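(* For a Noetherian ring $R$, the following statements are equivalent: (a) $R$ is a Jacobson ring. (b) For every subfinite $R$-algebra $A$ and every monomial preorder $\prec$, $\dim A$ is the supremum of the lengths of sequences in $A$ that are independent over $R$ with respect to $\prec$. (c) If $A \subseteq B$ is a pair of subfinite $R$-algebras ($A$ an $R$-subalgebra of $B$), then $\dim A \le \dim B$.
   Context: All rings and algebras are commutative with identity; $\dim$ denotes Krull dimension. A ring $R$ is a Jacobson ring if every prime ideal of $R$ is an intersection of maximal ideals. An $R$-algebra is called subfinite if it is a subalgebra of a finitely generated $R$-algebra. A strict weak order on a set $M$ is a binary relation $\prec$ such that for all $f,g,h \in M$ with $f \prec g$: (i) $f \prec h$ or $h \prec g$, and (ii) $g \not\prec f$. A monomial preorder is a strict weak order $\prec$ on the set of monomials in the variables $x_1,x_2,\ldots$ such that (iii) $1 \prec f$ for all monomials $f \neq 1$, and (iv) for all monomials $f,g,h$: $f \prec g$ if and only if $fh \prec gh$. For a polynomial $f$ over $R$, $\operatorname{in}_\prec(f)$ is the sum of all terms of $f$ whose monomials are minimal with respect to $\prec$ among the monomials appearing in $f$ (with $\operatorname{in}_\prec(0)=0$). A sequence $a_1,\ldots,a_s$ of elements of an $R$-algebra $A$ is dependent over $R$ with respect to $\prec$ if there exists a polynomial $f \in R[x_1,\ldots,x_s]$ with $f(a_1,\ldots,a_s)=0$ in $A$ such that $\operatorname{in}_\prec(f)$ has at least one coefficient that is invertible in $R$; otherwise it is independent over $R$ with respect to $\prec$. (Coefficients are taken with respect to all monomials, so $0$ counts as a coefficient;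 this matters only if $R$ is the zero ring.) Convention: in (b) the empty sequence ($s=0$, with $f \in R$ constant) is allowed, so it is independent over $R$ whenever $A \ne 0$; the supremum of the empty set and the dimension of the zero ring are both $-\infty$. *)

(* Defs.v *)
From HB Require Import structures.
From mathcomp Require Import all_boot all_order all_algebra finmap.
From mathcomp Require Import monalg.
From mathcomp Require Import boolp classical_sets constructive_ereal.
Set Implicit Arguments.
Unset Strict Implicit.
Unset Printing Implicit Defensive.
Import Order.TTheory GRing.Theory Num.Theory.
Local Open Scope classical_set_scope.
Local Open Scope ring_scope.

(* Rings are [comPzRingType]s, so the zero ring is included.  MathComp's algebra
   structures and [ring_quotient] ideals require a nonzero ring; hence ideals
   are plain sets here, and an R-algebra is a ring A together with its
   structure morphism [phi : {rmorphism R -> A}]. *)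

Section Ideals.
Context (A : comPzRingType).
Implicit Types (I P M : set A).

Definition is_ideal I : Prop :=
  [/\ I 0, (forall x y, I x -> I y -> I (x + y))
    & (forall a x, I x -> I (a * x))].

Definition prime_ideal P : Prop :=
  [/\ is_ideal P, ~ P 1 & (forall x y, P (x * y) -> P x \/ P y)].

Definition maximal_ideal M : Prop :=
  [/\ is_ideal M, M <> setT
    & (forall J, is_ideal J -> M `<=` J -> J = M \/ J = setT)].

Definition fg_ideal I : Prop :=
  exists (n : nat) (a : n.-tuple A),
    I = [set x | exists c : 'I_n -> A, x = \sum_(i < n) c i * tnth a i].

End Ideals.

Definition noetherian (A : comPzRingType) : Prop :=
  forall I : set A, is_ideal I -> fg_ideal I.

Definition jacobson (A : comPzRingType) : Prop :=
  forall P : set A, prime_ideal P ->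
    exists2 F : set (set A), F `<=` @maximal_ideal A & P = \bigcap_(M in F) M.

(* Suprema of sets of natural numbers are taken in {-oo} U Z U {+oo}; the first
   argument of [supremum] is its value at the empty set. *)
Definition nat_sup (S : set nat) : \bar int :=
  supremum -oo%E [set n%:Z%:E%E | n in S].

Definition prime_chain (A : comPzRingType) (n : nat) : Prop :=
  exists2 P : 'I_n.+1 -> set A,
    (forall i, prime_ideal (P i))
    & (forall i j : 'I_n.+1, (i < j)%N -> P i `<` P j).

Definition krull_dim (A : comPzRingType) : \bar int :=
  nat_sup [set n | prime_chain A n].

(* Monomials in the variables x_1, x_2, ... are the finitely supported exponent
   functions [{cmonom nat}]; the variable x_i has index i - 1. *)
Notation monomial := {cmonom nat}.

Definition strict_weak_order (T : Type) (prec : T -> T -> Prop) : Prop :=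
  forall f g h : T, prec f g -> (prec f h \/ prec h g) /\ ~ prec g f.

Definition monomial_preorder (prec : monomial -> monomial -> Prop) : Prop :=
  [/\ strict_weak_order prec,
      (forall f : monomial, f <> mone -> prec mone f)
    & (forall f g h : monomial, prec f g <-> prec (mmul f h) (mmul g h))].

(* Polynomials over R are the finitely supported families [{malg R[monomial]}]
   of coefficients: this additive group is defined also if R is zero, whereas
   its ring structure and [mmap] are only available over nonzero rings. *)
Section Polynomials.
Context (R : comPzRingType).
Implicit Type f : {malg R[monomial]}.

Definition in_vars (s : nat) f : Prop :=
  forall m : monomial, m \in msupp f -> forall i, (s <= i)%N -> m i = 0%N.

Definition poly_eval (A : comPzRingType) (phi : {rmorphism R -> A})
    (s : nat) (a : s.-tuple A) f : A :=
  \sum_(m <- msupp f) phi (f@_m) * \prod_(i < s) tnth a i ^+ m i.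

Definition initial_form (prec : monomial -> monomial -> Prop) f :
    {malg R[monomial]} :=
  \sum_(m <- msupp f | `[< forall m', m' \in msupp f -> ~ prec m' m >])
     << f@_m *g m >>.

End Polynomials.

Definition invertible (R : comPzRingType) (x : R) : Prop :=
  exists y : R, y * x = 1.

Definition dependent (R A : comPzRingType) (phi : {rmorphism R -> A})
    (prec : monomial -> monomial -> Prop) (s : nat) (a : s.-tuple A) : Prop :=
  exists f : {malg R[monomial]},
    [/\ in_vars s f, poly_eval phi a f = 0
      & exists m : monomial, invertible ((initial_form prec f)@_m)].

Definition independent (R A : comPzRingType) (phi : {rmorphism R -> A})
    (prec : monomial -> monomial -> Prop) (s : nat) (a : s.-tuple A) : Prop :=
  ~ dependent phi prec a.

Definition fg_algebra (R B : comPzRingType) (psi : {rmorphism R -> B}) : Prop :=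
  exists (s : nat) (b : s.-tuple B), forall x : B,
    exists2 f : {malg R[monomial]}, in_vars s f & poly_eval psi b f = x.

(* Subalgebras are given by injective R-algebra morphisms. *)
Definition alg_embedding (R A B : comPzRingType) (phi : {rmorphism R -> A})
    (psi : {rmorphism R -> B}) (iota : {rmorphism A -> B}) : Prop :=
  (forall r, iota (phi r) = psi r) /\ injective iota.

Definition subfinite (R A : comPzRingType) (phi : {rmorphism R -> A}) : Prop :=
  exists (B : comPzRingType) (psi : {rmorphism R -> B})
    (iota : {rmorphism A -> B}), alg_embedding phi psi iota /\ fg_algebra psi.

(* Main.v *)
Require Import Defs.
From HB Require Import structures.
From mathcomp Require Import all_boot all_order all_algebra finmap.
From mathcomp Require Import monalg.
From mathcomp Require Import boolp classical_sets constructive_ereal.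
From mathcomp Require Import ring lra zify.
Set Implicit Arguments.
Unset Strict Implicit.
Unset Printing Implicit Defensive.
Import Order.TTheory GRing.Theory Num.Theory generic_quotient.
Local Open Scope classical_set_scope.
Local Open Scope ring_scope.

(** Why the three statements are equivalent.

    From (c) to (a) ([monotone_dimension_jacobson]).  If [R] is not Jacobson, it
    has a prime [Q] which is not maximal, and an element [x] outside [Q], such
    that every ideal strictly above [Q] contains a power of [x].  Hence [1 / x]
    generates the field of fractions [K] of [R / Q] as an [R]-algebra, and
    [R / Q], of dimension at least 1, is subfinite and embedded in [K], of
    dimension 0.

    From (b) to (c).  An embedding creates no new relations, so that it preserves
    independence ([independent_mono]); take any monomial preorder, for
    instance the comparison of total degrees.

    From (a) to (b) ([jacobson_dimension]).  It is enough to show, for each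
    preorder and each [s], that [A] has a chain of primes of length [s] if and
    only if it has an independent sequence of length [s].

    - From chains to sequences ([chain_independent], for any Noetherian ring).
      Choosing an element in each step of the chain, pull it back to
      [C = R[X_0, .., X_(s-1)]], and let [h >= s] be the maximal length of a
      chain between its ends [P] and [M].  Then [M] is minimal over [P] and some
      [h] elements of [M] ([parameters]).  In a relation among such parameters
      modulo [P], the coefficients at minimal monomials lie in [M], hence are not
      invertible ([parameters_independent]).  For finitely many monomials the
      preorder is dominated by positive integral weights ([weights], from
      Fourier-Motzkin elimination), and for weights the claim follows from the
      height theorem, applied to the degeneration of [C] along the weighted
      filtration by the parameters.

    - From sequences to chains ([independent_prime_chain]).  Refine the preorder to
      a total one.  The polynomials whose lowest term is a bare monomial form a
      multiplicative set, and independence says that it misses the kernel of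
      [C -> A]; so some prime [P] above the kernel misses it ([initial_prime]).
      The core of the argument is that there is a chain of length [s] above
      [P] in [C] ([independent_chain]).  Let [L_e] be the ideal of the [c] for
      which [c X^e] is, modulo [P], a combination of larger monomials.  These
      ideals are proper and increase with [e] for divisibility, so they lie in
      one prime [M].  Noetherianity and Dickson's lemma reduce all of them to
      finitely many, so that integral weights may again replace the
      preorder ([compatible_weights]), and then the coefficients of a weighted
      homogeneous relation modulo [P] are in [M] ([homogeneous_relation], by
      Krull's intersection theorem).  Consequently the blow-up of suitable powers
      of the [X_i] has an [s - 1]-dimensional fibre over [M], which forces a
      chain of length [s] between [P] and [M] ([blowup_chain], [long_chain]).

      It remains to move a chain from [C] to [A], and here the Jacobson property
      is used ([lift_chain]).  Embed [A] in a finitely generated algebra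
      [B], a quotient of a polynomial ring [C[Z]].  Over a prime of [C], chains of
      primes lift to [C[Z]] provided that they avoid a certain element [h]
      ([lifting_pconst]).  All members of a chain except the last can be
      moved off [h] ([chain_avoiding]), and the last one can be replaced by
      a maximal ideal which avoids [h], because [C] is a Jacobson ring too
      ([maximal_separation_poly]).

    Algebras over a zero ring are zero and their case is immediate; all other
    rings are viewed as nonzero ones ([nonzero_pz_nz]) in order to have
    polynomials and fractions. *)

(** * Ideals and primes *)

Section IdealBasics.
Context (A : comPzRingType).
Implicit Types (I J K P Q M S : set A) (x y z : A).

Lemma ideal0 I : is_ideal I -> I 0. Proof. by case. Qed.
Lemma idealD I x y : is_ideal I -> I x -> I y -> I (x + y).
Proof. by case=> _ h _; exact: h. Qed.
Lemma idealM I x y : is_ideal I -> I x -> I (y * x).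
Proof. by case=> _ _ h; exact: h. Qed.
Lemma idealMr I x y : is_ideal I -> I x -> I (x * y).
Proof. by move=> iI Ix; rewrite mulrC; apply: idealM. Qed.
Lemma idealN I x : is_ideal I -> I x -> I (- x).
Proof. by move=> iI Ix; rewrite -mulN1r; apply: idealM. Qed.
Lemma idealB I x y : is_ideal I -> I x -> I y -> I (x - y).
Proof. by move=> iI Ix Iy; apply: idealD => //; apply: idealN. Qed.
Lemma ideal_subl I x y : is_ideal I -> I y -> I (x + y) -> I x.
Proof. by move=> iI Iy Ixy; rewrite -(addrK y x); apply: idealB. Qed.
Lemma ideal_sum I (T : Type) (r : seq T) (Q : pred T) (F : T -> A) :
  is_ideal I -> (forall i, Q i -> I (F i)) -> I (\sum_(i <- r | Q i) F i).
Proof.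
move=> iI IF; elim/big_rec: _ => [|i x Qi Ix]; first exact: ideal0.
by apply: idealD => //; apply: IF.
Qed.

Lemma prime_is_ideal P : prime_ideal P -> is_ideal P. Proof. by case. Qed.
Lemma primeM P x y : prime_ideal P -> P (x * y) -> P x \/ P y.
Proof. by case=> _ _ h; exact: h. Qed.
Lemma prime1 P : prime_ideal P -> ~ P 1. Proof. by case. Qed.
Lemma primeX P x n : prime_ideal P -> P (x ^+ n) -> P x.
Proof.
move=> pP; elim: n => [|n IH]; first by rewrite expr0 => /(prime1 pP).
by rewrite exprS => /(primeM pP)[].
Qed.
Lemma primeMn P x y : prime_ideal P -> ~ P x -> ~ P y -> ~ P (x * y).
Proof. by move=> pP nx ny /(primeM pP)[]. Qed.
Lemma primeXn P x n : prime_ideal P -> ~ P x -> ~ P (x ^+ n).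
Proof. by move=> pP nx /(primeX pP). Qed.
Lemma proper_not1 I : is_ideal I -> I <> setT -> ~ I 1.
Proof.
move=> iI nT I1; apply: nT; apply/seteqP; split=> // x _.
by rewrite -(mulr1 x); apply: idealM.
Qed.

Lemma setT_ideal : is_ideal (@setT A). Proof. by []. Qed.

(** The ideal [I + (x)]. *)
Definition adj I x : set A := [set z | exists c, I (z - c * x)].

Lemma adj_ideal I x : is_ideal I -> is_ideal (adj I x).
Proof.
move=> iI; split.
- by exists 0; rewrite mul0r subr0; apply: ideal0.
- move=> y z [c Ic] [d Id]; exists (c + d).
  have -> : y + z - (c + d) * x = (y - c * x) + (z - d * x) by ring.
  exact: idealD.
- move=> a y [c Ic]; exists (a * c).
  have -> : a * y - a * c * x = a * (y - c * x) by ring.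
  exact: idealM.
Qed.

Lemma sub_adj I x : I `<=` adj I x.
Proof. by move=> y Iy; exists 0; rewrite mul0r subr0. Qed.

Lemma mem_adj I x : is_ideal I -> adj I x x.
Proof. by move=> iI; exists 1; rewrite mul1r subrr; apply: ideal0. Qed.

Lemma adj_sub I J x : is_ideal J -> I `<=` J -> J x -> adj I x `<=` J.
Proof.
move=> iJ IJ Jx y [c /IJ h]; rewrite -(subrK (c * x) y).
by apply: idealD => //; apply: idealM.
Qed.

Definition colon I x : set A := [set z | I (z * x)].

Lemma colon_ideal I x : is_ideal I -> is_ideal (colon I x).
Proof.
move=> iI; rewrite /colon; split => /=.
- by rewrite mul0r; apply: ideal0.
- by move=> y z h1 h2; rewrite mulrDl; apply: idealD.
- by move=> a y h; rewrite -mulrA; apply: idealM.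
Qed.

Lemma sub_colon I x : is_ideal I -> I `<=` colon I x.
Proof. by move=> iI y Iy; apply: idealMr. Qed.

Definition multiplicative S := S 1 /\ forall x y, S x -> S y -> S (x * y).

Lemma bigcup_ideal (F : set (set A)) :
  F !=set0 -> (forall J, F J -> is_ideal J) -> total_on F subset ->
  is_ideal (\bigcup_(X in F) X).
Proof.
move=> [J0 FJ0] FI tot; split.
- by exists J0 => //; apply: ideal0; apply: FI.
- move=> x y [X FX Xx] [Y FY Yy]; case: (tot _ _ FX FY) => h.
  + by exists Y => //; apply: idealD => //; [apply: FI|apply: h].
  + by exists X => //; apply: idealD => //; [apply: FI|apply: h].
- by move=> a x [X FX Xx]; exists X => //; apply: idealM => //; apply: FI.
Qed.

(** Zorn's lemma for ideals above [I].  Unions with [I] are taken so that the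
    empty chain, whose union is empty, is covered too. *)
Lemma maximal_ideal_exists (Q : set (set A)) I : is_ideal I -> Q I ->
  (forall F : set (set A), F !=set0 -> total_on F subset ->
     (forall J, F J -> [/\ is_ideal J, I `<=` J & Q J]) ->
     Q (\bigcup_(X in F) X)) ->
  exists M, [/\ is_ideal M, I `<=` M, Q M &
    forall J, is_ideal J -> M `<` J -> ~ Q J].
Proof.
move=> iI QI Qcup.
pose good J := [/\ is_ideal (I `|` J) & Q (I `|` J)].
have [F Fgood Ftot|M [[iM QM] Mmax]] := @Zorn_bigcup A good.
  have [->|/set0P [J0 FJ0]] := eqVneq F set0.
    by rewrite bigcup_set0 /good setU0.
  set G := [set I `|` X | X in F].
  have Gn0 : G !=set0 by exists (I `|` J0), J0.
  have Gtot : total_on G subset.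
    move=> _ _ [X FX <-] [Y FY <-] /=.
    by case: (Ftot _ _ FX FY) => h; [left|right]; exact: setUS.
  have Gg : forall J, G J -> [/\ is_ideal J, I `<=` J & Q J].
    by move=> _ [X FX <-]; have [? ?] := Fgood _ FX; split=> // x Ix; left.
  have e : I `|` \bigcup_(X in F) X = \bigcup_(Y in G) Y.
    apply/seteqP; split=> x.
    - case=> [Ix|[X FX Xx]].
      + by exists (I `|` J0); [exists J0|left].
      + by exists (I `|` X); [exists X|right].
    - case=> _ [X FX <-] [Ix|Xx]; first by left.
      by right; exists X.
  rewrite /good e; split; last exact: Qcup.
  by apply: bigcup_ideal => // J /Gg[].
exists (I `|` M); split=> //.
move=> J iJ [MJ nJM] QJ.
have e : I `|` J = J by apply/setUidPr => x Ix; apply: MJ; left.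
apply: (Mmax J); last by rewrite /good e.
split; first by move=> x Mx; apply: MJ; right.
by move=> JM; apply: nJM => x /JM; right.
Qed.

(** Krull's argument: if [x] and [y] are not in an ideal [P] which is maximal among
    those missing [S], then [P + (x)] and [P + (y)] meet [S], and the product of
    such elements would be in [P] if [x * y] were.  The last clause keeps the
    maximality of [P], from which such primes get their special properties. *)
Lemma prime_avoiding I S : is_ideal I -> multiplicative S ->
  (forall x, I x -> ~ S x) ->
  exists P, [/\ prime_ideal P, I `<=` P, (forall x, P x -> ~ S x) &
    forall J, is_ideal J -> P `<` J -> exists2 x, J x & S x].
Proof.
move=> iI [S1 SM] IS.
have [|F [J0 FJ0] Ftot FI|M [iM IM MS Mmax]] :=
    @maximal_ideal_exists [set J | forall x, J x -> ~ S x] I iI.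
- exact: IS.
- by move=> x [J /FI[_ _ JS] Jx]; apply: JS.
have Mm J : is_ideal J -> M `<` J -> exists2 x, J x & S x.
  move=> iJ MJ; have /existsNP[x /not_implyP[Jx /contrapT Sx]] := Mmax _ iJ MJ.
  by exists x.
exists M; split=> //; split=> //; first by move=> /MS.
move=> x y Mxy; apply: contrapT => /not_orP[nx ny].
have adjM z : ~ M z -> exists2 u, adj M z u & S u.
  move=> nz; apply: Mm; first exact: adj_ideal.
  split; first exact: sub_adj.
  by move=> /(_ z) h; apply: nz; apply: h; apply: mem_adj.
have [u [c Mu] Su] := adjM _ nx; have [v [d Mv] Sv] := adjM _ ny.
apply: (MS (u * v)); last exact: SM.
have -> : u * v = (u - c * x) * v + (v - d * y) * (c * x) + c * d * (x * y) by ring.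
by apply: idealD => //; [apply: idealD => //; apply: idealMr|apply: idealM].
Qed.
Lemma prime_above I : is_ideal I -> ~ I 1 ->
  exists P, prime_ideal P /\ I `<=` P.
Proof.
move=> iI nI1; have [||P [pP IP _ _]] := @prime_avoiding I [set 1] iI.
- by split=> // x y -> ->; rewrite mulr1.
- by move=> x Ix x1; apply: nI1; rewrite -x1.
- by exists P.
Qed.

Lemma maximal_prime M : maximal_ideal M -> prime_ideal M.
Proof.
case=> iM nM Mmax; split=> //; first exact: proper_not1.
move=> x y Mxy; apply: contrapT => /not_orP[nx ny].
have [e|e] := Mmax (adj M x) (adj_ideal x iM) (@sub_adj M x).
  by apply: nx; rewrite -e; apply: mem_adj.
have [c Mc] : adj M x 1 by rewrite e.
apply: ny; have -> : y = (1 - c * x) * y + c * (x * y) by ring.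
by apply: idealD => //; [apply: idealMr|apply: idealM].
Qed.

End IdealBasics.

Lemma preimage_prime (A B : comPzRingType) (f : {rmorphism A -> B}) (Q : set B) :
  prime_ideal Q -> prime_ideal (f @^-1` Q).
Proof.
move=> pQ; have iQ := prime_is_ideal pQ; split=> [|/=|x y /=].
- split=> [|x y|a x] /=; rewrite ?rmorph0 ?rmorphD ?rmorphM.
  + exact: (ideal0 iQ).
  + exact: (idealD iQ).
  + exact: (idealM _ iQ).
- by rewrite rmorph1; apply: prime1.
- by rewrite rmorphM; apply: primeM.
Qed.

(** A surjective morphism whose kernel lies in [Q] identifies [Q] with its image. *)
Lemma image_prime (C D : comPzRingType) (f : {rmorphism C -> D}) (Q : set C) :
  (forall y, exists x, f x = y) -> (forall x, f x = 0 -> Q x) -> prime_ideal Q ->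
  prime_ideal (f @` Q).
Proof.
move=> fs kQ pQ; have iQ := prime_is_ideal pQ.
have mem x : (f @` Q) (f x) -> Q x.
  move=> [y Qy fy]; rewrite -(subrK y x); apply: idealD => //.
  by apply: kQ; rewrite rmorphB fy subrr.
split.
- split.
  + by exists 0; [apply: ideal0|rewrite rmorph0].
  + move=> _ _ [x Qx <-] [y Qy <-]; exists (x + y); first exact: idealD.
    by rewrite rmorphD.
  + move=> d _ [x Qx <-]; have [c <-] := fs d; exists (c * x); first exact: idealM.
    by rewrite rmorphM.
- by rewrite -(rmorph1 f) => /mem; apply: prime1.
- move=> u v; have [x <-] := fs u; have [y <-] := fs v.
  rewrite -rmorphM => /mem/(primeM pQ)[h|h]; [left|right]; exact: imageP.
Qed.

Definition ideal_gen (A : comPzRingType) (S : set A) : set A :=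
  [set z | forall J, is_ideal J -> S `<=` J -> J z].

Section Generated.
Context (A : comPzRingType).
Implicit Types (S : set A).

Lemma ideal_gen_ideal S : is_ideal (ideal_gen S).
Proof.
split=> [J iJ _|u v Iu Iv J iJ h|a u Iu J iJ h]; first exact: ideal0.
- by apply: idealD => //; [apply: Iu|apply: Iv].
- by apply: idealM => //; apply: Iu.
Qed.

Lemma sub_ideal_gen S : S `<=` ideal_gen S.
Proof. by move=> x Sx J _; apply. Qed.

Lemma ideal_gen_min S J : is_ideal J -> S `<=` J -> ideal_gen S `<=` J.
Proof. by move=> iJ SJ x; apply. Qed.

Lemma ideal_genS S S' : S `<=` S' -> ideal_gen S `<=` ideal_gen S'.
Proof.
by move=> h; apply: ideal_gen_min; [apply: ideal_gen_ideal|apply: (subset_trans h); apply: sub_ideal_gen].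
Qed.
End Generated.

(** * Noetherian rings: minimal primes and prime avoidance *)

(** Equivalent to Noetherianity; unlike finite generation of ideals, this form passes easily
    to polynomials and gives maximal elements of families of ideals. *)
Definition acc (A : comPzRingType) : Prop :=
  forall J : nat -> set A, (forall n, is_ideal (J n)) ->
    (forall n, J n `<=` J n.+1) -> exists N, forall n, (N <= n)%N -> J n `<=` J N.

Lemma dependent_choice (T : Type) (R : nat -> T -> T -> Prop) (x0 : T) :
  (forall n x, exists y, R n x y) ->
  exists f : nat -> T, f 0%N = x0 /\ forall n, R n (f n) (f n.+1).
Proof.
move=> h; have [g gP] : exists g : nat -> T -> T, forall n x, R n x (g n x).
  have [g gP] := choice (fun nx : nat * T => h nx.1 nx.2).
  by exists (fun n x => g (n, x)) => n x; apply: (gP (n, x)).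
exists (fix f n := if n is n'.+1 then g n' (f n') else x0); split=> //.
Qed.

Lemma In_cat (T : Type) (r s : seq T) x :
  List.In x (r ++ s) <-> List.In x r \/ List.In x s.
Proof. by elim: r => [|y r IH] /=; [|rewrite IH]; tauto. Qed.

Lemma In_filter (T : Type) (p : T -> Prop) (r : seq T) :
  exists r', forall x, List.In x r' <-> List.In x r /\ p x.
Proof.
elim: r => [|y r [r' IH]]; first by exists [::] => x; split=> // -[].
have [py|npy] := pselect (p y); last first.
  exists r' => x /=; rewrite IH; split=> [[? ?]|[[<- //|? ?]]]; split=> //; by right.
exists (y :: r') => x /=; rewrite IH.
by split=> [[<-|[? ?]]|[[<-|?] ?]]; [split=> //; left|split=> //; right|left|right].
Qed.

Section Noetherian.
Context (A : comPzRingType).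
Implicit Types (I J K P Q M : set A) (x y z : A).

Lemma chain_le (J : nat -> set A) : (forall n, J n `<=` J n.+1) ->
  forall m n, (m <= n)%N -> J m `<=` J n.
Proof.
move=> h m n /subnK <-; elim: (n - m)%N => [|k IH] //=.
by apply: (subset_trans IH); rewrite addSn; apply: h.
Qed.

Lemma noetherian_acc : noetherian A -> acc A.
Proof.
move=> nA J iJ incJ.
pose U := \bigcup_n J n.
have iU : is_ideal U.
  split; first by exists 0%N => //; apply: ideal0.
  - move=> x y [m _ Jx] [n _ Jy]; exists (maxn m n) => //.
    by apply: idealD => //; [apply: (chain_le incJ (leq_maxl m n))
                            |apply: (chain_le incJ (leq_maxr m n))].
  - by move=> a x [m _ Jx]; exists m => //; apply: idealM.
have [k [a Ua]] := nA _ iU.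
have mem i : U (tnth a i).
  rewrite Ua; exists (fun j => (j == i)%:R).
  rewrite (bigD1 i) //= eqxx mul1r big1 ?addr0 // => j /negbTE ->.
  by rewrite mul0r.
have exJ i : exists m, J m (tnth a i) by have [m _ h] := mem i; exists m.
have [f fP] := choice exJ.
exists (\max_(i < k) f i)%N => n _ x Jx.
have : U x by exists n.
rewrite Ua => -[c ->]; apply: ideal_sum => // i _; apply: idealM => //.
exact: (chain_le incJ (leq_bigmax i)).
Qed.

Lemma acc_max (F : set (set A)) : acc A -> F !=set0 ->
  (forall J, F J -> is_ideal J) ->
  exists2 M, F M & forall J, F J -> M `<=` J -> J `<=` M.
Proof.
move=> aA [J0 FJ0] FI; apply: contrapT => nmax.
have step (n : nat) (J : {J | F J}) : exists K : {J | F J},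
    sval J `<=` sval K /\ ~ sval K `<=` sval J.
  apply: contrapT => h; apply: nmax; exists (sval J); first exact: (svalP J).
  move=> K FK JK; apply: contrapT => nKJ; apply: h.
  by exists (exist _ K FK).
have [f [_ fP]] := dependent_choice (exist _ J0 FJ0) step.
have [||N hN] := aA (fun n => sval (f n)).
- by move=> n; apply: FI; apply: (svalP (f n)).
- by move=> n; case: (fP n).
by case: (fP N) => _; apply; apply: hN.
Qed.

(** Noetherian induction. *)
Lemma acc_ind (Q : set A -> Prop) : acc A ->
  (forall I, is_ideal I -> (forall J, is_ideal J -> I `<` J -> Q J) -> Q I) ->
  forall I, is_ideal I -> Q I.
Proof.
move=> aA step I iI; apply: contrapT => nQ.
have [||M [iM nQM] Mmax] := @acc_max [set J | is_ideal J /\ ~ Q J] aA.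
- by exists I.
- by move=> J [].
apply: nQM; apply: step => // J iJ [MJ nJM]; apply: contrapT => nQJ.
by apply: nJM; apply: Mmax.
Qed.

Lemma not_prime_witness I : is_ideal I -> ~ I 1 -> ~ prime_ideal I ->
  exists a b, [/\ I (a * b), ~ I a & ~ I b].
Proof.
move=> iI nI1 np; apply: contrapT => h; apply: np; split=> // a b Iab.
apply: contrapT => /not_orP[na nb]; apply: h; by exists a, b.
Qed.

Lemma adj_proper I x : is_ideal I -> ~ I x -> I `<` adj I x.
Proof.
move=> iI nx; split; first exact: sub_adj.
by move=> /(_ x) h; apply: nx; apply: h; apply: mem_adj.
Qed.

(** The list contains all minimal primes of [I].  By Noetherian induction: if [I] is
    not prime, [a * b] is in [I] for some [a] and [b] outside it, and the primes
    above [I] are those above [I + (a)] or [I + (b)]. *)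
Lemma finitely_many_primes I : acc A -> is_ideal I ->
  exists Qs : seq (set A),
    (forall Q, List.In Q Qs -> prime_ideal Q /\ I `<=` Q) /\
    (forall P, prime_ideal P -> I `<=` P -> exists2 Q, List.In Q Qs & Q `<=` P).
Proof.
move=> aA iI; move: I iI; apply: (acc_ind aA) => I iI IH.
have [I1|nI1] := pselect (I 1).
  exists [::]; split=> [Q []|P pP IP].
  by case: (prime1 pP (IP _ I1)).
have [pI|npI] := pselect (prime_ideal I).
  exists [:: I]; split; first by move=> Q [<-|[]]; split.
  by move=> P pP IP; exists I => //; left.
have [a [b [Iab na nb]]] := not_prime_witness iI nI1 npI.
have [Q1 [Q1p Q1m]] := IH _ (adj_ideal a iI) (adj_proper iI na).
have [Q2 [Q2p Q2m]] := IH _ (adj_ideal b iI) (adj_proper iI nb).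
exists (Q1 ++ Q2); split.
  move=> Q /In_cat [Qin|Qin].
  - have [pQ IQ] := Q1p Q Qin; split=> //.
    by apply: subset_trans IQ; apply: sub_adj.
  - have [pQ IQ] := Q2p Q Qin; split=> //.
    by apply: subset_trans IQ; apply: sub_adj.
move=> P pP IP; case: (primeM pP (IP _ Iab)) => hP.
- have [Q h1 h2] := Q1m P pP (adj_sub (prime_is_ideal pP) IP hP).
  by exists Q => //; apply/In_cat; left.
- have [Q h1 h2] := Q2m P pP (adj_sub (prime_is_ideal pP) IP hP).
  by exists Q => //; apply/In_cat; right.
Qed.

Lemma seq_minimal (Qs : seq (set A)) Q0 : List.In Q0 Qs ->
  exists Q, [/\ List.In Q Qs, Q `<=` Q0 &
    forall Q', List.In Q' Qs -> Q' `<=` Q -> Q `<=` Q'].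
Proof.
elim: Qs Q0 => [|Q1 Qs IH] Q0 //= Q0in.
have [[Q [Qin QQ1]]|h] := pselect (exists Q, List.In Q Qs /\ Q `<=` Q1).
  have [R [Rin RQ Rmin]] : exists R, [/\ List.In R Qs, R `<=` Q0 &
      forall Q', List.In Q' Qs -> Q' `<=` R -> R `<=` Q'].
    case: Q0in => [<-|/IH //].
    by have [R [? RQ ?]] := IH _ Qin; exists R; split=> //; apply: subset_trans QQ1.
  exists R; split=> //; first by right.
  move=> Q' [<-|Q'in] Q'R; last exact: Rmin.
  have : Q `<=` R by apply: subset_trans Q'R.
  by move=> /(Rmin _ Qin) RQ2; apply: subset_trans QQ1.
case: Q0in => [<-|/IH [R [Rin RQ Rmin]]].
  exists Q1; split=> //; first by left.
  by move=> Q' [<- //|Q'in] Q'Q1; exfalso; apply: h; exists Q'.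
have [Q1R|nQ1R] := pselect (Q1 `<=` R).
  exists Q1; split; [by left|exact: subset_trans RQ|].
  by move=> Q' [<- //|Q'in] Q'Q1; exfalso; apply: h; exists Q'.
exists R; split=> //; first by right.
by move=> Q' [<- /nQ1R //|Q'in]; apply: Rmin.
Qed.

Lemma minimal_prime I M : acc A -> is_ideal I -> prime_ideal M -> I `<=` M ->
  exists Q, [/\ prime_ideal Q, I `<=` Q, Q `<=` M &
    forall Q', prime_ideal Q' -> I `<=` Q' -> Q' `<=` Q -> Q' = Q].
Proof.
move=> aA iI pM IM; have [Qs [Qp Qm]] := finitely_many_primes aA iI.
have [Q0 Q0in Q0M] := Qm M pM IM.
have [Q [Qin QQ0 Qmin]] := seq_minimal Q0in.
have [pQ IQ] := Qp _ Qin.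
exists Q; split=> //; first exact: subset_trans Q0M.
move=> Q' pQ' IQ' Q'Q; apply/seteqP; split=> //.
have [R Rin RQ'] := Qm _ pQ' IQ'.
apply: (subset_trans _ RQ'); apply: Qmin => //.
exact: (subset_trans RQ' Q'Q).
Qed.

(** By induction on the list: if [y] avoids all the primes except the first
    one, correct it by an element of [J] which is not in the first one but in all
    those where this could spoil [y]. *)
Lemma prime_avoidance (Qs : seq (set A)) J : is_ideal J ->
  (forall Q, List.In Q Qs -> prime_ideal Q) ->
  (forall Q, List.In Q Qs -> ~ J `<=` Q) ->
  exists2 y, J y & forall Q, List.In Q Qs -> ~ Q y.
Proof.
move=> iJ; elim: Qs => [|Q1 Qs IH] pQ nJ; first by exists 0; [apply: ideal0|].
have [||y Jy ny] := IH.
- by move=> Q Qin; apply: pQ; right.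
- by move=> Q Qin; apply: nJ; right.
have pQ1 : prime_ideal Q1 by apply: pQ; left.
have [Q1y|nQ1y] := pselect (Q1 y); last first.
  by exists y => // Q [<- //|/ny].
(* The primes contained in [Q1] miss [y + z] as soon as [Q1] does. *)
have [z [Jz nQ1z zQ]] : exists z, [/\ J z, ~ Q1 z &
    forall Q, List.In Q Qs -> ~ Q `<=` Q1 -> Q z].
  have [j [Jj nj]] : exists j, J j /\ ~ Q1 j.
    apply: contrapT => h; apply: (nJ Q1); first by left.
    by move=> j Jj; apply: contrapT => nj; apply: h; exists j.
  have {IH ny nJ pQ}: forall Q, List.In Q Qs -> prime_ideal Q.
    by move=> Q Qin; apply: pQ; right.
  elim: Qs => [|Q Qs IH] pQ; first by exists j.
  have [|z [Jz nz zQ]] := IH; first by move=> R Rin; apply: pQ; right.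
  have [QQ1|nQQ1] := pselect (Q `<=` Q1).
    by exists z; split=> // R [<- //|]; apply: zQ.
  have [q [Qq nq]] : exists q, Q q /\ ~ Q1 q.
    apply: contrapT => h; apply: nQQ1 => q Qq; apply: contrapT => nq; apply: h.
    by exists q.
  exists (q * z); split; [exact: idealM|exact: primeMn|].
  move=> R Rin RQ1; have iR : is_ideal R by apply: prime_is_ideal; apply: pQ.
  case: Rin => [eR|Rin]; first by apply: idealMr => //; rewrite -eR.
  by apply: idealM => //; apply: zQ.
exists (y + z); first exact: idealD.
move=> Q [<-|Qin] h.
  apply: nQ1z; apply: (ideal_subl (prime_is_ideal pQ1) Q1y); by rewrite addrC.
have iQ : is_ideal Q by apply: prime_is_ideal; apply: pQ; right.
have [QQ1|nQQ1] := pselect (Q `<=` Q1).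
  apply: nQ1z; apply: (ideal_subl (prime_is_ideal pQ1) Q1y).
  by rewrite addrC; apply: QQ1.
by apply: (ny _ Qin); apply: (ideal_subl iQ (zQ _ Qin nQQ1)).
Qed.

End Noetherian.

(** * Krull's principal ideal theorem *)

Section PrincipalIdeal.
Context (A : comPzRingType).
Implicit Types (I J K P Q M : set A) (x y z t : A).

(** The contraction to [A] of the extension of [I] to the localization at [P]. *)
Definition sat P I : set A := [set z | exists t, ~ P t /\ I (t * z)].

Lemma sat_ideal P I : prime_ideal P -> is_ideal I -> is_ideal (sat P I).
Proof.
move=> pP iI; split.
- by exists 1; split; [apply: prime1|rewrite mulr0; apply: ideal0].
- move=> x y [t [nt It]] [u [nu Iu]]; exists (t * u); split; first exact: primeMn.
  have -> : t * u * (x + y) = u * (t * x) + t * (u * y) by ring.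
  by apply: idealD => //; apply: idealM.
- move=> a x [t [nt It]]; exists t; split=> //.
  have -> : t * (a * x) = a * (t * x) by ring.
  exact: idealM.
Qed.

Lemma sub_sat P I : prime_ideal P -> I `<=` sat P I.
Proof. by move=> pP x Ix; exists 1; rewrite mul1r; split; [apply: prime1|]. Qed.

Lemma satS P I J : I `<=` J -> sat P I `<=` sat P J.
Proof. by move=> IJ x [t [nt It]]; exists t; split=> //; apply: IJ. Qed.

Lemma sat_sat P I : prime_ideal P -> sat P (sat P I) `<=` sat P I.
Proof.
move=> pP x [t [nt [u [nu Iu]]]]; exists (u * t); split; first exact: primeMn.
by rewrite -mulrA.
Qed.

(** The descending chain condition for the ideals of the localization at [P] of
    [A / I]: that ring is Artinian. *)
Definition sat_dcc P I : Prop :=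
  forall J : nat -> set A, (forall n, is_ideal (J n)) ->
    (forall n, sat P (J n) `<=` J n) -> (forall n, I `<=` J n) ->
    (forall n, J n.+1 `<=` J n) ->
    exists N, forall n, (N <= n)%N -> J N `<=` J n.

Lemma dchain_le (J : nat -> set A) : (forall n, J n.+1 `<=` J n) ->
  forall m n, (m <= n)%N -> J n `<=` J m.
Proof.
move=> h m n /subnK <-; elim: (n - m)%N => [|k IH] //=.
by rewrite addSn; apply: subset_trans IH; apply: h.
Qed.

(** A Noetherian local ring with only one prime is Artinian.  By Noetherian
    induction on [I]: when [a * b] is in [I] with [a] and [b] outside, a decreasing
    sequence [J n] is determined by the two sequences [J n + (a)] and [J n : a], which
    are above the larger ideals [I + (a)] and [I : a]. *)
Lemma sat_dccP P I0 : acc A -> prime_ideal P -> is_ideal I0 ->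
  (forall Q, prime_ideal Q -> I0 `<=` Q -> Q `<=` P -> Q = P) ->
  sat_dcc P I0.
Proof.
move=> aA pP iI0 Pmin; suff : forall I, is_ideal I -> I0 `<=` I -> sat_dcc P I by apply.
apply: (acc_ind aA) => I iI IH I0I.
have bigger K : is_ideal K -> I `<` K -> sat_dcc P K.
  by move=> iK IK; apply: IH => //; apply: (subset_trans I0I); case: IK.
have [e|e] := pselect (sat P I `<=` I); last first.
  have h : sat_dcc P (sat P I).
    by apply: bigger; [exact: sat_ideal|split=> //; exact: sub_sat].
  move=> J iJ sJ IJ dJ; apply: h => // n.
  by apply: (subset_trans _ (sJ n)); apply: satS.
have [IP|nIP] := pselect (I `<=` P); last first.
  have [t [It nPt]] : exists t, I t /\ ~ P t.
    apply: contrapT => h; apply: nIP => t It; apply: contrapT => nt.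
    by apply: h; exists t.
  have I1 : I 1 by apply: e; exists t; rewrite mulr1.
  move=> J iJ _ IJ _; exists 0%N => n _ x _.
  by rewrite -(mulr1 x); apply: idealM => //; apply: IJ.
have nI1 : ~ I 1 by move=> /IP; apply: prime1.
have [pI|npI] := pselect (prime_ideal I).
  have IeP : I = P by apply: Pmin.
  move=> J iJ sJ IJ dJ.
  have [[N JN]|h] := pselect (exists N, J N `<=` P).
    exists N => n _; apply: (subset_trans JN); rewrite -IeP; exact: IJ.
  exists 0%N => n _ x _; rewrite -(mulr1 x); apply: idealM => //.
  apply: sJ; apply: contrapT => h1; apply: h; exists n => t Jt.
  by apply: contrapT => nt; apply: h1; exists t; rewrite mulr1.
have [a [b [Iab na nb]]] := not_prime_witness iI nI1 npI.
have h1 := bigger _ (adj_ideal a iI) (adj_proper iI na).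
have h2 : sat_dcc P (colon I a).
  apply: bigger; first exact: colon_ideal.
  split; first exact: sub_colon.
  by move=> /(_ b) h; apply: nb; apply: h; rewrite /colon /= mulrC.
move=> J iJ sJ IJ dJ.
have [||||N1 hN1] := h1 (fun n => sat P (adj (J n) a)).
- by move=> n; apply: sat_ideal => //; apply: adj_ideal.
- by move=> n; apply: sat_sat.
- move=> n; apply: subset_trans (sub_sat pP); apply: adj_sub.
  + exact: adj_ideal.
  + by apply: (subset_trans (IJ n)); apply: sub_adj.
  + exact: mem_adj.
- by move=> n; apply: satS => x [c Jc]; exists c; apply: dJ.
have [||||N2 hN2] := h2 (fun n => colon (J n) a).
- by move=> n; apply: colon_ideal.
- move=> n x [t [nt]]; rewrite /colon /= -mulrA => Jt.
  by apply: sJ; exists t.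
- by move=> n x; apply: IJ.
- by move=> n x; apply: dJ.
exists (maxn N1 N2) => n ln y Jy.
have [t [nt [c Jc]]] : sat P (adj (J n) a) y.
  apply: (hN1 n); first by apply: leq_trans ln; apply: leq_maxl.
  apply: sub_sat => //; apply: sub_adj.
  exact: (dchain_le dJ (leq_maxl N1 N2)).
have Jca : J (maxn N1 N2) (c * a).
  have -> : c * a = t * y - (t * y - c * a) by ring.
  by apply: idealB => //; [apply: idealM|apply: (dchain_le dJ ln)].
have Jnca : J n (c * a).
  apply: (hN2 n _ c); first by apply: leq_trans ln; apply: leq_maxr.
  exact: (dchain_le dJ (leq_maxr N1 N2)).
by apply: sJ; exists t; split=> //; rewrite -(subrK (c * a) (t * y)); apply: idealD.
Qed.

(** Nakayama's lemma in the localization at [P], for [N] contained in [I + x N].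
    A maximality argument replaces finite generation: if [K] is a saturated ideal that is
    maximal for not containing [N], then [N] is generated by one element modulo [K]. *)
Lemma sat_nakayama P I (N : set A) x : acc A -> prime_ideal P -> is_ideal I ->
  is_ideal N -> P x ->
  (forall z, N z -> exists t c, [/\ ~ P t, N c & I (t * z - c * x)]) ->
  N `<=` sat P I.
Proof.
move=> aA pP iI iN Px h; apply: contrapT => nN.
have [||K [iK sK IK nNK] Kmax] := @acc_max A
    [set K | [/\ is_ideal K, sat P K `<=` K, I `<=` K & ~ N `<=` K]] aA.
- exists (sat P I); split=> //; [exact: sat_ideal|exact: sat_sat|exact: sub_sat].
- by move=> K [].
have [g [Ng nKg]] : exists g, N g /\ ~ K g.
  apply: contrapT => h'; apply: nNK => g Ng; apply: contrapT => nK; apply: h'.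
  by exists g.
have NK : N `<=` sat P (adj K g).
  apply: contrapT => nNK'; apply: nKg.
  apply: (Kmax (sat P (adj K g))).
  - split=> //; [|exact: sat_sat|].
    + by apply: sat_ideal => //; apply: adj_ideal.
    + apply: (subset_trans IK); apply: subset_trans (sub_sat pP); exact: sub_adj.
  - by apply: subset_trans (sub_sat pP); exact: sub_adj.
  - by apply: sub_sat => //; apply: mem_adj.
have [t [n [nt Nn It]]] := h g Ng.
have [t' [nt' [c Kc]]] := NK n Nn.
apply: nKg; apply: sK; exists (t' * t - c * x); split.
  move=> h'; apply: (primeMn pP nt' nt); rewrite -(subrK (c * x) (t' * t)).
  by apply: idealD (prime_is_ideal pP) h' _; apply: idealM => //; apply: prime_is_ideal.
have -> : (t' * t - c * x) * g =
   t' * (t * g - n * x) + x * (t' * n - c * g) by ring.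
by apply: idealD => //; apply: idealM => //; apply: IK.
Qed.

(** A prime which is minimal over [P0 + (x)] has height at most one over [P0].
    Krull's proof: if [P] were minimal over [P0 + (x)], the localization at [P] modulo [(x)] would
    be Artinian, so the symbolic powers [S n] of an element of [P1] would be stationary
    modulo [x], hence stationary by Nakayama's lemma; but then that element would
    have a power in [P0]. *)
Lemma principal_ideal_theorem P0 P1 P x : acc A ->
  prime_ideal P0 -> prime_ideal P1 -> prime_ideal P ->
  P0 `<` P1 -> P1 `<` P -> P x ->
  exists Q, [/\ prime_ideal Q, P0 `<=` Q, Q x & Q `<` P].
Proof.
move=> aA pP0 pP1 pP [P01 nP10] [P1P nPP1] Px; apply: contrapT => none.
have i0 := prime_is_ideal pP0.
have nP1x : ~ P1 x.
  by move=> P1x; apply: none; exists P1; split=> //; split.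
(* Otherwise [P] is minimal over [P0 + (x)]. *)
have dcc : sat_dcc P (adj P0 x).
  apply: sat_dccP => //; first exact: adj_ideal.
  move=> Q pQ IQ QP; apply/seteqP; split=> //; apply: contrapT => nPQ.
  apply: none; exists Q; split=> //.
    by apply: subset_trans IQ; apply: sub_adj.
  by apply: IQ; apply: mem_adj.
have [y [P1y nP0y]] : exists y, P1 y /\ ~ P0 y.
  apply: contrapT => h; apply: nP10 => y Py; apply: contrapT => ny; apply: h.
  by exists y.
(* The symbolic powers of [y], modulo [P0]. *)
pose S n := sat P1 (adj P0 (y ^+ n)).
have iS n : is_ideal (S n) by apply: sat_ideal => //; apply: adj_ideal.
have P0S n : P0 `<=` S n.
  by apply: subset_trans (sub_sat pP1); apply: sub_adj.
have dS n : S n.+1 `<=` S n.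
  apply: satS; apply: adj_sub; first exact: adj_ideal.
    exact: sub_adj.
  by rewrite exprS; apply: idealM; [apply: adj_ideal|apply: mem_adj].
have sS n : sat P (S n) `<=` S n.
  move=> z [t [nt Stz]]; apply: sat_sat => //; exists t; split=> //.
  by move=> /P1P.
have [||||N hN] := dcc (fun n => sat P (adj (S n) x)).
- by move=> n; apply: sat_ideal => //; apply: adj_ideal.
- by move=> n; apply: sat_sat.
- move=> n; apply: subset_trans (sub_sat pP); apply: adj_sub.
  + exact: adj_ideal.
  + by apply: (subset_trans (P0S n)); apply: sub_adj.
  + exact: mem_adj.
- by move=> n; apply: satS => z [c h]; exists c; apply: dS.
have SN : S N `<=` S N.+1.
  apply: subset_trans (sS N.+1); apply: (@sat_nakayama P (S N.+1) (S N) x) => //.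
  move=> z Sz.
  have [t [nt [c Sc]]] : sat P (adj (S N.+1) x) z.
    by apply: (hN N.+1) => //; apply: sub_sat => //; apply: sub_adj.
  have Scx : S N (c * x).
    have -> : c * x = t * z - (t * z - c * x) by ring.
    by apply: idealB => //; [apply: idealM|apply: dS].
  exists t, c; split=> //.
  by apply: sat_sat => //; exists x; rewrite mulrC.
have [t [nt [c P0c]]] : S N.+1 (y ^+ N).
  by apply: SN; apply: sub_sat => //; apply: mem_adj.
have : P0 (y ^+ N * (t - c * y)).
  by have -> : y ^+ N * (t - c * y) = t * y ^+ N - c * y ^+ N.+1
    by rewrite exprS; ring.
case/(primeM pP0) => [/(primeX pP0) //|/P01 h].
apply: nt; rewrite -(subrK (c * y) t).
have iP1 := prime_is_ideal pP1.
by apply: idealD => //; apply: idealM.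
Qed.

End PrincipalIdeal.

(** * Chains of primes, the height theorem and parameters *)

Section Heights.
Context (A : comPzRingType).
Implicit Types (I J P Q M : set A) (x y z : A) (n : nat).

(** The recursion starts at the bottom, since proofs change chains at their lower
    end. *)
Fixpoint chain P M n : Prop :=
  if n is k.+1 then exists Q, [/\ prime_ideal Q, P `<` Q & chain Q M k]
  else P = M.

Lemma chain_sub n P M : chain P M n -> P `<=` M.
Proof.
elim: n P => [P -> //|n IH P [Q [_ [PQ _] /IH]]]; exact: subset_trans.
Qed.

Lemma chain_rcons n P M N : prime_ideal N -> chain P M n -> M `<` N ->
  chain P N n.+1.
Proof.
move=> pN; elim: n P => [P -> MN|n IH P [Q [pQ PQ cQ]] MN]; first by exists N.
by exists Q; split=> //; apply: IH.
Qed.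

Lemma chain_same n P : chain P P n -> n = 0%N.
Proof. by case: n => // n [Q [_ [_ nQP] /chain_sub]]. Qed.

Lemma chain_end n P M : chain P M n.+1 -> P `<` M.
Proof.
move=> [Q [_ [PQ nQP] /chain_sub QM]]; split; first exact: subset_trans QM.
by move=> MP; apply: nQP; apply: (subset_trans QM).
Qed.

Lemma chain_take n m P M : chain P M (n + m) ->
  exists M', [/\ M' = P \/ prime_ideal M', chain P M' n & M' `<=` M].
Proof.
elim: n P => [|n IH] P /=; first by move=> /chain_sub PM; exists P; split=> //; left.
move=> [Q [pQ PQ /IH [M' [pM' cM' M'M]]]]; exists M'; split=> //; last by exists Q.
by right; case: pM' => [->|].
Qed.

(** The principal ideal theorem allows to push [x] down the chain, one step
    at a time. *)
Lemma chain_into n P M x : acc A -> prime_ideal P -> prime_ideal M ->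
  chain P M n.+1 -> M x ->
  exists Q, [/\ prime_ideal Q, P `<` Q, Q x & chain Q M n].
Proof.
move=> aA; elim: n P => [|n IH] P pP pM.
  by move=> [Q [pQ PQ /= eQ]] Mx; exists Q; split=> //; rewrite eQ.
move=> [Q1 [pQ1 PQ1 cQ1]] Mx.
have [Q2 [pQ2 Q12 Q2x cQ2]] := IH _ pQ1 pM cQ1 Mx.
have [Q [pQ PQ Qx QQ2]] := principal_ideal_theorem aA pP pQ1 pQ2 PQ1 Q12 Q2x.
have [QP|nQP] := pselect (Q `<=` P).
  by exists Q1; split=> //; case: PQ1 => h _; apply: h; apply: QP.
by exists Q; split=> //; exists Q2.
Qed.

(** By [chain_into] the first step of a chain can be made to contain [x], and the
    remaining elements are used for the rest of the chain. *)
Lemma height_theorem (xs : seq A) n P M : acc A ->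
  prime_ideal P -> prime_ideal M -> chain P M n ->
  {in xs, forall x, M x} ->
  (forall Q, prime_ideal Q -> P `<=` Q -> {in xs, forall x, Q x} ->
     Q `<=` M -> Q = M) ->
  (n <= size xs)%N.
Proof.
move=> aA; elim: xs n P => [|x xs IH] n P pP pM cPM Mxs Mmin.
  have e : P = M by apply: Mmin => //; apply: chain_sub cPM.
  by move: cPM; rewrite e => /chain_same ->.
case: n cPM => // n cPM.
have [|Q [pQ [PQ _] Qx cQM]] := chain_into aA pP pM cPM (x := x).
  by apply: Mxs; rewrite mem_head.
apply: (IH n Q) => //; first by move=> y yin; apply: Mxs; rewrite inE yin orbT.
move=> R pR QR Rxs RM; apply: Mmin => //; first exact: subset_trans QR.
by move=> y; rewrite inE => /predU1P[->|/Rxs //]; apply: QR.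
Qed.

Lemma nsub_witness P Q : ~ P `<=` Q -> exists x, P x /\ ~ Q x.
Proof.
move=> h; apply: contrapT => h'; apply: h => x Px; apply: contrapT => nx.
by apply: h'; exists x.
Qed.

(** A converse of the height theorem.  Any [x] in [M] outside the minimal primes
    of [J] that do not contain [M] lowers the height of [M] over [J], and prime
    avoidance provides one. *)
Lemma parameters h J M : acc A -> is_ideal J -> prime_ideal M -> J `<=` M ->
  (forall Q n, prime_ideal Q -> J `<=` Q -> chain Q M n -> (n <= h)%N) ->
  exists xs : seq A, [/\ size xs = h, {in xs, forall x, M x} &
    forall Q, prime_ideal Q -> J `<=` Q -> {in xs, forall x, Q x} ->
      Q `<=` M -> Q = M].
Proof.
move=> aA; elim: h J => [|h IH] J iJ pM JM hh.
  exists [::]; split=> // Q pQ JQ _ QM; apply/seteqP; split=> //.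
  apply: contrapT => nMQ.
  by have := hh Q 1%N pQ JQ; rewrite ltn0 => h; apply/notF/h; exists M; split.
have iM := prime_is_ideal pM.
have [Qs [Qp Qm]] := finitely_many_primes aA iJ.
have [Qs' Qs'P] := In_filter (fun Q => ~ M `<=` Q) Qs.
have [||x Mx nx] := @prime_avoidance _ Qs' M iM.
- by move=> Q /Qs'P[/Qp[]].
- by move=> Q /Qs'P[].
have [||||xs [sxs Mxs Mmin]] := IH (adj J x).
- exact: adj_ideal.
- exact: pM.
- exact: adj_sub.
- move=> Q n pQ JQ cQ; have JQ' : J `<=` Q := subset_trans (@sub_adj _ J x) JQ.
  have [R Rin RQ] := Qm Q pQ JQ'.
  have [pR JR] := Qp R Rin.
  have [MR|nMR] := pselect (M `<=` R).
    have e : Q = M.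
      by apply/seteqP; split; [apply: chain_sub cQ|apply: subset_trans RQ].
    by move: cQ; rewrite e => /chain_same ->.
  have nRx : ~ R x by apply: nx; apply/Qs'P.
  rewrite -ltnS; apply: (hh R) => //; exists Q; split=> //; split=> //.
  by move=> QR; apply: nRx; apply: QR; apply: JQ; apply: mem_adj.
exists (x :: xs); split; first by rewrite /= sxs.
  by move=> y; rewrite inE => /predU1P[->|/Mxs].
move=> Q pQ JQ Qxs QM; apply: Mmin => //; last first.
  by move=> y yin; apply: Qxs; rewrite inE yin orbT.
by apply: adj_sub => //; [apply: prime_is_ideal|apply: Qxs; rewrite mem_head].
Qed.

(** Choose [y] in [P''] outside the minimal primes [R] of [P + (c)], and [Q] minimal
    over [P + (y)].  If [c] were in [Q], then [P < R < Q] for one of these [R], and [Q]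
    would have height two over [P], against the principal ideal theorem. *)
Lemma between_avoiding P P' P'' c : acc A ->
  prime_ideal P -> prime_ideal P' -> prime_ideal P'' ->
  P `<` P' -> P' `<` P'' -> ~ P c ->
  exists Q, [/\ prime_ideal Q, P `<` Q, Q `<` P'' & ~ Q c].
Proof.
move=> aA pP pP' pP'' PP' P'P'' nPc.
have iP := prime_is_ideal pP; have iP'' := prime_is_ideal pP''.
have [Qs [Qp Qm]] := finitely_many_primes aA (adj_ideal c iP).
have [Qs' Qs'P] := In_filter (fun Q => ~ P'' `<=` Q) Qs.
have [||y Py ny] := @prime_avoidance _ (P :: Qs') P'' iP''.
- by move=> Q [<- //|/Qs'P[/Qp[]]].
- move=> Q [<-|/Qs'P[] //]; case: P'P'' PP' => h1 h2 [h3 h4] h.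
  by apply: h2; apply: (subset_trans h).
have nPy : ~ P y by apply: ny; left.
have [Q0 [pQ0 PQ0 Q0y [Q0P'' nP''Q0]]] :=
  principal_ideal_theorem aA pP pP' pP'' PP' P'P'' Py.
have [Q [pQ yQ QQ0 Qmin]] := minimal_prime aA (adj_ideal y iP) pQ0
  (adj_sub (prime_is_ideal pQ0) PQ0 Q0y).
have PQ : P `<=` Q by apply: subset_trans yQ; apply: sub_adj.
have Qy : Q y by apply: yQ; apply: mem_adj.
have nP''Q : ~ P'' `<=` Q by move=> h; apply: nP''Q0; apply: subset_trans QQ0.
exists Q; split=> //.
- by split=> // /(_ y Qy).
- by split=> //; apply: subset_trans Q0P''.
move=> Qc.
have [R Rin RQ] := Qm Q pQ (adj_sub (prime_is_ideal pQ) PQ Qc).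
have [pR cR] := Qp R Rin.
have PR : P `<=` R by apply: subset_trans cR; apply: sub_adj.
have nRy : ~ R y.
  apply: ny; right; apply/Qs'P; split=> // h.
  by apply: nP''Q; apply: subset_trans RQ.
have PltR : P `<` R by split=> // h; apply: nPc; apply: h; apply: cR; apply: mem_adj.
have RltQ : R `<` Q by split=> // h; apply: nRy; apply: h.
have [S [pS PS Sy [SQ nQS]]] := principal_ideal_theorem aA pP pR pQ PltR RltQ Qy.
apply: nQS; rewrite (Qmin S) //.
exact: adj_sub (prime_is_ideal pS) PS Sy.
Qed.

(** All members of the new chain except [M] avoid [c], by [between_avoiding]. *)
Lemma chain_avoiding n P M c : acc A -> prime_ideal P -> prime_ideal M ->
  chain P M n.+1 -> ~ P c ->
  exists Q, [/\ prime_ideal Q, ~ Q c, chain P Q n & Q `<` M].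
Proof.
move=> aA; elim: n P => [|n IH] P pP pM.
  by move=> /chain_end PM nPc; exists P.
move=> [Q1 [pQ1 PQ1 [Q2 [pQ2 Q12 cQ2]]]] nPc.
have [Q [pQ PQ QQ2 nQc]] := between_avoiding aA pP pQ1 pQ2 PQ1 Q12 nPc.
have cQ : chain Q M n.+1 by exists Q2.
have [R [pR nRc cR RM]] := IH _ pQ pM cQ nQc.
by exists R; split=> //; exists Q.
Qed.

End Heights.

Lemma chain_map (A B : comPzRingType) (F : set A -> set B) n (P M : set A) :
  (forall Q, prime_ideal Q -> prime_ideal (F Q)) ->
  (forall Q R, prime_ideal Q -> prime_ideal R -> Q `<` R -> F Q `<` F R) ->
  prime_ideal P -> chain P M n -> chain (F P) (F M) n.
Proof.
move=> Fp Fm; elim: n P => [P _ -> //|n IH P pP [Q [pQ PQ cQ]]].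
by exists (F Q); split; [apply: Fp|apply: Fm|apply: IH].
Qed.

(** * Ideals of a polynomial ring in one variable *)

Section PolynomialIdeals.
Context (A : comNzRingType).
Implicit Types (I J P M : set A) (q Q : set {poly A}) (f g h r : {poly A}).

Definition ext I : set {poly A} := [set f | forall i, I f`_i].
Definition contr q : set A := [set a | q a%:P].

Lemma ext_ideal I : is_ideal I -> is_ideal (ext I).
Proof.
move=> iI; split=> [i|f g If Ig i|f g Ig i]; first by rewrite coef0; apply: ideal0.
- by rewrite coefD; apply: idealD.
- by rewrite coefM; apply: ideal_sum => // j _; apply: idealM.
Qed.

Lemma extC I a : is_ideal I -> I a -> ext I a%:P.
Proof. by move=> iI Ia [|i]; rewrite coefC //=; apply: ideal0. Qed.

Lemma extCE I a : is_ideal I -> ext I a%:P <-> I a.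
Proof. by move=> iI; split=> [/(_ 0%N)|]; [rewrite coefC|apply: extC]. Qed.

Lemma contr_ext I : is_ideal I -> contr (ext I) = I.
Proof. by move=> iI; apply/seteqP; split=> a /(extCE _ iI). Qed.

Lemma extS I J : I `<=` J -> ext I `<=` ext J.
Proof. by move=> IJ f If i; apply: IJ. Qed.

Lemma ext_contr_sub q : is_ideal q -> ext (contr q) `<=` q.
Proof.
move=> iq f qf; rewrite -(coefK f) poly_def; apply: ideal_sum => // i _.
by rewrite -mul_polyC; apply: idealMr => //; apply: qf.
Qed.

Lemma contr_ideal q : is_ideal q -> is_ideal (contr q).
Proof.
move=> iq; rewrite /contr; split => /=; first by rewrite polyC0; apply: (ideal0 iq).
- by move=> x y qx qy; rewrite polyCD; apply: idealD.
- by move=> a x qx; rewrite polyCM; apply: idealM.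
Qed.

Lemma contr_prime q : prime_ideal q -> prime_ideal (contr q).
Proof. exact: (@preimage_prime _ _ polyC). Qed.

Lemma ext_proper I J : is_ideal I -> is_ideal J -> I `<` J -> ext I `<` ext J.
Proof.
move=> iI iJ [IJ nJI]; split; first exact: extS.
by move=> JI; apply: nJI => a /(extCE _ iJ)/JI/(extCE _ iI).
Qed.

(** Modulo [I], each polynomial has a representative whose leading
    coefficient is nonzero modulo [I]; this allows to argue with degrees
    without passing to the quotient ring. *)
Lemma truncation I f : is_ideal I -> ~ ext I f ->
  exists g, [/\ ext I (f - g), ~ I (lead_coef g) & (size g <= size f)%N].
Proof.
move=> iI; have ie := ext_ideal iI; have [n] := ubnP (size f); elim: n f => // n IH f sf nf.
have [Il|nIl] := pselect (I (lead_coef f)); last first.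
  by exists f; split=> //; rewrite subrr; exact: (ideal0 ie).
have f0 : f != 0.
  by apply: contra_not_neq nf => ->; exact: (ideal0 ie).
pose t := lead_coef f *: 'X^((size f).-1).
have It : ext I t.
  by move=> i; rewrite coefZ; apply: idealMr.
have sf0 : (0 < size f)%N by rewrite size_poly_gt0.
have s1 : (size (f - t)%R < size f)%N.
  rewrite -(prednK sf0) ltnS; apply/leq_sizeP => j lj.
  rewrite coefB coefZ coefXn; have [->|ne] := eqVneq j (size f).-1.
    by rewrite mulr1 subrr.
  by rewrite mulr0 subr0 nth_default // -(prednK sf0) ltn_neqAle eq_sym ne.
have [||g [Ig ng sg]] := IH (f - t).
- by apply: leq_trans s1 _.
- by move=> h; apply: nf; rewrite -(subrK t f); exact: (idealD ie).
exists g; split=> //; last by apply: leq_trans sg (ltnW s1).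
have -> : f - g = (f - t - g) + t by ring.
by exact: (idealD ie).
Qed.

Lemma ext_prime P : prime_ideal P -> prime_ideal (ext P).
Proof.
move=> pP; have iP := prime_is_ideal pP; have ie := ext_ideal iP.
split=> //; first by move/(extCE 1 iP); apply: prime1.
move=> f g Pfg; apply: contrapT => /not_orP[nf ng].
(* The leading coefficient of the product of the truncations is outside [P]. *)
have [f' [Pf nf' _]] := truncation iP nf.
have [g' [Pg ng' _]] := truncation iP ng.
have : ext P (f' * g').
  have -> : f' * g' = f * g - (f * (g - g') + g' * (f - f')) by ring.
  by apply: (idealB ie) => //; apply: (idealD ie) => //; apply: (idealM _ ie).
by move/(_ (size f' + size g').-2); rewrite -mul_lead_coef; apply: primeMn.
Qed.

(** Hilbert's basis theorem.  The ideals [L n d] of the coefficients of degree [d] of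
    the members of [J n] of degree at most [d] increase with [n] and [d].  They are
    stationary along the diagonal, and also in [n] for each of the finitely many smaller [d];
    if they agree in all degrees, then so do the ideals. *)
Lemma acc_poly : acc A -> acc {poly A}.
Proof.
move=> aA J iJ incJ.
pose L n d : set A := [set a | exists f, [/\ J n f, (size f <= d.+1)%N & f`_d = a]].
have iL n d : is_ideal (L n d).
  split; first by exists 0; rewrite size_poly0 coef0; split=> //; apply: ideal0.
  - move=> _ _ [f [Jf sf <-]] [g [Jg sg <-]]; exists (f + g).
    rewrite coefD; split=> //; first exact: idealD.
    by apply: leq_trans (size_polyD _ _) _; rewrite geq_max sf.
  - move=> a _ [f [Jf sf <-]]; exists (a *: f).
    rewrite coefZ; split=> //; first by rewrite -mul_polyC; apply: idealM.
    exact: leq_trans (size_scale_leq _ _) sf.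
have Ln m n d : (m <= n)%N -> L m d `<=` L n d.
  by move=> mn _ [f [Jf sf <-]]; exists f; split=> //; apply: (chain_le incJ mn).
have Ld n d e : (d <= e)%N -> L n d `<=` L n e.
  move=> de _ [f [Jf sf <-]]; exists (f * 'X^(e - d)); split.
  - exact: idealMr.
  - apply: leq_trans (size_polyMleq _ _) _; rewrite size_polyXn addnS /=.
    by rewrite -(subnKC de) addKn -addSn leq_add2r.
  - by rewrite coefMXn ltnNge leq_subr /= subKn.
have [|N0 hN0] := aA (fun n => L n n) (fun n => iL n n).
  by move=> n; apply: (subset_trans (Ln n n.+1 n (leqnSn n))); apply: Ld.
have exN d : exists N, forall n, (N <= n)%N -> L n d `<=` L N d.
  by apply: aA (fun n => iL n d) _ => n; apply: Ln.
(* A common bound for [n], valid in the degrees below [N0]. *)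
have [Nd hNd] := choice exN.
pose N := maxn N0 (\max_(d < N0) Nd d)%N.
have hN n d : (N <= n)%N -> L n d `<=` L N d.
  move=> Nn; have [dN0|N0d] := ltnP d N0.
    have h : (Nd d <= N)%N.
      by apply: leq_trans (leq_maxr _ _); apply: (leq_bigmax (Ordinal dN0)).
    by apply: (subset_trans (hNd d n (leq_trans h Nn))); apply: Ln.
  have h0 : (N0 <= N)%N by apply: leq_maxl.
  apply: (@subset_trans _ (L (maxn n d) (maxn n d))).
    by apply: (subset_trans (Ln n (maxn n d) d (leq_maxl _ _))); apply: Ld; apply: leq_maxr.
  apply: subset_trans (hN0 _ _) _; first by apply: leq_trans h0 _; apply: leq_trans Nn _; apply: leq_maxl.
  by apply: (subset_trans (Ld N0 N0 d N0d)); apply: Ln.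
exists N => n Nn f Jf.
have [k] := ubnP (size f); elim: k f Jf => // k IH f Jf sf.
have [->|f0] := eqVneq f 0; first exact: ideal0.
have sf0 : (0 < size f)%N by rewrite size_poly_gt0.
have [g [Jg sg eg]] : L N (size f).-1 (lead_coef f).
  by apply: (hN n) => //; exists f; rewrite prednK.
have s1 : (size (f - g)%R < size f)%N.
  rewrite -(prednK sf0) ltnS; apply/leq_sizeP => j lj; rewrite coefB.
  have [->|ne] := eqVneq j (size f).-1; first by rewrite eg subrr.
  have lj' : (size f <= j)%N by rewrite -(prednK sf0) ltn_neqAle eq_sym ne.
  rewrite !nth_default ?subrr //; apply: leq_trans sg _; by rewrite prednK.
rewrite -(subrK g f); apply: idealD => //; apply: IH.
- by apply: idealB => //; apply: (chain_le incJ Nn).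
- exact: leq_trans s1 _.
Qed.

(** The division multiplies [p] by powers of the leading coefficient of [f] only, so
    the coefficients of the remainder stay in any ideal containing those of [p]. *)
Lemma pseudo_division I f p : is_ideal I -> (0 < size f)%N -> ext I p ->
  exists n h r, [/\ (lead_coef f ^+ n) *: p = h * f + r, ext I r & (size r < size f)%N].
Proof.
move=> iI sf; have [k] := ubnP (size p); elim: k p => // k IH p sp Ip.
have [lt|le] := ltnP (size p) (size f).
  by exists 0%N, 0, p; rewrite expr0 scale1r mul0r add0r.
have sp0 : (0 < size p)%N := leq_trans sf le.
pose m := 'X^(size p - size f) : {poly A}.
pose p' := lead_coef f *: p - lead_coef p *: (m * f).
have Ip' : ext I p'.
  move=> i; rewrite coefB !coefZ; apply: idealB => //; first exact: idealM.
  by apply: idealMr => //; apply: Ip.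
have sp' : (size p' < size p)%N.
  rewrite -(prednK sp0) ltnS; apply/leq_sizeP => j lj.
  rewrite coefB !coefZ /m ['X^_ * f]mulrC coefMXn.
  have -> : (j < size p - size f)%N = false.
    by apply/negbTE; rewrite -leqNgt; lia.
  have [->|ne] := eqVneq j (size p).-1.
    have -> : ((size p).-1 - (size p - size f) = (size f).-1)%N by lia.
    by rewrite !lead_coefE mulrC subrr.
  have lj' : (size p <= j)%N by rewrite -(prednK sp0) ltn_neqAle eq_sym ne.
  rewrite !nth_default ?mulr0 ?subrr //.
  by rewrite -[X in (X <= _)%N](subKn le) leq_sub2r.
have [n [h [r [e Ir sr]]]] := IH p' (leq_trans sp' sp) Ip'.
exists n.+1, (h + (lead_coef f ^+ n * lead_coef p) *: m), r; split=> //.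
rewrite exprSr -scalerA.
have -> : lead_coef f *: p = p' + lead_coef p *: (m * f) by rewrite /p' subrK.
rewrite scalerDr e scalerA mulrDl -scalerAl; ring.
Qed.

End PolynomialIdeals.

(** * Lifting chains of primes to a polynomial ring *)

(** Increasing sequences of primes, not necessarily strictly: when a chain is lifted,
    strictness is inherited from the contractions. *)
Definition prime_tower (A : comPzRingType) (P : nat -> set A) n : Prop :=
  (forall i, (i <= n)%N -> prime_ideal (P i)) /\
  (forall i, (i < n)%N -> P i `<=` P i.+1).

(** A common strengthening of Chevalley's theorem and of going down.  For finitely
    generated ring extensions, the chains of primes that start at the contraction of [q] lift
    to chains that start at [q], not always, but as soon as their top avoids
    one element [h]; moreover the lift can be made to avoid a prescribed [c].
    Thanks to the element [c] the property is stable under composition. *)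
Definition lifting (A B : comPzRingType) (j : A -> B) (q : set B) : Prop :=
  forall c, ~ q c -> exists h, ~ q (j h) /\
    forall n (P : nat -> set A), prime_tower P n -> P 0%N = j @^-1` q -> ~ P n h ->
    exists Q : nat -> set B, [/\ prime_tower Q n, Q 0%N = q,
      (forall i, (i <= n)%N -> j @^-1` (Q i) = P i) & ~ Q n c].

Lemma lifting_id (A : comPzRingType) (q : set A) : lifting id q.
Proof. by move=> c nc; exists c; split=> // n P incP P0 nPc; exists P. Qed.

Lemma lifting_comp (A B C : comPzRingType) (j : A -> B) (k : B -> C) (q : set C) :
  lifting j (k @^-1` q) -> lifting k q -> lifting (k \o j) q.
Proof.
move=> Lj Lk c nc; have [h1 [nh1 L1]] := Lk c nc; have [h [nh L]] := Lj h1 nh1.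
exists h; split=> // n P incP P0 nPh.
have [Q1 [incQ1 Q10 cQ1 nQ1]] := L n P incP P0 nPh.
have [Q [incQ Q0 cQ nQ]] := L1 n Q1 incQ1 Q10 nQ1.
by exists Q; split=> // i ilen; rewrite -cQ1 // -cQ.
Qed.

Section Lifting.
Context (A : comNzRingType).
Implicit Types (I J P M : set A) (q Q : set {poly A}) (f g h r : {poly A}).

(** For a prime [J] with contraction [P], such an [f] is, up to a factor, the minimal
    polynomial of the class of the variable over the field of fractions of [A / P]. *)
Lemma minimal_size P (J : set {poly A}) : is_ideal P -> is_ideal J ->
  ext P `<=` J -> ~ J `<=` ext P ->
  exists f, [/\ J f, ~ P (lead_coef f) &
    forall g, J g -> (size g < size f)%N -> ext P g].
Proof.
move=> iP iJ PJ /nsub_witness[f0 [Jf0 nf0]].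
have exn : exists n, `[< exists f, [/\ J f, ~ ext P f & size f = n] >].
  by exists (size f0); apply/asboolP; exists f0.
have [n /asboolP[f [Jf nf sf]] nmin] := ex_minnP exn.
have [g [Pfg ng sg]] := truncation iP nf.
exists g; split=> //.
  have -> : g = f - (f - g) by ring.
  by apply: idealB => //; apply: PJ.
move=> h Jh sh; apply: contrapT => nh.
have : (n <= size h)%N by apply: nmin; apply/asboolP; exists h.
by rewrite -sf leqNgt (leq_trans sh sg).
Qed.

Section Algebraic.
Context (q : set {poly A}) (pq : prime_ideal q) (f : {poly A}).
Let P0 := contr q.
Context (qf : q f) (nlf : ~ P0 (lead_coef f))
  (fmin : forall g, q g -> (size g < size f)%N -> ext P0 g).

Let iq := prime_is_ideal pq.
Let pP0 : prime_ideal P0 := contr_prime pq.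
Let iP0 := prime_is_ideal pP0.
Let pe : prime_ideal (ext P0) := ext_prime pP0.
Let ie := prime_is_ideal pe.

Lemma scale_mem (J : set {poly A}) a g : is_ideal J -> J g -> J (a *: g).
Proof. by move=> iJ Jg; rewrite -mul_polyC; apply: idealM. Qed.

Lemma scale_prime (Q : set {poly A}) a g :
  prime_ideal Q -> Q (a *: g) -> Q a%:P \/ Q g.
Proof. by move=> pQ; rewrite -mul_polyC; apply: primeM. Qed.

Lemma algebraic_size : (1 < size f)%N.
Proof.
rewrite ltnNge; apply/negP => /size1_polyC e; apply: nlf.
by rewrite e lead_coefC /P0 /contr /= -e.
Qed.

Lemma algebraic_sizeP : (0 < size f)%N. Proof. exact: ltnW algebraic_size. Qed.

(** Irreducibility of the minimal polynomial [f].  If the member [r] of smallest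
    degree of [q + (g)] were not constant modulo [P0], pseudo-division of [f] by [r] would give
    a factorization of [f] modulo [P0] into polynomials of smaller degree. *)
Lemma algebraic_constant g : ~ q g -> exists a, ~ P0 a /\ adj q g a%:P.
Proof.
move=> nqg; set J := adj q g.
have iJ : is_ideal J by apply: adj_ideal.
have qJ : q `<=` J by apply: sub_adj.
have [n [h [g' [e _ sg']]]] :=
  @pseudo_division A setT f g (setT_ideal A) algebraic_sizeP (fun _ => I).
(* Replacing [g] by its remainder modulo [f] makes the degree of [r] smaller than that
   of [f]. *)
have nqg' : ~ q g'.
  move=> qg'; have : q (lead_coef f ^+ n *: g).
    by rewrite e; apply: idealD => //; apply: idealM.
  by case/(scale_prime pq) => // /(primeX (contr_prime pq)) /nlf.
have Jg' : J g'.
  have -> : g' = lead_coef f ^+ n *: g - h * f by rewrite e; ring.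
  apply: idealB => //; last by apply: qJ; apply: idealM.
  by apply: scale_mem => //; apply: mem_adj.
have eq0 : ext P0 `<=` q := ext_contr_sub iq.
have [r [Jr nr rmin]] : exists r, [/\ J r, ~ P0 (lead_coef r) &
    forall g, J g -> (size g < size r)%N -> ext P0 g].
  apply: minimal_size => //; first exact: subset_trans qJ.
  by move=> /(_ _ Jg')/eq0.
have srg : (size r <= size g')%N.
  by rewrite leqNgt; apply/negP => /(rmin _ Jg')/eq0.
have [s1|s1] := leqP (size r) 1.
  exists (lead_coef r); split=> //.
  by rewrite (size1_polyC s1) lead_coefC -(size1_polyC s1).
have srf : (size r < size f)%N := leq_ltn_trans srg sg'.
have [m [k [r' [e' _ sr']]]] :=
  @pseudo_division A setT r f (setT_ideal A) (ltnW s1) (fun _ => I).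
have er' : ext P0 r'.
  apply: rmin => //.
  have -> : r' = lead_coef r ^+ m *: f - k * r by rewrite e'; ring.
  by apply: idealB => //; [apply: scale_mem => //; apply: qJ|apply: idealM].
have qkr : q (k * r).
  have -> : k * r = lead_coef r ^+ m *: f - r' by rewrite e'; ring.
  by apply: idealB => //; [apply: scale_mem|apply: eq0].
exfalso; case: (primeM pq qkr) => [qk|qr]; last first.
  by apply: nr; apply: (fmin qr srf).
have nk : ~ ext P0 k.
  move=> ek; have : ext P0 (lead_coef r ^+ m *: f).
    by rewrite e'; apply: (idealD ie) => //; apply: (idealMr _ ie).
  case/(scale_prime pe) => [/(extCE _ iP0)/(primeX pP0) //|ef].
  exact: nlf (ef _).
have [k' [ek nk' _]] := truncation iP0 nk.
have ekr : ext P0 (k' * r - lead_coef r ^+ m *: f).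
  have -> : k' * r - lead_coef r ^+ m *: f = - (r' + r * (k - k')) by rewrite e'; ring.
  by apply: (idealN ie); apply: (idealD ie) => //; apply: (idealM _ ie).
have nc : ~ P0 (lead_coef r ^+ m * f`_(size k' + size r).-2).
  move=> h1; apply: (primeMn pP0 nk' nr); rewrite mul_lead_coef.
  apply: (ideal_subl iP0 (idealN iP0 h1)).
  by have := ekr (size k' + size r).-2; rewrite coefB coefZ.
have sk' : (size k' < size f)%N.
  have : ((size k' + size r).-2 < size f)%N.
    rewrite ltnNge; apply/negP => h1; apply: nc.
    by rewrite nth_default // mulr0; apply: ideal0.
  apply: leq_trans; rewrite ltnS -(subnKC s1) addnS addnS /=; exact: leq_addr.
apply: nk'; apply: fmin => //.
have -> : k' = k - (k - k') by ring.
by apply: idealB => //; apply: eq0.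
Qed.

Let IP P : set {poly A} := [set g | exists2 u, q u & ext P (g - u)].

Lemma IP_ideal P : is_ideal P -> is_ideal (IP P).
Proof.
move=> iP; have ieP := ext_ideal iP; split.
- by exists 0; [apply: ideal0|rewrite subr0; apply: (ideal0 ieP)].
- move=> x y [u qu eu] [v qv ev]; exists (u + v); first exact: idealD.
  have -> : x + y - (u + v) = (x - u) + (y - v) by ring.
  by apply: (idealD ieP).
- move=> a x [u qu eu]; exists (a * u); first exact: idealM.
  by rewrite -mulrBr; apply: (idealM _ ieP).
Qed.

Lemma q_IP P : is_ideal P -> q `<=` IP P.
Proof. by move=> iP u qu; exists u => //; rewrite subrr; apply: (ideal0 (ext_ideal iP)). Qed.

Lemma ext_IP P : ext P `<=` IP P.
Proof. by move=> u qu; exists 0; [apply: ideal0|rewrite subr0]. Qed.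

(** Once the leading coefficient of [f] is inverted, [{poly A}] modulo [q] is a free
    module over [A / P0] with the powers of the variable below the degree of [f] as a
    basis, so that freeness passes to the quotient modulo [P]. *)
Lemma small_IP P t : prime_ideal P -> P0 `<=` P -> ~ P (lead_coef f) ->
  IP P t -> (size t < size f)%N -> ext P t.
Proof.
move=> pP P0P nl [u qu et] st; have iP := prime_is_ideal pP.
have peP := ext_prime pP; have ieP := prime_is_ideal peP.
have [m [h [r [e er sr]]]] := pseudo_division iP algebraic_sizeP et.
have : ext P (lead_coef f ^+ m *: t).
  rewrite -(subrK r (_ *: t)); apply: (idealD ieP) => //.
  apply: (extS P0P); apply: fmin.
    have -> : lead_coef f ^+ m *: t - r = lead_coef f ^+ m *: u + h * f.
      by move: e; rewrite scalerBr => /eqP; rewrite subr_eq => /eqP ->; ring.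
    by apply: idealD => //; [apply: scale_mem|apply: idealM].
  rewrite (leq_ltn_trans (size_polyD _ _)) // size_polyN gtn_max sr andbT.
  exact: leq_ltn_trans (size_scale_leq _ _) st.
by case/(scale_prime peP) => // /(extCE _ iP)/(primeX pP).
Qed.

(** For the same reason, up to powers of the leading coefficient of [f] there
    is no torsion over [A / P] modulo [q + ext P]. *)
Lemma torsion_IP P a t : prime_ideal P -> P0 `<=` P -> ~ P (lead_coef f) ->
  ~ P a -> IP P (a *: t) -> exists k, IP P (lead_coef f ^+ k *: t).
Proof.
move=> pP P0P nl na It; have iP := prime_is_ideal pP; have iI := IP_ideal iP.
have peP := ext_prime pP.
have [k [h [r [e _ sr]]]] :=
  @pseudo_division A setT f t (setT_ideal A) algebraic_sizeP (fun _ => I).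
exists k; rewrite e; apply: idealD => //.
  by apply: q_IP => //; apply: idealM.
have : ext P (a *: r).
  apply: small_IP => //; last exact: leq_ltn_trans (size_scale_leq _ _) sr.
  have -> : a *: r = lead_coef f ^+ k *: (a *: t) - a *: (h * f).
    by rewrite scalerA mulrC -scalerA e scalerDr; ring.
  apply: idealB => //; first exact: scale_mem.
  by apply: q_IP => //; apply: scale_mem => //; apply: idealM.
by case/(scale_prime peP) => [/(extCE _ iP) //|er]; apply: ext_IP.
Qed.

(** By [small_IP] the constants outside [P] are not in the ideal [q + ext P]. *)
Lemma lying_over P : prime_ideal P -> P0 `<=` P -> ~ P (lead_coef f) ->
  exists Q, [/\ prime_ideal Q, q `<=` Q & contr Q = P].
Proof.
move=> pP P0P nl; have iP := prime_is_ideal pP.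
pose S : set {poly A} := [set a%:P | a in ~` P].
have [||Q [pQ IQ QS _]] := @prime_avoiding _ (IP P) S (IP_ideal iP).
- split; first by exists 1; [apply: prime1|].
  move=> _ _ [a na <-] [b nb <-]; exists (a * b); first exact: primeMn.
  by rewrite polyCM.
- move=> x Ix [a na ex]; apply: na; apply/(extCE _ iP); rewrite ex.
  apply: small_IP => //; rewrite -ex.
  exact: leq_ltn_trans (size_polyC_leq1 _) algebraic_size.
exists Q; split=> //; first exact: subset_trans (q_IP iP) IQ.
apply/seteqP; split=> a.
  by move=> Qa; apply: contrapT => na; apply: (QS _ Qa); exists a.
by move=> Pa; apply: IQ; apply: ext_IP; apply: extC.
Qed.

(** The products of a constant outside [P] and a polynomial outside [Q'] form a
    multiplicative set, which misses [q + ext P] by [torsion_IP].  A prime that misses it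
    lies over [P] and inside [Q']. *)
Lemma going_down P P' (Q' : set {poly A}) : prime_ideal P -> prime_ideal Q' ->
  P0 `<=` P -> P `<=` P' -> ~ P' (lead_coef f) -> q `<=` Q' -> contr Q' = P' ->
  exists Q, [/\ prime_ideal Q, q `<=` Q, contr Q = P & Q `<=` Q'].
Proof.
move=> pP pQ' P0P PP' nl qQ' cQ'; have iP := prime_is_ideal pP.
have iQ' := prime_is_ideal pQ'.
(* A prime of [{poly A}] which misses [S] contains no constant outside [P] and is
   contained in [Q']. *)
pose S : set {poly A} := [set x | exists a t, [/\ ~ P a, ~ Q' t & x = a *: t]].
have [||Q [pQ IQ QS _]] := @prime_avoiding _ (IP P) S (IP_ideal iP).
- split; first by exists 1, 1; rewrite scale1r; split=> //; apply: prime1.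
  move=> _ _ [a [t [na nt ->]]] [b [u [nb nu ->]]]; exists (a * b), (t * u).
  split; [exact: primeMn|exact: primeMn|].
  by rewrite -scalerAl -scalerAr scalerA.
- move=> x Ix [a [t [na nt ex]]].
  have nlP : ~ P (lead_coef f) by move=> /PP'.
  have [|k [u qu eu]] := @torsion_IP P a t pP P0P nlP na; first by rewrite -ex.
  have : Q' (lead_coef f ^+ k *: t).
    rewrite -(subrK u (_ *: t)); apply: idealD => //; last exact: qQ'.
    by apply: (ext_contr_sub iQ'); rewrite cQ'; apply: extS eu.
  case/(scale_prime pQ') => // h; apply: nl.
  by apply: (@primeX _ _ _ k (_ : prime_ideal P')); rewrite -cQ' //; apply: contr_prime.
exists Q; split=> //; first exact: subset_trans (q_IP iP) IQ.
- apply/seteqP; split=> a.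
    move=> Qa; apply: contrapT => na; apply: (QS _ Qa); exists a, 1.
    by rewrite alg_polyC; split=> //; apply: prime1.
  by move=> Pa; apply: IQ; apply: ext_IP; apply: extC.
- move=> x Qx; apply: contrapT => nx; apply: (QS _ Qx); exists 1, x.
  by rewrite scale1r; split=> //; apply: prime1.
Qed.

Lemma going_down_chain n (P : nat -> set A) (Q' : set {poly A}) :
  prime_tower P n -> (forall i, (i <= n)%N -> P0 `<=` P i) -> ~ P n (lead_coef f) ->
  prime_ideal Q' -> q `<=` Q' -> contr Q' = P n ->
  exists Q : nat -> set {poly A}, [/\ prime_tower Q n,
    (forall i, (i <= n)%N -> q `<=` Q i), (forall i, (i <= n)%N -> contr (Q i) = P i)
     & Q n = Q'].
Proof.
elim: n P Q' => [|n IH] P Q' [pP incP] P0P nl pQ' qQ' cQ'.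
  by exists (fun => Q'); split=> // -[] //; split.
have [Q1 [pQ1 qQ1 cQ1 Q1Q']] : exists Q, [/\ prime_ideal Q, q `<=` Q,
    contr Q = P n & Q `<=` Q'].
  apply: (@going_down (P n) (P n.+1)) => //; [exact: pP|exact: P0P|exact: incP].
have [||||||Q [[pQ incQ] qQ cQ eQ]] := IH P Q1.
- by split=> i h; [apply: pP; apply: leqW|apply: incP; apply: leqW].
- by move=> i h; apply: P0P; apply: leqW.
- by move=> h; apply: nl; apply: incP.
- by [].
- by [].
- by [].
exists (fun i => if (i <= n)%N then Q i else Q'); split.
- split=> i h; first by case: ifP => // h'; apply: pQ.
  rewrite -ltnS h; case: ifP => h'; first exact: incQ.
  have -> : i = n by lia.
  by rewrite eQ.
- by move=> i h; case: ifP => // h'; apply: qQ.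
- move=> i h; case: ifP => h'; first exact: cQ.
  have -> : i = n.+1 by lia.
  exact: cQ'.
- by rewrite ltnn.
Qed.

End Algebraic.

(** If [q] is the extension of its contraction [P0], extend all the primes; to avoid
    [c] it is enough to avoid a coefficient of [c].  Otherwise [q] is algebraic, with minimal
    polynomial [f], and some constant [a] outside [P0] is in [q + (c)].  When the top
    of the chain avoids [a] and the leading coefficient of [f], it has a prime over it, and the
    rest of the chain is obtained by going down. *)
Lemma lifting_polyC (q : set {poly A}) : prime_ideal q -> lifting polyC q.
Proof.
move=> pq c nqc; have iq := prime_is_ideal pq.
have pP0 := contr_prime pq; have iP0 := prime_is_ideal pP0.
have eq0 := ext_contr_sub iq.
have incP0 n (P : nat -> set A) : prime_tower P n -> P 0%N = contr q ->
    forall i, (i <= n)%N -> contr q `<=` P i.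
  move=> [pP incP] P0; elim=> [|i IHi] h; first by rewrite P0.
  by apply: (subset_trans (IHi (ltnW h))); apply: incP.
have [qe|nqe] := pselect (q `<=` ext (contr q)).
  have eqe : q = ext (contr q) by apply/seteqP.
  have [i nci] : exists i, ~ contr q c`_i.
    by apply/existsNP => h; apply: nqc; rewrite eqe.
  exists c`_i; split=> // n P incP P0 nPn.
  have [pP incP'] := incP.
  exists (fun i => ext (P i)); split.
  - split=> k kn; first by apply: ext_prime; apply: pP.
    by apply: extS; apply: incP'.
  - by rewrite P0 -eqe.
  - by move=> k kn; apply: contr_ext; apply: prime_is_ideal; apply: pP.
  - by move=> /(_ i).
have [f [qf nlf fmin]] := minimal_size iP0 iq eq0 nqe.
have [a [na qca]] := algebraic_constant pq qf nlf fmin nqc.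
exists (lead_coef f * a); split; first exact: (primeMn pP0).
move=> n P incP P0 nPn; have P0P := incP0 n P incP P0.
have [pP incP'] := incP; have iPn := prime_is_ideal (pP n (leqnn n)).
have nl : ~ P n (lead_coef f) by move=> h; apply: nPn; apply: idealMr.
have [Qn [pQn qQn cQn]] := lying_over pq qf nlf fmin (pP n (leqnn n)) (P0P n (leqnn n)) nl.
have [Q [[pQ incQ] qQ cQ eQ]] := going_down_chain pq qf nlf fmin incP P0P nl pQn qQn cQn.
have nQnc : ~ Qn c.
  move=> Qc; apply: nPn; apply: idealM => //; rewrite -cQn.
  by apply: (adj_sub (prime_is_ideal pQn) qQn Qc).
exists (fun i => if i == 0%N then q else Q i); split=> //.
- split=> [i h|[|i] h /=]; [|exact: qQ|exact: incQ].
  by case: eqP => // _; apply: pQ.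
- by move=> i h; case: eqP => [->|_]; [rewrite P0|apply: cQ].
- by case: eqP => // _; rewrite eQ.
Qed.

End Lifting.

(** * Polynomial rings over Jacobson rings *)

(** The Jacobson property in the form in which it is used: one element outside a
    prime at a time. *)
Definition maximal_separation (A : comPzRingType) : Prop :=
  forall (P : set A) b, prime_ideal P -> ~ P b ->
  exists M, [/\ maximal_ideal M, P `<=` M & ~ M b].

Lemma jacobson_separation (A : comPzRingType) : jacobson A -> maximal_separation A.
Proof.
move=> jA P b pP nb; have [F FM eP] := jA P pP.
move: nb; rewrite eP => /existsNP[M /not_implyP[FMM nMb]].
by exists M; split=> //; [apply: FM|apply: bigcap_inf].
Qed.

(** It suffices that a prime [Q] which is maximal among the ideals avoiding the
    powers of [b] is a maximal ideal.  By [lifting_polyC], a maximal ideal of [A] above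
    the contraction of [Q], and avoiding a suitable [h], lifts to a prime above [Q]
    that avoids [b], and that is [Q] itself.  So [Q] contracts to a maximal ideal.
    Moreover [Q] is not just the extension of its contraction [P0]: otherwise the class of
    [1 + 'X * b] would be a unit in a polynomial ring over a field.  Therefore [Q] is
    algebraic over the field [A / P0]. *)
Lemma maximal_separation_poly (A : comNzRingType) : maximal_separation A -> maximal_separation {poly A}.
Proof.
move=> jA P b pP nPb.
have S : multiplicative [set x : {poly A} | exists n, x = b ^+ n].
  split; first by exists 0%N.
  by move=> _ _ [m ->] [n ->]; exists (m + n)%N; rewrite exprD.
have [|Q [pQ PQ QS Qmax]] := prime_avoiding (prime_is_ideal pP) S.
  by move=> x Px [n ex]; apply: nPb; apply: (primeX (n := n) pP); rewrite -ex.
have nQb : ~ Q b by move=> Qb; apply: (QS b Qb); exists 1%N.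
exists Q; split=> //.
have iQ := prime_is_ideal pQ.
have pP0 := contr_prime pQ; have iP0 := prime_is_ideal pP0.
have [h [nh L]] := lifting_polyC pQ nQb.
have [M [mM PM nMh]] := jA _ _ pP0 nh.
have pM := maximal_prime mM.
have [Q' [[pQ' incQ'] Q'0 cQ' nQ'b]] : exists Q' : nat -> set {poly A},
    [/\ prime_tower Q' 1, Q' 0%N = Q,
      (forall i, (i <= 1)%N -> polyC @^-1` (Q' i) = (if i == 0%N then contr Q else M))
      & ~ Q' 1%N b].
  apply: (L 1%N (fun i => if i == 0%N then contr Q else M)) => //.
  by split=> [[|[]] // _|[]].
(* The lift of [M] is above [Q] and avoids [b], hence equals [Q]. *)
have eM : M = contr Q.
  have <- : Q' 1%N = Q.
    apply/seteqP; split; last by rewrite -Q'0; apply: incQ'.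
    apply: contrapT => nQ'Q.
    have [|x Q'x [n ex]] := Qmax (Q' 1%N) (prime_is_ideal (pQ' 1%N isT)).
      by split=> //; rewrite -Q'0; apply: incQ'.
    by apply: nQ'b; apply: (primeX (n := n) (pQ' 1%N isT)); rewrite -ex.
  exact: (esym (cQ' 1%N isT)).
have [iM _ Mmax] := mM.
have unitM a : ~ contr Q a -> adj (contr Q) a 1.
  rewrite -eM => na; have [e|->//] := Mmax _ (adj_ideal a iM) (@sub_adj _ M a).
  by case: na; rewrite -e; apply: mem_adj.
have nqe : ~ Q `<=` ext (contr Q).
  move=> QP; have eQ : Q = ext (contr Q).
    by apply/seteqP; split=> //; apply: ext_contr_sub.
  set P0 := contr Q in eQ pP0 iP0 unitM.
  have peP := ext_prime pP0; have ieP := prime_is_ideal peP.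
  have nQg : ~ Q (1 + 'X * b).
    rewrite eQ => /(_ 0%N); rewrite coefD coef1 coefXM addr0.
    exact: prime1.
  have [x Jx [n ex]] := Qmax _ (adj_ideal _ iQ) (adj_proper iQ nQg).
  have iJ := adj_ideal (1 + 'X * b) iQ.
  (* Modulo [1 + 'X * b], the element [b] is invertible, with inverse [- 'X], so a power of [b]
     generates the unit ideal. *)
  have J1 : adj Q (1 + 'X * b) 1.
    have h1 : adj Q (1 + 'X * b) ('X ^+ n * b ^+ n).
      by apply: (idealM _ iJ); rewrite -ex.
    have : adj Q (1 + 'X * b) ((-1) ^+ n * ((1 + 'X * b - 1) ^+ n)).
      have -> : 1 + 'X * b - 1 = 'X * b by ring.
      by rewrite exprMn; apply: (idealM _ iJ).
    rewrite -exprMn; have -> : -1 * (1 + 'X * b - 1) = 1 - (1 + 'X * b) by ring.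
    elim: n {ex h1} => [|n IH]; first by rewrite expr0.
    rewrite exprSr mulrBr mulr1 => hn; apply: IH.
    rewrite -(subrK ((1 - (1 + 'X * b)) ^+ n * (1 + 'X * b)) (_ ^+ n)).
    by apply: (idealD iJ) => //; apply: (idealM _ iJ); apply: mem_adj.
  have {x Jx n ex J1} [k Qk] := J1.
  have nb : ~ ext P0 b by rewrite -eQ.
  have nk : ~ ext P0 k.
    move=> ek; apply: (prime1 pQ); rewrite -(subrK (k * (1 + 'X * b)) 1).
    by apply: idealD => //; rewrite eQ; apply: (idealMr _ ieP).
  have [b' [eb nb' _]] := truncation iP0 nb.
  have [k' [ek nk' _]] := truncation iP0 nk.
  pose g := 1 + 'X * b'.
  have b'0 : b' != 0.
    by apply: contra_not_neq nb' => ->; rewrite lead_coef0; apply: ideal0.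
  have k'0 : k' != 0.
    by apply: contra_not_neq nk' => ->; rewrite lead_coef0; apply: ideal0.
  have sXb : size ('X * b') = (size b').+1 by rewrite mulrC size_mulX.
  have sg : size g = (size b').+1.
    by rewrite /g addrC size_polyDl sXb // size_poly1 ltnS size_poly_gt0.
  have lg : lead_coef g = lead_coef b'.
    have h1 : (size (1%R : {poly A}) < size ('X * b')%R)%N.
      by rewrite sXb size_poly1 ltnS size_poly_gt0.
    by rewrite /g addrC (lead_coefDl h1) mulrC lead_coefMX.
  have : ext P0 (1 - k' * g).
    have -> : 1 - k' * g = (1 - k * (1 + 'X * b)) + (k - k') * (1 + 'X * b)
                + k' * ('X * (b - b')) by rewrite /g; ring.
    apply: (idealD ieP); first (apply: (idealD ieP); first by rewrite -eQ).
      exact: (idealMr _ ieP).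
    by apply: (idealM _ ieP); apply: (idealM _ ieP).
  move/(_ (size k' + size g).-2); rewrite coefB -mul_lead_coef lg coef1.
  have -> : ((size k' + size g).-2 == 0)%N = false.
    have : (0 < size k')%N by rewrite size_poly_gt0.
    have : (0 < size b')%N by rewrite size_poly_gt0.
    by rewrite sg addnS; case: (size b') => // m _; case: (size k') => // l _; rewrite addnS addSn.
  rewrite sub0r => /(idealN iP0); rewrite opprK; exact: primeMn.
have [f [qf nlf fmin]] := minimal_size iP0 iQ (ext_contr_sub iQ) nqe.
split=> //.
  by move=> eT; apply: (prime1 pQ); rewrite eT.
move=> J iJ QJ; have [JQ|/nsub_witness[g [Jg nQg]]] := pselect (J `<=` Q).
  by left; apply/seteqP.
right; have [a [na [c Qa]]] := algebraic_constant pQ qf nlf fmin nQg.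
have Ja : J a%:P.
  by rewrite -(subrK (c * g) a%:P); apply: idealD => //; [apply: QJ|apply: idealM].
have [d Q1] := unitM _ na.
apply/seteqP; split=> // x _; rewrite -(mulr1 x); apply: idealM => //.
rewrite -(subrK (d%:P * a%:P) 1); apply: idealD => //; last exact: idealM.
by apply: QJ; move: Q1; rewrite /contr /= polyCB polyCM polyC1.
Qed.

(** * Iterated polynomial rings *)

(** Polynomials in [n] variables, iterated so that properties pass from [R] to [pring R n]
    by induction on [n]. *)
Fixpoint pring (R : comNzRingType) (n : nat) : comNzRingType :=
  if n is k.+1 then ({poly (pring R k)} : comNzRingType) else R.

Fixpoint pconst (R : comNzRingType) (n : nat) : {rmorphism R -> pring R n} :=
  match n return {rmorphism R -> pring R n} with
  | 0%N => idfun
  | k.+1 => (polyC \o pconst R k)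
  end.

Fixpoint pvar (R : comNzRingType) (n i : nat) : pring R n :=
  match n return pring R n with
  | 0%N => 0
  | k.+1 => if i == k then 'X else (pvar R k i)%:P
  end.

Definition mono (C : comNzRingType) (s : nat) (x : nat -> C) (e : monomial) : C :=
  \prod_(i < s) x i ^+ e i.

Lemma mono_morph (C : comNzRingType) (s : nat) (x : nat -> C) :
  mmorphism (mono s x).
Proof.
split=> [e f|]; rewrite /mono.
  by rewrite -big_split /=; apply: eq_bigr => i _; rewrite cmM exprD.
by rewrite big1 // => i _; rewrite cm1 expr0.
Qed.

HB.instance Definition _ (C : comNzRingType) (s : nat) (x : nat -> C) :=
  isMultiplicative.Build _ _ (mono s x) (mono_morph s x).

Section IteratedPolynomials.
Context (R : comNzRingType).

Lemma acc_pring n : acc R -> acc (pring R n).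
Proof. by move=> aR; elim: n => //= n; apply: acc_poly. Qed.

Lemma maximal_separation_pring n : maximal_separation R -> maximal_separation (pring R n).
Proof. by move=> aR; elim: n => //= n; apply: maximal_separation_poly. Qed.

Lemma lifting_pconst n (q : set (pring R n)) : prime_ideal q ->
  lifting (pconst R n) q.
Proof.
elim: n q => [|n IH] q pq; first exact: lifting_id.
apply: (@lifting_comp _ _ _ (pconst R n) polyC); last exact: lifting_polyC.
by apply: IH; apply: contr_prime.
Qed.

(** The universal property of the polynomial ring. *)
Lemma pring_eval n (A : comNzRingType) (phi : {rmorphism R -> A}) (x : nat -> A) :
  exists psi : {rmorphism pring R n -> A},
    (forall r, psi (pconst R n r) = phi r) /\
    (forall i, (i < n)%N -> psi (pvar R n i) = x i).
Proof.
elim: n => [|n [psi [psic psiv]]]; first by exists phi.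
have cxn : commr_rmorph psi (x n) by move=> a; apply: mulrC.
exists (horner_morph cxn); split=> [r|i lin] /=.
  by rewrite horner_morphC.
case: eqP => [->|ne]; first by rewrite horner_morphX.
by rewrite horner_morphC psiv //; lia.
Qed.

Lemma contr_pconst n (q : set (pring R n)) : prime_ideal q ->
  prime_ideal (pconst R n @^-1` q).
Proof. exact: preimage_prime. Qed.

Fixpoint pext (n : nat) (I : set R) : set (pring R n) :=
  match n return set (pring R n) with
  | 0%N => I
  | k.+1 => ext (@pext k I)
  end.
Arguments pext n I : clear implicits.

Lemma pext_prime n P : prime_ideal P -> prime_ideal (pext n P).
Proof. by move=> pP; elim: n => //= n; apply: ext_prime. Qed.

Lemma pext_ideal n I : is_ideal I -> is_ideal (pext n I).
Proof. by move=> iI; elim: n => //= n; apply: ext_ideal. Qed.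

Lemma pext_const n I a : is_ideal I -> pext n I (pconst R n a) <-> I a.
Proof.
move=> iI; elim: n => //= n IH.
by split=> [/(extCE _ (pext_ideal n iI))/IH|/IH h] //; apply: extC => //; apply: pext_ideal.
Qed.

Lemma pext_sub n I (Q : set (pring R n)) : is_ideal Q ->
  (forall a, I a -> Q (pconst R n a)) -> pext n I `<=` Q.
Proof.
elim: n Q => [|n IH] Q iQ IQ //=.
apply: subset_trans (ext_contr_sub iQ); apply: extS; apply: IH => //.
exact: contr_ideal.
Qed.

Lemma pext_proper n I J : is_ideal I -> is_ideal J -> I `<` J ->
  pext n I `<` pext n J.
Proof.
move=> iI iJ IJ; elim: n => //= n IH.
by apply: ext_proper => //; apply: pext_ideal.
Qed.

Lemma mono_pvarS n e :
  mono n.+1 (pvar R n.+1) e = (mono n (pvar R n) e)%:P * 'X^(e n).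
Proof.
rewrite /mono big_ord_recr /= eqxx rmorph_prod; congr (_ * _).
apply: eq_bigr => i _; rewrite rmorphXn /=.
by rewrite ltn_eqF.
Qed.

(** Distinct monomials are independent modulo the polynomials with coefficients in [I], as
    one sees by comparing the coefficients of one variable after the other. *)
Lemma pext_coef n I (S : seq monomial) (c : monomial -> R) : is_ideal I -> uniq S ->
  (forall e f, e \in S -> f \in S -> (forall i, (i < n)%N -> e i = f i) -> e = f) ->
  pext n I (\sum_(e <- S) pconst R n (c e) * mono n (pvar R n) e) ->
  forall e, e \in S -> I (c e).
Proof.
move=> iI; elim: n S => [|n IH] S uS injS h e eS.
  have eS1 : S =i [:: e].
    by move=> f; rewrite inE; apply/idP/eqP => [fS|-> //]; apply: injS.
  have : perm_eq S [:: e] by apply: uniq_perm.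
  move=> pS; move: h; rewrite (perm_big _ pS) big_seq1 /= /mono big_ord0 mulr1.
  by [].
apply: (IH [seq f : monomial <- S | f n == e n] _ _ _ e).
- exact: filter_uniq.
- move=> f g; rewrite !mem_filter => /andP[/eqP fe fS] /andP[/eqP ge gS] fg.
  apply: injS => // i; rewrite ltnS leq_eqVlt => /predU1P[->|]; last exact: fg.
  by rewrite fe ge.
- rewrite big_filter big_mkcond /=.
  have := h (e n); rewrite coef_sum; congr (pext n I _); apply: eq_bigr => f _.
  rewrite mono_pvarS mulrA -polyCM coefCM coefXn eq_sym.
  by case: eqP => _; rewrite ?mulr1 ?mulr0.
- by rewrite mem_filter eqxx.
Qed.

(** Localized at [u], the polynomials modulo [p] are generated by the constants, since
    the class of the variable [i] is [b i / u]; so each variable contributes one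
    step to a chain below [p]. *)
Lemma chain_eval n (p : set (pring R n)) u (b : nat -> R) : prime_ideal p ->
  ~ p (pconst R n u) ->
  (forall i, (i < n)%N -> p (pconst R n u * pvar R n i - pconst R n (b i))) ->
  chain (pext n (pconst R n @^-1` p)) p n.
Proof.
elim: n p => [|n IH] p pp nu pb //.
have pp' := contr_prime pp; have ip := prime_is_ideal pp.
have ip' := prime_is_ideal pp'.
have c1 : chain (pext n (pconst R n @^-1` (contr p))) (contr p) n.
  apply: IH => // i lin.
  have := pb i (ltnW lin); rewrite /= ltn_eqF // /contr /= polyCB polyCM.
  by [].
apply: (@chain_rcons _ n _ (ext (contr p))) => //.
  apply: (chain_map (@ext_prime _) _ _ c1); last first.
    by apply: pext_prime; apply: (@contr_pconst n (contr p)).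
  by move=> Q Q' pQ pQ'; apply: ext_proper; apply: prime_is_ideal.
split; first exact: ext_contr_sub.
move=> pe; have := pe _ (pb n (ltnSn n)); rewrite /= eqxx => /(_ 1%N).
rewrite coefB coefCM coefX coefC mulr1 subr0; exact: nu.
Qed.

End IteratedPolynomials.

Arguments pext {R} n I.

(** * Nonzero rings, residue rings and residue fields *)

(** Polynomial rings and fields require the nonzero ring structure.  The new structure
    has the given one underneath, so that a statement about [R] can be proved
    for [R']. *)
Lemma nonzero_pz_nz (R : comPzRingType) : (1 : R) != 0 ->
  exists R' : comNzRingType, (R' : comPzRingType) = R.
Proof.
move=> one_neq0.
have : exists R' : comNzRingType, (R' : comPzRingType) =
    GRing.ComPzRing.Pack (GRing.ComPzRing.class R).
  (* With the class [c] a variable, the equality holds by computation after a case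
     analysis. *)
  case: R one_neq0 => T c one_neq0.
  pose m := GRing.PzSemiRing_isNonZero.Build (GRing.ComPzRing.Pack c) one_neq0.
  exists (HB.pack_for comNzRingType T c m).
  by clearbody m; clear one_neq0; case: c m.
by case: R one_neq0.
Qed.

Lemma fraction_numden (D : idomainType) (z : {fraction D}) :
  exists x y : D, y != 0 /\ z = FracField.tofrac x / FracField.tofrac y.
Proof.
elim/quotW: z => r; exists (frac r).1, (frac r).2.
have d0 := denom_ratioP r; split=> //.
have d0' : FracField.tofrac (frac r).2 != 0 by rewrite tofrac_eq0.
apply: (mulIf d0'); rewrite mulfVK //.
rewrite -[LHS]/(FracField.mul _ _) !piE; apply/eqmodP; rewrite /= FracField.equivfE.
rewrite /FracField.mulf !numden_Ratio ?mulf_neq0 ?oner_neq0 //.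
by rewrite !mulr1 mulrC.
Qed.

Section ResidueRing.
Context (R : comNzRingType) (P : set R) (pP : prime_ideal P).

Definition prime_mem of prime_ideal P : pred R := fun x => `[< P x >].
Local Notation I := (prime_mem pP).

Lemma prime_mem_idealr : idealr_closed I.
Proof.
have iP := prime_is_ideal pP; split.
- by apply/asboolP; exact: (ideal0 iP).
- by apply/negP => /asboolP; exact: (prime1 pP).
- move=> a x y /asboolP Px /asboolP Py; apply/asboolP.
  by apply: idealD => //; apply: idealM.
Qed.
HB.instance Definition _ := isIdealr.Build R I prime_mem_idealr.

Lemma prime_mem_prime : prime_idealr_closed I.
Proof.
by move=> x y /asboolP/(primeM pP)[h|h]; apply/orP; [left|right]; apply/asboolP.
Qed.
HB.instance Definition _ := isPrimeIdealrClosed.Build R I prime_mem_prime.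

(** The quotient ring of [R] by [P]; units and inverses are chosen classically,
    to obtain an integral domain and its field of fractions. *)
Definition residue := {ideal_quot (I : prime_idealr R)}.
HB.instance Definition _ := GRing.ComNzRing.on residue.

Definition residue_unit : pred residue := fun x => `[< exists y, y * x = 1 >].
Definition residue_inv (x : residue) : residue :=
  if pselect (exists y, y * x = 1) is left h then projT1 (cid h) else x.

Lemma residue_mulVx : {in residue_unit, left_inverse 1 residue_inv *%R}.
Proof.
move=> x /asboolP h; rewrite /residue_inv; case: pselect => // h'.
by case: (cid h').
Qed.
Lemma residue_unitPl (x y : residue) : y * x = 1 -> residue_unit x.
Proof. by move=> h; apply/asboolP; exists y. Qed.
Lemma residue_invr_out : {in [predC residue_unit], residue_inv =1 id}.
Proof.
move=> x; rewrite inE => /asboolP h; rewrite /residue_inv; by case: pselect.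
Qed.
HB.instance Definition _ := GRing.ComNzRing_hasMulInverse.Build residue
  residue_mulVx residue_unitPl residue_invr_out.

Lemma residue_integral (x y : residue) : x * y = 0 -> (x == 0) || (y == 0).
Proof. exact: Quotient.rquot_IdomainAxiom. Qed.
HB.instance Definition _ := GRing.ComUnitRing_isIntegral.Build residue residue_integral.

(** All that is needed about the residue ring [D] and the residue field [K] at [P],
    without their construction. *)
Lemma residue_field :
  exists (D : comNzRingType) (K : fieldType)
    (p : {rmorphism R -> D}) (t : {rmorphism D -> K}),
    [/\ forall y, exists x, p x = y, forall x, p x = 0 <-> P x, injective t &
      forall z, exists x y, t y != 0 /\ z = t x / t y].
Proof.
pose p : {rmorphism R -> {ideal_quot (I : prime_idealr R)}} := (\pi_{ideal_quot (I : prime_idealr R)})%qT.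
exists residue, {fraction residue}, p, (@FracField.tofrac residue).
split.
- by move=> y; exists (repr y); rewrite /p /= reprK.
- move=> x; have e : (p x == 0) = (x \in (I : pred R)).
    by rewrite -(rmorph0 p) /p /= -Quotient.idealrBE subr0.
  split=> [/eqP|Px]; first by rewrite e => /asboolP.
  by apply/eqP; rewrite e; apply/asboolP.
- by move=> x y /eqP; rewrite tofrac_eq => /eqP.
- move=> z; have [x [y [y0 ->]]] := fraction_numden z.
  by exists x, y; rewrite tofrac_eq0.
Qed.
End ResidueRing.

(** * Polynomials as combinations of monomials *)

Section Span.
Context (R : comNzRingType).

Lemma pring_ind n (V : set (pring R n)) :
  (forall r, V (pconst R n r)) -> (forall i, (i < n)%N -> V (pvar R n i)) ->
  (forall x y, V x -> V y -> V (x + y)) -> (forall x y, V x -> V y -> V (x * y)) ->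
  forall g, V g.
Proof.
elim: n V => [|n IH] V Vc Vv VD VM g; first exact: Vc.
have VC h : V h%:P.
  apply: (IH (fun h => V h%:P)) => [r|i lin|x y Vx Vy|x y Vx Vy].
  - exact: Vc.
  - by have := Vv i (ltnW lin); rewrite /= ltn_eqF.
  - by rewrite polyCD; apply: VD.
  - by rewrite polyCM; apply: VM.
have VX : V 'X by have := Vv n (ltnSn n); rewrite /= eqxx.
elim/poly_ind: g => [|p c Vp]; first by rewrite -polyC0.
by apply: VD => //; apply: VM.
Qed.

Lemma poly_eval_mmap (A : comNzRingType) (phi : {rmorphism R -> A}) s (a : s.-tuple A) f :
  poly_eval phi a f = mmap phi (mono s (fun i => nth 0 a i)) f.
Proof.
rewrite /poly_eval /mmap; apply: eq_bigr => m _; congr (_ * _).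
by apply: eq_bigr => i _; rewrite (tnth_nth 0).
Qed.

Lemma mmap_rmorph (A B : comNzRingType) (phi : {rmorphism R -> A})
  (psi : {rmorphism A -> B}) s (x : nat -> A) f :
  psi (mmap phi (mono s x) f) = mmap (psi \o phi) (mono s (psi \o x)) f.
Proof.
rewrite /mmap rmorph_sum; apply: eq_bigr => m _; rewrite rmorphM /=; congr (_ * _).
by rewrite /mono rmorph_prod; apply: eq_bigr => i _; rewrite rmorphXn.
Qed.

Lemma eq_mmap (A : comNzRingType) (phi psi : R -> A) s (x y : nat -> A)
  (f : {malg R[monomial]}) :
  phi =1 psi -> (forall i, (i < s)%N -> x i = y i) ->
  mmap phi (mono s x) f = mmap psi (mono s y) f.
Proof.
move=> e1 e2; apply: eq_bigr => m _; rewrite e1; congr (_ * _).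
by apply: eq_bigr => i _; rewrite e2.
Qed.

Lemma mmap_sum (A : comNzRingType) (phi : {additive R -> A}) (h : monomial -> A)
  (I : Type) (r : seq I) (F : I -> {malg R[monomial]}) :
  mmap phi h (\sum_(i <- r) F i) = \sum_(i <- r) mmap phi h (F i).
Proof. exact: (raddf_sum (mmap phi h)). Qed.

Lemma in_varsD s (f g : {malg R[monomial]}) : in_vars s f -> in_vars s g -> in_vars s (f + g).
Proof.
move=> vf vg m /(fsubsetP (msuppD_le f g)); rewrite in_fsetU => /orP[]; [exact: vf|exact: vg].
Qed.

Lemma in_varsM s (f g : {malg R[monomial]}) : in_vars s f -> in_vars s g -> in_vars s (f * g).
Proof.
move=> vf vg m /msuppM_le[m1 [m2 [m1f m2g ->]]] i si.
by rewrite cmM (vf _ m1f) // (vg _ m2g).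
Qed.

Lemma in_varsU s c (m : monomial) : (forall i, (s <= i)%N -> m i = 0%N) ->
  in_vars s (<< c *g m >> : {malg R[monomial]}).
Proof.
move=> vm m' /(fsubsetP msuppU_le); rewrite in_fset1 => /eqP ->; exact: vm.
Qed.

Lemma mono_ucm (A : comNzRingType) n (x : nat -> A) i : (i < n)%N ->
  mono n x (ucm i) = x i.
Proof.
move=> lin; rewrite /mono (bigD1 (Ordinal lin)) //= cmUU expr1 big1 ?mulr1 // => j ne.
rewrite cmU; case: eqP => [e|]; last by rewrite expr0.
by case/eqP: ne; apply: val_inj.
Qed.

(** This connects iterated polynomials with families of coefficients indexed
    by monomials. *)
Lemma pring_span n (g : pring R n) : exists f : {malg R[monomial]},
  in_vars n f /\ mmap (pconst R n) (mono n (pvar R n)) f = g.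
Proof.
move: g; apply: pring_ind => [r|i lin|x y [f [vf <-]] [g [vg <-]]|x y [f [vf <-]] [g [vg <-]]].
- exists << r *g mone >>; split; first by apply: in_varsU => i _; rewrite cm1.
  by rewrite mmapU mmorph1 mulr1.
- exists << 1 *g ucm i >>; split.
    by apply: in_varsU => j nj; rewrite cmU; case: eqP => // e; move: nj; rewrite -e leqNgt lin.
  by rewrite mmapU /= rmorph1 mul1r mono_ucm.
- by exists (f + g); split; [apply: in_varsD|rewrite raddfD].
- by exists (f * g); split; [apply: in_varsM|rewrite rmorphM].
Qed.

End Span.

(** * Dickson's lemma *)

Definition evar s (e : monomial) : Prop := forall i, (s <= i)%N -> e i = 0%N.
Definition mdvd (e f : monomial) : Prop := forall i, (e i <= f i)%N.

Lemma evarM s e f : evar s e -> evar s f -> evar s (mmul e f).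
Proof. by move=> ve vf i si; rewrite cmM ve // vf. Qed.
Lemma evar1 s : evar s mone. Proof. by move=> i _; rewrite cm1. Qed.

Lemma mdvdP (e f : monomial) : mdvd e f -> f = mmul e (divcm f e).
Proof. by move=> ef; apply/eqP/cmP => i; rewrite cmM divcmE subnKC. Qed.

Lemma evar_div s (e f : monomial) : evar s f -> evar s (divcm f e).
Proof. by move=> vf i si; rewrite divcmE vf. Qed.

Section Dickson.

Lemma nat_increasing_subsequence (u : nat -> nat) :
  exists p : nat -> nat, (forall n, (p n < p n.+1)%N) /\
    (forall n, (u (p n) <= u (p n.+1))%N).
Proof.
have exk n : exists k, (n <= k)%N /\ forall j, (n <= j)%N -> (u k <= u j)%N.
  have exm : exists m, `[< exists2 k, (n <= k)%N & u k = m >].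
    by exists (u n); apply/asboolP; exists n.
  have [m /asboolP[k nk <-] mmin] := ex_minnP exm.
  by exists k; split=> // j nj; apply: mmin; apply/asboolP; exists j.
have [K KP] := choice exk.
pose p := fix p n := if n is m.+1 then K (p m).+1 else K 0%N.
have pS n : (p n < p n.+1)%N by have [] := KP (p n).+1.
exists p; split=> // n.
have h : exists m, p n = K m /\ (m <= p n)%N.
  by case: n => [|n]; [exists 0%N|exists (p n).+1; split=> //; apply: (pS n)].
have [m [e mp]] := h.
by rewrite e; apply: (KP m).2; apply: leq_trans mp _; apply: ltnW.
Qed.

Lemma increasing_le (p : nat -> nat) : (forall n, (p n < p n.+1)%N) ->
  forall m n, (m < n)%N -> (p m < p n)%N.
Proof. by move=> h m n; apply: (homo_ltn ltn_trans h). Qed.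

(** In the form of an infinite subsequence, increasing for divisibility; the
    variables are treated one after another. *)
Lemma dickson s (e : nat -> monomial) :
  exists p : nat -> nat, (forall n, (p n < p n.+1)%N) /\
    (forall n i, (i < s)%N -> (e (p n) i <= e (p n.+1) i)%N).
Proof.
elim: s => [|s [p [pinc pe]]]; first by exists id.
have [q [qinc qe]] := nat_increasing_subsequence (fun n => e (p n) s).
exists (p \o q); split=> n /=; first by apply: increasing_le.
move=> i; rewrite ltnS leq_eqVlt => /predU1P[->|lis]; first exact: qe.
have [d <-] : exists d, (q n + d = q n.+1)%N.
  by exists (q n.+1 - q n)%N; rewrite subnKC // ltnW.
elim: d => [|d IH]; first by rewrite addn0.
by apply: (leq_trans IH); rewrite addnS; apply: pe.
Qed.

(** Otherwise choose monomials [e n] such that none of the earlier ones serves for the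
    next; by Dickson's lemma, a subsequence increases for divisibility, and its ideals
    would increase forever. *)
Lemma finite_generators (C : comPzRingType) s (L : monomial -> set C) : acc C ->
  (forall e, evar s e -> is_ideal (L e)) ->
  (forall e f, evar s e -> evar s f -> mdvd e f -> L e `<=` L f) ->
  exists T : seq monomial, (forall t, t \in T -> evar s t) /\
    forall e, evar s e -> exists t, [/\ t \in T, mdvd t e & L e `<=` L t].
Proof.
move=> aC iL Lmon; apply: contrapT => none.
pose St := {T : seq monomial | forall t, t \in T -> evar s t}.
have step (n : nat) (T : St) : exists T' : St, exists e : monomial,
    [/\ evar s e, sval T' = e :: sval T &
      forall t, t \in sval T -> ~ (mdvd t e /\ L e `<=` L t)].
  apply: contrapT => h; apply: none; exists (sval T); split; first exact: (svalP T).
  move=> e ve; apply: contrapT => h'; apply: h.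
  have vT' : forall t, t \in e :: sval T -> evar s t.
    by move=> t; rewrite inE => /predU1P[->|/(svalP T)].
  exists (exist _ _ vT'), e; split=> // t tT [te Let]; apply: h'.
  by exists t.
have nil : forall t : monomial, t \in [::] -> evar s t by [].
have [F [_ FP]] := dependent_choice (exist _ _ nil : St) step.
have [e eP] := choice FP.
have eF m n : (m < n)%N -> e m \in sval (F n).
  elim: n => // n IH; rewrite ltnS leq_eqVlt; have [_ -> _] := eP n.
  by move=> /predU1P[->|/IH h]; rewrite inE ?eqxx // h orbT.
have [p [pinc pe]] := dickson s e.
have ve n : evar s (e n) by have [] := eP n.
have pd n : mdvd (e (p n)) (e (p n.+1)).
  by move=> i; have [lis|les] := ltnP i s; [apply: pe|rewrite !ve].
have [|N hN] := aC (fun n => L (e (p n))) (fun n => iL _ (ve _)).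
  by move=> n; apply: Lmon.
have [_ _ h] := eP (p N.+1); apply: (h (e (p N))); first exact: eF.
by split=> //; apply: hN.
Qed.

End Dickson.

(** * Fourier-Motzkin elimination *)

Section Farkas.

Definition holds (strict : bool) (x y : rat) : Prop := if strict then x < y else x <= y.

Lemma holdsW b x y : holds b x y -> x <= y.
Proof. by case: b => //= /ltW. Qed.

Lemma seq_argmax (X : seq (bool * rat)) x0 : x0 \in X ->
  exists x, x \in X /\ forall y, y \in X -> y.2 <= x.2.
Proof.
elim: X x0 => // x1 X IH x0 _.
case: X IH => [|x2 X] IH.
  by exists x1; split=> [|y]; rewrite inE // => /eqP ->.
have [x [xX xmax]] := IH x2 (mem_head _ _).
have [h|h] := leP x1.2 x.2.
  by exists x; split=> [|y]; rewrite inE ?xX ?orbT // => /predU1P[->|/xmax].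
exists x1; split=> [|y]; rewrite inE ?eqxx // => /predU1P[->|/xmax] //.
by move=> h'; apply: le_trans h' (ltW h).
Qed.

Lemma between_bounds (X Y : seq (bool * rat)) :
  (forall x y, x \in X -> y \in Y -> holds (x.1 || y.1) x.2 y.2) ->
  exists t, (forall x, x \in X -> holds x.1 x.2 t) /\
            (forall y, y \in Y -> holds y.1 t y.2).
Proof.
move=> h.
have oppmem (y : bool * rat) : y \in Y -> (y.1, - y.2) \in [seq (y.1, - y.2) | y <- Y].
  by move=> yY; apply/mapP; exists y.
have minY y0 : y0 \in Y -> exists y, y \in Y /\ forall z, z \in Y -> y.2 <= z.2.
  move=> /oppmem/seq_argmax[z [/mapP[y yY ->] ymax]]; exists y; split=> // z' z'Y.
  by have := ymax _ (oppmem _ z'Y); rewrite /= lerN2.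
case: X h => [|x0 X] h.
  case: Y h minY oppmem => [|y0 Y] h minY _; first by exists 0.
  have [y [yY ymin]] := minY y0 (mem_head _ _).
  exists (y.2 - 1); split=> // z /ymin; rewrite /holds; case: z.1 => /= h1; lra.
have [x [xX xmax]] := seq_argmax (mem_head x0 X).
case: Y h minY oppmem => [|y0 Y] h minY _.
  exists (x.2 + 1); split=> // z /xmax; rewrite /holds; case: z.1 => /= h1; lra.
have [y [yY ymin]] := minY y0 (mem_head _ _).
have xy := holdsW (h x y xX yY).
exists ((x.2 + y.2) / 2); split=> z zin.
  have := h z y zin yY; have := xmax z zin; move: xy; rewrite /holds.
  by case: z.1; case: y.1 => /= h1 h2 h3; lra.
have := h x z xX zin; have := ymin z zin; move: xy; rewrite /holds.
by case: z.1; case: x.1 => /= h1 h2 h3; lra.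
Qed.

Context (s : nat).
Implicit Types (v : 'rV[int]_s) (w : 'I_s -> rat).

Definition dot w v : rat := \sum_i w i * (v 0 i)%:~R.

Lemma dotD w u v : dot w (u + v) = dot w u + dot w v.
Proof. by rewrite /dot -big_split; apply: eq_bigr => i _; rewrite /= mxE intrD mulrDr. Qed.

Lemma dotMn w v n : dot w (v *+ n) = dot w v * n%:R.
Proof. by elim: n => [|n IH]; rewrite ?mulr0n ?mulrS ?dotD ?IH; [rewrite mulr0 /dot big1 // => i _; rewrite mxE mulr0|rewrite mulrDr mulr1]. Qed.

Lemma dot_upd w k t v :
  dot (fun i => if i == k then t else w i) v =
  dot (fun i => if i == k then 0 else w i) v + t * (v 0 k)%:~R.
Proof.
rewrite /dot (bigD1 k) //= eqxx [in RHS](bigD1 k) //= eqxx mul0r add0r addrC.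
by congr (_ + _); apply: eq_bigr => i /negbTE ->.
Qed.

(** A finite system of weak and strict homogeneous inequalities has a solution unless
    a positive combination of them says that [0 < 0].  The predicate [pos] is any
    collection of coefficient vectors, with strictness flags, which is stable under
    sums and does not contain this contradiction; elimination of one unknown
    stays inside of it. *)
Lemma fourier_motzkin (pos : bool -> 'rV[int]_s -> Prop) :
  (forall a b u v, pos a u -> pos b v -> pos (a || b) (u + v)) -> ~ pos true 0 ->
  forall l : seq (bool * 'rV[int]_s), (forall p, p \in l -> pos p.1 p.2) ->
  exists w, forall p, p \in l -> holds p.1 0 (dot w p.2).
Proof.
move=> posD npos0.
have posMn a v n : (0 < n)%N -> pos a v -> pos a (v *+ n).
  case: n => // n _ pv; elim: n => [|n IH]; first by rewrite mulr1n.
  by rewrite mulrS -[a]orbb; apply: posD.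
suff main k : (k <= s)%N -> forall l : seq (bool * 'rV[int]_s),
    (forall p, p \in l -> pos p.1 p.2) ->
    (forall p, p \in l -> forall i : 'I_s, (k <= i)%N -> p.2 0 i = 0) ->
    exists w, forall p, p \in l -> holds p.1 0 (dot w p.2).
  move=> l pl; apply: (main s (leqnn s) l pl) => p _ i; by rewrite leqNgt ltn_ord.
elim: k => [_|k IH ks] l pl zl.
  exists (fun=> 0) => p pin; have e : p.2 = 0.
    by apply/rowP => i; rewrite mxE; apply: zl.
  have := pl p pin; rewrite e; case: p.1 => [/npos0 //|_] /=.
  by rewrite /dot big1 // => i _; rewrite mul0r.
pose ik := Ordinal ks.
pose b (p : bool * 'rV[int]_s) := p.2 0 ik.
(* The combination in which the unknown [k] cancels, for [p] with a positive and [q]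
   with a negative coefficient. *)
pose comb (p q : bool * 'rV[int]_s) := (p.1 || q.1, p.2 *+ `|b q|%N + q.2 *+ `|b p|%N).
pose Z := [seq p <- l | b p == 0].
pose Pp := [seq p <- l | 0 < b p].
pose Pn := [seq p <- l | b p < 0].
pose l' := Z ++ [seq comb p q | p <- Pp, q <- Pn].
have [||w hw] := IH (ltnW ks) l'.
- move=> p; rewrite mem_cat => /orP[|/allpairsP[[p1 p2] /= [h1 h2 ->]]].
    by rewrite mem_filter => /andP[_ /pl].
  move: h1 h2; rewrite !mem_filter => /andP[b1 /pl h1] /andP[b2 /pl h2].
  by apply: posD; apply: posMn => //; rewrite absz_gt0; [rewrite lt_eqF|rewrite gt_eqF].
- move=> p; rewrite mem_cat => /orP[pZ|/allpairsP[[p1 p2] /= [h1 h2 ->]]] i ki.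
    move: pZ; rewrite mem_filter => /andP[/eqP bp pin].
    move: ki; rewrite leq_eqVlt => /predU1P[e|ki]; last exact: zl.
    by rewrite (_ : i = ik) //; apply: val_inj.
  move: h1 h2; rewrite !mem_filter => /andP[b1 i1] /andP[b2 i2].
  rewrite /= !mxE !mulmxnE; move: ki; rewrite leq_eqVlt => /predU1P[e|ki].
    rewrite (_ : i = ik); last exact: val_inj.
    rewrite -/(b p1) -/(b p2); move: (b p1) (b p2) b1 b2 => x y; nia.
  by rewrite (zl _ i1) // (zl _ i2) // !mul0rn addr0.
pose w0 i := if i == ik then 0 else w i.
have dw0 v : v 0 ik = 0 -> dot w v = dot w0 v.
  move=> v0; rewrite -[RHS]addr0 -(mulr0 (w ik)) -[X in _ * X](_ : (v 0 ik)%:~R = 0 :> rat) ?v0 //.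
  rewrite -v0 -dot_upd; apply: eq_bigr => i _; by case: eqP => // ->.
(* Lower bounds [X] and upper bounds [Y] on the unknown [k], given the others. *)
pose X := [seq (p.1, - dot w0 p.2 / (b p)%:~R) | p <- Pp].
pose Y := [seq (p.1, - dot w0 p.2 / (b p)%:~R) | p <- Pn].
have [|t [tX tY]] := @between_bounds X Y.
  move=> _ _ /mapP[p pP ->] /mapP[q qN ->] /=.
  have : holds (p.1 || q.1) 0 (dot w (comb p q).2).
    by apply: (hw (comb p q)); rewrite mem_cat; apply/orP; right; apply/allpairsP; exists (p, q).
  move: pP qN; rewrite !mem_filter => /andP[bp _] /andP[bq _].
  rewrite dw0 /=; last first.
    rewrite !mxE !mulmxnE -/(b p) -/(b q); move: (b p) (b q) bp bq => x y; nia.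
  rewrite dotD !dotMn.
  have -> : (`|b q|%N)%:R = - (b q)%:~R :> rat.
    by rewrite -[LHS]/((`|b q|%N)%:Z%:~R) abszE ltr0_norm // rmorphN.
  have -> : (`|b p|%N)%:R = (b p)%:~R :> rat.
    by rewrite -[LHS]/((`|b p|%N)%:Z%:~R) abszE gtr0_norm.
  have bp' : 0 < (b p)%:~R :> rat by rewrite ltr0z.
  have bq' : (b q)%:~R < 0 :> rat by rewrite ltrz0.
  have e : dot w0 p.2 * - (b q)%:~R + dot w0 q.2 * (b p)%:~R =
     ((- dot w0 q.2 / (b q)%:~R) - (- dot w0 p.2 / (b p)%:~R)) * ((b p)%:~R * - (b q)%:~R).
    by field; rewrite gt_eqF // lt_eqF.
  have c0 : 0 < (b p)%:~R * - (b q)%:~R :> rat by rewrite mulr_gt0 // oppr_gt0.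
  rewrite e /holds; case: (p.1 || q.1).
    by rewrite pmulr_lgt0 // subr_gt0.
  by rewrite pmulr_lge0 // subr_ge0.
exists (fun i => if i == ik then t else w i) => p pin.
rewrite dot_upd -/(b p) -/w0.
have [bp|bp|bp] := ltgtP (b p) 0.
- have := tY (p.1, - dot w0 p.2 / (b p)%:~R).
  rewrite (map_f (fun p => (p.1, - dot w0 p.2 / (b p)%:~R))) ?mem_filter ?bp // => /(_ isT) /=.
  have bp' : (b p)%:~R < 0 :> rat by rewrite ltrz0.
  rewrite /holds; case: p.1; rewrite ?ltr_ndivlMr ?ler_ndivlMr // ?ltr_ndivrMr ?ler_ndivrMr ?ltr_ndivlMr ?ler_ndivlMr // => h1; lra.
- have := tX (p.1, - dot w0 p.2 / (b p)%:~R).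
  rewrite (map_f (fun p => (p.1, - dot w0 p.2 / (b p)%:~R))) ?mem_filter ?bp // => /(_ isT) /=.
  have bp' : 0 < (b p)%:~R :> rat by rewrite ltr0z.
  rewrite /holds; case: p.1; rewrite ?ltr_pdivrMr ?ler_pdivrMr // => h1; lra.
- rewrite bp mulr0 addr0 -dw0; last exact: bp.
  by apply: hw; rewrite mem_cat mem_filter bp eqxx pin.
Qed.

End Farkas.

(** * Monomial preorders and weights *)

Definition wt (w : nat -> nat) (s : nat) (e : monomial) : nat := (\sum_(i < s) w i * e i)%N.

Lemma wtM w s e f : wt w s (mmul e f) = (wt w s e + wt w s f)%N.
Proof. by rewrite /wt -big_split; apply: eq_bigr => i _; rewrite cmM mulnDr. Qed.
Section MonomialPreorders.
Context (prec : monomial -> monomial -> Prop) (mp : monomial_preorder prec).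
Implicit Types (u v a b c : monomial).

Let swo : strict_weak_order prec. Proof. by case: mp. Qed.
Lemma prec_one u : u <> mone -> prec mone u. Proof. by case: mp => _ h _; apply: h. Qed.
Lemma precM u v c : prec u v <-> prec (mmul u c) (mmul v c).
Proof. by case: mp => _ _ h; apply: h. Qed.
Lemma precMl u v c : prec u v <-> prec (mmul c u) (mmul c v).
Proof. by rewrite ![mmul c _]mulmC; apply: precM. Qed.
Lemma prec_split a b c : prec a b -> prec a c \/ prec c b.
Proof. by move=> /(@swo a b c)[]. Qed.
Lemma prec_asym a b : prec a b -> ~ prec b a.
Proof. by move=> /(@swo a b a)[]. Qed.
Lemma prec_irr a : ~ prec a a. Proof. by move=> h; apply: (prec_asym h). Qed.
Lemma prec_trans b a c : prec a b -> prec b c -> prec a c.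
Proof. by move=> ab bc; case: (prec_split c ab) => // /(prec_asym bc). Qed.

(** Comparisons, strict for the flag [true] and weak for [false], multiply: the preorder
    behaves like an ordered group. *)
Lemma precMM (s t : bool) a b u v :
  (if s then prec a b else ~ prec b a) -> (if t then prec u v else ~ prec v u) ->
  if s || t then prec (mmul a u) (mmul b v) else ~ prec (mmul b v) (mmul a u).
Proof.
case: s => [ab|nba].
  have h1 : prec (mmul a u) (mmul b u) := (precM _ _ _).1 ab.
  case: t => [uv|nvu] /=; first exact: (prec_trans h1 ((precMl _ _ _).1 uv)).
  by case: (prec_split (mmul b v) h1) => // /(precMl _ _ _).2.
case: t => [uv|nvu] /=.
  have h1 : prec (mmul a u) (mmul a v) := (precMl _ _ _).1 uv.
  by case: (prec_split (mmul b v) h1) => // /(precM _ _ _).2.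
by move=> h; case: (prec_split (mmul a v) h) => [/(precM _ _ _).2|/(precMl _ _ _).2].
Qed.

Lemma prec_dvd a b : mdvd a b -> ~ prec b a.
Proof.
move=> /mdvdP eb ba; have h : prec (divcm b a) mone.
  by apply: (precMl _ _ a).2; rewrite -eb mulm1.
have [e|/eqP ne] := eqVneq (divcm b a) mone; first by move: h; rewrite e; apply: prec_irr.
exact: (prec_asym (prec_one ne)).
Qed.

(** By Dickson's lemma, monomial preorders are well-founded in finitely many variables. *)
Lemma monomial_minimum s (S : set monomial) : (forall e, S e -> evar s e) ->
  S !=set0 -> exists2 e, S e & forall f, S f -> ~ prec f e.
Proof.
move=> vS [e0 Se0]; apply: contrapT => none.
have step (n : nat) (e : {e | S e}) : exists f : {e | S e}, prec (sval f) (sval e).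
  apply: contrapT => h; apply: none; exists (sval e); first exact: (svalP e).
  by move=> f Sf fe; apply: h; exists (exist _ f Sf).
have [F [_ FP]] := dependent_choice (exist _ e0 Se0) step.
have lt m n : (m < n)%N -> prec (sval (F n)) (sval (F m)).
  elim: n => // n IH; rewrite ltnS leq_eqVlt => /predU1P[->|/IH h]; first exact: FP.
  exact: prec_trans (FP n) h.
have [p [pinc pe]] := dickson s (fun n => sval (F n)).
apply: (@prec_dvd (sval (F (p 0%N))) (sval (F (p 1%N)))); last by apply: lt.
move=> i; have [lis|les] := ltnP i s; first exact: pe.
by rewrite (vS _ (svalP (F (p 0%N))) i les).
Qed.

(** The differences of exponents in true comparisons form a collection as in
    [fourier_motzkin]; the comparisons of 1 with the variables make the weights positive, and
    multiplying by the denominators makes them integral. *)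
Lemma weights s (l : seq (bool * (monomial * monomial))) :
  (forall p, p \in l -> [/\ evar s p.2.1, evar s p.2.2 &
     if p.1 then prec p.2.1 p.2.2 else ~ prec p.2.2 p.2.1]) ->
  exists w : nat -> nat, (forall i, (i < s)%N -> (0 < w i)%N) /\
    forall p, p \in l -> if p.1 then (wt w s p.2.1 < wt w s p.2.2)%N
                         else (wt w s p.2.1 <= wt w s p.2.2)%N.
Proof.
move=> lP.
pose diff (u v : monomial) : 'rV[int]_s := \row_i ((v i)%:Z - (u i)%:Z).
pose pos (b : bool) (x : 'rV[int]_s) := exists u v, [/\ evar s u, evar s v,
   (if b then prec u v else ~ prec v u) & x = diff u v].
have posD : forall (b1 b2 : bool) x y, pos b1 x -> pos b2 y -> pos (b1 || b2) (x + y).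
  move=> b1 b2 _ _ [u [v [vu vv uv ->]]] [u' [v' [vu' vv' uv' ->]]].
  exists (mmul u u'), (mmul v v'); split; [exact: evarM|exact: evarM|exact: precMM|].
  by apply/rowP => i; rewrite !mxE !cmM !PoszD; ring.
have npos0 : ~ pos true 0.
  move=> [u [v [vu vv uv e]]]; suff euv : u = v by move: uv; rewrite euv; apply: prec_irr.
  apply/eqP/cmP => i; have [lis|les] := ltnP i s; last by rewrite vu // vv.
  have := congr1 (fun x : 'rV_s => x 0 (Ordinal lis)) e; rewrite !mxE /=.
  by move/esym/eqP; rewrite subr_eq0 => /eqP[].
pose l1 := [seq (p.1, diff p.2.1 p.2.2) | p <- l] ++
           [seq (true, diff mone (ucm (val i))) | i <- enum 'I_s].
have [p|w hw] := fourier_motzkin posD npos0 (l := l1).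
  rewrite mem_cat => /orP[/mapP[q /lP[v1 v2 h] ->]|/mapP[i _ ->]] /=.
    by exists q.2.1, q.2.2.
  exists mone, (ucm (val i)); split => //; first exact: evar1.
  - move=> j; rewrite cmU; case: eqP => // <-; by rewrite leqNgt ltn_ord.
  - by apply: prec_one => /eqP/cmP/(_ (val i)); rewrite cmUU cm1.
have wpos i : 0 < w i.
  have := hw (true, diff mone (ucm (val i))).
  rewrite mem_cat (map_f (fun i : 'I_s => (true, diff mone (ucm (val i))))) ?mem_enum ?orbT //.
  move=> /(_ isT); rewrite /holds /= /dot (bigD1 i) //= mxE cmUU cm1 subr0 mulr1.
  rewrite big1 ?addr0 // => j ne; rewrite mxE cmU cm1 subr0.
  by rewrite (_ : (val i == val j) = false) ?mulr0 //; apply: contraNF ne => /eqP/val_inj ->.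
(* A common denominator of the weights. *)
pose d := (\prod_(i < s) `|denq (w i)|)%N.
have d0 : (0 < d)%N by rewrite prodn_gt0 // => i; rewrite absz_gt0 denq_neq0.
have exW (i : 'I_s) : exists W : nat, (W%:R : rat) = w i * d%:R.
  exists (`|numq (w i)| * \prod_(j < s | j != i) `|denq (w j)|)%N.
  have -> : d = (`|denq (w i)| * \prod_(j < s | j != i) `|denq (w j)|)%N.
    by rewrite /d (bigD1 i).
  rewrite !natrM mulrA; congr (_ * _).
  have -> : (`|numq (w i)|%N)%:R = (numq (w i))%:~R :> rat.
    by rewrite -[LHS]/((`|numq (w i)|%N)%:Z%:~R) abszE gtr0_norm // numq_gt0.
  have -> : (`|denq (w i)|%N)%:R = (denq (w i))%:~R :> rat.
    by rewrite -[LHS]/((`|denq (w i)|%N)%:Z%:~R) abszE gtr0_norm.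
  by rewrite -{2}[w i]divq_num_den mulfVK // intq_eq0 denq_neq0.
have [W WP] := choice exW.
pose w' i := if insub i is Some j then W j else 0%N.
have w'E (i : 'I_s) : w' i = W i by rewrite /w' valK.
have dotE u v : dot w (diff u v) * d%:R = (wt w' s v)%:R - (wt w' s u)%:R.
  rewrite /dot /wt !natr_sum mulr_suml -sumrB; apply: eq_bigr => i _.
  by rewrite mxE !w'E !natrM WP rmorphB /=; ring.
exists w'; split=> [i lis|p pl].
  have : (0 : rat) < (w' i)%:R.
    by rewrite -[i]/(val (Ordinal lis)) w'E WP mulr_gt0 // ltr0n.
  by rewrite ltr0n.
have := hw (p.1, diff p.2.1 p.2.2).
rewrite mem_cat (map_f (fun p => (p.1, diff p.2.1 p.2.2))) // => /(_ isT).
have dp : 0 < (d%:R : rat) by rewrite ltr0n.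
rewrite /holds /=; case: p.1; rewrite -1?(pmulr_lgt0 _ dp) -1?(pmulr_lge0 _ dp) dotE.
  by rewrite subr_gt0 ltr_nat.
by rewrite subr_ge0 ler_nat.
Qed.

(** Lexicographic comparison, to break the ties of a preorder. *)
Definition mlex (u v : monomial) : Prop :=
  exists i, (u i < v i)%N /\ forall j, (j < i)%N -> u j = v j.

Definition refinement (u v : monomial) : Prop :=
  prec u v \/ [/\ ~ prec u v, ~ prec v u & mlex u v].

Lemma mlex_total u v : u <> v -> mlex u v \/ mlex v u.
Proof.
move=> ne; have ex : exists i, u i != v i.
  apply: contrapT => h; apply: ne; apply/eqP/cmP => i; apply/eqP; apply: contrapT => h'.
  by apply: h; exists i; apply/negP.
have [i ni imin] := ex_minnP ex.
have eqj j : (j < i)%N -> u j = v j.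
  by move=> ji; apply/eqP; apply: contraLR ji => /imin; rewrite -leqNgt.
move: ni; rewrite neq_ltn => /orP[h|h]; [left|right]; exists i; split=> // j ji.
by rewrite eqj.
Qed.

Lemma mlex_trans v u w : mlex u v -> mlex v w -> mlex u w.
Proof.
move=> [i [hi ei]] [j [hj ej]].
have [ij|ji|e] := ltngtP i j.
- by exists i; split=> [|k ki]; [rewrite -ej|rewrite ei // ej // (ltn_trans ki)].
- by exists j; split=> [|k kj]; [rewrite ei|rewrite ei ?ej // (ltn_trans kj)].
- rewrite -e in hj ej *; exists i; split=> [|k ki]; first exact: ltn_trans hj.
  by rewrite ei // ej.
Qed.

Lemma refinement_total u v : u <> v -> refinement u v \/ refinement v u.
Proof.
move=> ne; have [h|nuv] := pselect (prec u v); first by left; left.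
have [h|nvu] := pselect (prec v u); first by right; left.
by case: (mlex_total ne) => h; [left|right]; right.
Qed.

Lemma refinement_trans v u w : refinement u v -> refinement v w -> refinement u w.
Proof.
move=> [uv|[nuv nvu luv]] [vw|[nvw nwv lvw]].
- by left; apply: prec_trans vw.
- by left; case: (prec_split w uv).
- by left; case: (prec_split u vw).
right; split; last exact: mlex_trans lvw.
- by move=> h; case: (prec_split v h).
- by move=> h; case: (prec_split v h).
Qed.

Lemma refinement_irr u : ~ refinement u u.
Proof. by case=> [/prec_irr|[_ _ [i []]]] //; rewrite ltnn. Qed.

Lemma refinement_preorder : monomial_preorder refinement.
Proof.
split.
- move=> f g h fg; split; last by move=> gf; apply: (@refinement_irr f); apply: refinement_trans gf.
  have [e|ne] := pselect (h = f); first by right; rewrite e.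
  case: (refinement_total ne) => hf; last by left.
  by right; apply: refinement_trans fg.
- by move=> f nf; left; apply: prec_one.
- move=> f g h; rewrite /refinement.
  have e u v : prec (mmul u h) (mmul v h) = prec u v.
    by apply: propext; apply: iff_sym; apply: precM.
  have -> : mlex (mmul f h) (mmul g h) = mlex f g.
    apply: propext; split=> -[i [lt eqj]]; exists i.
    + by move: lt; rewrite !cmM ltn_add2r; split=> // j /eqj; rewrite !cmM => /addIn.
    + by rewrite !cmM ltn_add2r; split=> // j /eqj; rewrite !cmM => ->.
  by rewrite !e.
Qed.

End MonomialPreorders.

(** * Independence of parameters *)

Lemma ideal_prod_congr (A : comPzRingType) (I : set A) (T : Type) (r : seq T)
    (F G : T -> A) : is_ideal I -> (forall i, I (F i - G i)) ->
  I (\prod_(i <- r) F i - \prod_(i <- r) G i).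
Proof.
move=> iI h; elim: r => [|i r IH]; first by rewrite !big_nil subrr; apply: ideal0.
rewrite !big_cons.
have -> : F i * \prod_(j <- r) F j - G i * \prod_(j <- r) G j =
  F i * (\prod_(j <- r) F j - \prod_(j <- r) G j) + (F i - G i) * \prod_(j <- r) G j by ring.
by apply: idealD => //; [apply: idealM|apply: idealMr].
Qed.

Lemma ideal_exp_congr (A : comPzRingType) (I : set A) x y n : is_ideal I -> I (x - y) ->
  I (x ^+ n - y ^+ n).
Proof. by move=> iI h; rewrite subrXX; apply: idealMr. Qed.

Section ParametersIndependent.
Context (C : comNzRingType) (aC : acc C).
Implicit Types (P Q M : set C).

(** For a prime [M] of [C], this is the prime of [C[t]] generated by [M] and [t]. *)
Definition const_in M : set {poly C} := [set g | M g`_0].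

Lemma const_in_prime M : prime_ideal M -> prime_ideal (const_in M).
Proof.
move=> pM; have iM := prime_is_ideal pM; rewrite /const_in; split=> [|/=|x y /=].
- split=> [|x y|a x] /=; first by rewrite coef0; apply: (ideal0 iM).
  + by rewrite coefD; apply: idealD.
  + by rewrite coef0M; apply: idealM.
- by rewrite coef1; apply: prime1.
- by rewrite coef0M; apply: primeM.
Qed.

(** Replace the preorder by weights [w], and degenerate: over [C[t]], impose on new
    variables [y i] the equations [x i = t ^ w i * y i].  A relation among the [x i] becomes a
    power of [t] times a relation among the [y i] whose specialization at [t = 0] is the
    part of lowest weight, where [e0] is.  The prime [Nd] of [M] and [t] has height at least [s + 1]
    over the extension of [P], hence is not a component of these [s] equations, by the
    height theorem; so there is a component [p] below [Nd] which does not contain [t], where the power of [t] can be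
    cancelled. *)
Lemma parameters_independent s (x : nat -> C) P M :
  prime_ideal P -> prime_ideal M -> chain P M s -> (forall i, (i < s)%N -> M (x i)) ->
  (forall Q, prime_ideal Q -> P `<=` Q -> (forall i, (i < s)%N -> Q (x i)) ->
     Q `<=` M -> Q = M) ->
  forall prec, monomial_preorder prec ->
  forall (S : seq monomial) (c : monomial -> C) e0,
    uniq S -> (forall e, e \in S -> evar s e) -> e0 \in S ->
    (forall e, e \in S -> ~ prec e e0) ->
    P (\sum_(e <- S) c e * mono s x e) -> M (c e0).
Proof.
move=> pP pM cPM Mx Mmin prec mp S c e0 uS vS e0S e0min Pf.
have iP := prime_is_ideal pP; have iM := prime_is_ideal pM.
have [|w [wpos wS]] := @weights prec mp s [seq (false, (e0, e)) | e <- S].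
  by move=> _ /mapP[e eS ->] /=; split; [exact: vS|exact: vS|exact: e0min].
have {}wS e : e \in S -> (wt w s e0 <= wt w s e)%N.
  by move=> eS; apply: (wS (false, (e0, e))); apply: map_f.
pose N1 := const_in M; have pN1 : prime_ideal N1 := const_in_prime pM.
have iN1 := prime_is_ideal pN1.
have peP := ext_prime pP; have ieP := prime_is_ideal peP.
pose Pd := pext s (ext P); pose Nd := pext s N1.
have pPd : prime_ideal Pd := pext_prime s peP.
have pNd : prime_ideal Nd := pext_prime s pN1.
have iPd := prime_is_ideal pPd; have iNd := prime_is_ideal pNd.
have cN1 : chain (ext P) N1 s.+1.
  apply: (@chain_rcons _ s _ (ext M)) => //.
    apply: (chain_map (@ext_prime _)) cPM => // Q Q' pQ pQ'.
    by apply: ext_proper; apply: prime_is_ideal.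
  split; first by move=> g Mg; apply: Mg.
  move=> h; have : ext M 'X by apply: h; rewrite /N1 /const_in /= coefX; apply: (ideal0 iM).
  by move/(_ 1%N); rewrite coefX; apply: prime1.
have cNd : chain Pd Nd s.+1.
  apply: (chain_map (@pext_prime _ s)) cN1 => // Q Q' pQ pQ'.
  by apply: pext_proper; apply: prime_is_ideal.
(* The variable [t] of [{poly C}], as an element of the ring with the variables [y i]. *)
pose tau := pconst {poly C} s 'X.
pose kap : {rmorphism C -> _} := (pconst {poly C} s \o polyC).
pose y := pvar {poly C} s.
pose gen i := kap (x i) - tau ^+ w i * y i.
pose I : set (pring {poly C} s) := ideal_gen (Pd `|` [set gen i | i in [set i | (i < s)%N]]).
have iI : is_ideal I by apply: ideal_gen_ideal.
have PdI : Pd `<=` I by move=> z Pz; apply: sub_ideal_gen; left.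
have genI i : (i < s)%N -> I (gen i) by move=> lis; apply: sub_ideal_gen; right; exists i.
have I_min J : is_ideal J -> Pd `<=` J -> (forall i, (i < s)%N -> J (gen i)) -> I `<=` J.
  by move=> iJ PJ gJ; apply: ideal_gen_min => // _ [/PJ //|[i lis <-]]; apply: gJ.
have Ntau : Nd tau.
  by apply/(pext_const _ _ iN1); rewrite /N1 /const_in /= coefX; apply: (ideal0 iM).
have Nkap z : Nd (kap z) <-> M z.
  by rewrite /Nd /kap /= pext_const // /N1 /const_in /= coefC.
have INd : I `<=` Nd.
  apply: I_min => //; first exact: (chain_sub cNd).
  move=> i lis; apply: idealB => //; first by apply/Nkap; apply: Mx.
  by apply: idealMr => //; rewrite -(prednK (wpos i lis)) exprS; apply: idealMr.
have aD : acc (pring {poly C} s) by apply: acc_pring; apply: acc_poly.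
have [p [pp Ip pN pmin]] := minimal_prime aD iI pNd INd.
have ip := prime_is_ideal pp.
have nNp : ~ Nd `<=` p.
  move=> Np; have epN : p = Nd by apply/seteqP.
  (* The chain [cNd] has length [s + 1], but [Nd] would be minimal over [s] elements. *)
  suff : (s.+1 <= size [seq gen i | i <- iota 0 s])%N by rewrite size_map size_iota ltnn.
  apply: (height_theorem aD pPd pNd cNd).
    by move=> z /mapP[i + ->]; rewrite mem_iota => /andP[_ lis]; exact: (INd _ (genI i lis)).
  move=> Q pQ PQ gQ QN; rewrite -epN; apply: pmin => //; last by rewrite epN.
  apply: I_min => //; first exact: prime_is_ideal.
  by move=> i lis; apply: gQ; apply: map_f; rewrite mem_iota.
have genp i : (i < s)%N -> p (gen i) by move=> lis; exact: (Ip _ (genI i lis)).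
have ntau : ~ p tau.
  move=> ptau; apply: nNp.
  (* If [t] were in [p], then so would be the [x i], and [p] would contract to [M]. *)
  pose p0 : set C := kap @^-1` p.
  have pp0 : prime_ideal p0 := contr_prime (contr_pconst pp).
  have e0M : p0 = M.
    apply: Mmin => //.
    - move=> z Pz; apply: Ip; apply: PdI; rewrite /Pd /kap /= pext_const //.
      exact: extC.
    - move=> i lis; rewrite /p0 /= -(subrK (tau ^+ w i * y i) (pconst _ _ _)).
      apply: idealD => //; first exact: genp.
      by apply: idealMr => //; rewrite -(prednK (wpos i lis)) exprS; apply: idealMr.
    - by move=> z pz; apply/Nkap; apply: pN.
  apply: pext_sub => // g; rewrite /N1 /const_in /= -e0M => pg.
  have -> : g = (g`_0)%:P + \poly_(i < size g) g`_i.+1 * 'X.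
    apply/polyP => -[|i]; rewrite coefD coefC coefMX /= ?addr0 // add0r coef_poly.
    by case: ltnP => // h; rewrite nth_default // ltnW.
  rewrite rmorphD rmorphM; apply: (idealD ip); first exact: pg.
  exact: (idealM _ ip).
have congr_mono e : p (mono s (kap \o x) e - tau ^+ wt w s e * mono s y e).
  have -> : tau ^+ wt w s e * mono s y e = \prod_(i < s) (tau ^+ w i * y i) ^+ e i.
    rewrite /wt -prodrXr /mono -big_split; apply: eq_bigr => i _.
    by rewrite exprMn -exprM.
  rewrite /mono; apply: ideal_prod_congr => // i.
  by apply: ideal_exp_congr => //; apply: (genp i).
have : p (tau ^+ wt w s e0 *
    \sum_(e <- S) pconst {poly C} s ((c e)%:P * 'X^(wt w s e - wt w s e0)) * mono s y e).
  rewrite mulr_sumr.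
  have : p (kap (\sum_(e <- S) c e * mono s x e)).
    by apply: Ip; apply: PdI; rewrite /Pd /kap /= pext_const //; apply: extC.
  rewrite rmorph_sum => h.
  rewrite -[X in p X](subrK (\sum_(e <- S) kap (c e * mono s x e))).
  apply: idealD => //; rewrite -sumrB big_seq; apply: ideal_sum => // e eS.
  have -> : kap (c e * mono s x e) = kap (c e) * mono s (kap \o x) e.
    rewrite rmorphM; congr (_ * _); rewrite /mono rmorph_prod.
    by apply: eq_bigr => i _; rewrite rmorphXn.
  have -> : tau ^+ wt w s e0 * (pconst {poly C} s ((c e)%:P * 'X^(wt w s e - wt w s e0)) * mono s y e) = kap (c e) * (tau ^+ wt w s e * mono s y e).
    have -> : pconst {poly C} s ((c e)%:P * 'X^(wt w s e - wt w s e0)) =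
        kap (c e) * tau ^+ (wt w s e - wt w s e0) by rewrite rmorphM rmorphXn.
    rewrite -mulrA mulrCA; congr (_ * _); rewrite mulrA; congr (_ * _).
    by rewrite -exprD subnKC // wS.
  rewrite -mulrBr; apply: idealM => //.
  by rewrite -opprB; apply: idealN.
case/(primeM pp) => [/(primeX pp) //|/pN].
move/(pext_coef iN1 uS) => /(_ _ e0 e0S).
rewrite subnn expr0 mulr1 /N1 /const_in /= coefC; apply.
move=> e f /vS ve /vS vf ef; apply/eqP/cmP => i.
by have [lis|les] := ltnP i s; [apply: ef|rewrite ve // vf].
Qed.

End ParametersIndependent.

(** * Leading ideals and weighted homogeneous relations *)

Section Independence.
Context (C : comNzRingType) (aC : acc C) (s : nat) (x : nat -> C).
Context (P : set C) (pP : prime_ideal P).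
Context (prec : monomial -> monomial -> Prop) (mp : monomial_preorder prec).
Context (prec_total : forall u v, u <> v -> prec u v \/ prec v u).
Local Notation al := (mono s x).
Let iP := prime_is_ideal pP.

Definition mon_ideal (E : set monomial) : set C :=
  ideal_gen (P `|` [set al e | e in [set e | evar s e /\ E e]]).

Lemma mon_ideal_ideal E : is_ideal (mon_ideal E).
Proof. exact: ideal_gen_ideal. Qed.
Hint Resolve mon_ideal_ideal : core.

Lemma P_mon_ideal E : P `<=` mon_ideal E.
Proof. by move=> z Pz; apply: sub_ideal_gen; left. Qed.

Lemma mem_mon_ideal (E : set monomial) e : evar s e -> E e -> mon_ideal E (al e).
Proof. by move=> ve Ee; apply: sub_ideal_gen; right; exists e. Qed.

Lemma mon_ideal_min (E : set monomial) J : is_ideal J -> P `<=` J ->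
  (forall e, evar s e -> E e -> J (al e)) -> mon_ideal E `<=` J.
Proof.
by move=> iJ PJ h; apply: ideal_gen_min => // z [/PJ //|[e [ve Ee] <-]]; apply: h.
Qed.

Lemma mon_idealS (E E' : set monomial) : E `<=` E' -> mon_ideal E `<=` mon_ideal E'.
Proof.
move=> h; apply: mon_ideal_min => //; first exact: P_mon_ideal.
by move=> e ve /h; apply: mem_mon_ideal.
Qed.

Lemma mon_ideal_shift (E E' : set monomial) f z : evar s f ->
  (forall e, E e -> E' (mmul e f)) -> mon_ideal E z -> mon_ideal E' (z * al f).
Proof.
move=> vf h; move: z; apply: mon_ideal_min.
- exact: colon_ideal.
- by move=> z Pz; exact: (idealMr _ (mon_ideal_ideal _) (P_mon_ideal Pz)).
- move=> e ve /h Ee; rewrite /colon /= -mmorphM.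
  by apply: mem_mon_ideal => //; apply: evarM.
Qed.

Lemma mon_ideal_finite (E : set monomial) z : mon_ideal E z ->
  exists l : seq monomial, (forall e, e \in l -> evar s e /\ E e) /\
    mon_ideal [set e | e \in l] z.
Proof.
move: z; apply: mon_ideal_min.
- split.
  + by exists [::]; split=> //; exact: (ideal0 (mon_ideal_ideal _)).
  + move=> u v [l [lE hl]] [l' [lE' hl']]; exists (l ++ l'); split.
      by move=> e; rewrite mem_cat => /orP[/lE|/lE'].
    apply: (idealD (mon_ideal_ideal _)); [move: hl|move: hl']; apply: mon_idealS => e /=;
      by rewrite mem_cat => ->; rewrite ?orbT.
  + by move=> a u [l [lE hl]]; exists l; split=> //; apply: (idealM _ (mon_ideal_ideal _)).
- by move=> z Pz; exists [::]; split=> //; apply: P_mon_ideal.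
- move=> e ve Ee; exists [:: e]; split; first by move=> f; rewrite inE => /eqP ->.
  by apply: mem_mon_ideal => //=; rewrite inE.
Qed.

(** Linear combinations, modulo [P], of monomials larger than [e]: what may stand
    behind a term with monomial [e]. *)
Definition above (e : monomial) : set C := mon_ideal [set q | prec e q].

(** The coefficients [c] such that the term with monomial [e] can be replaced by higher
    terms; independence means that 1 is not one of them. *)
Definition lead_ideal (e : monomial) : set C := colon (above e) (al e).

Lemma above_ideal e : is_ideal (above e). Proof. exact: mon_ideal_ideal. Qed.
Hint Resolve above_ideal : core.

Lemma lead_ideal_ideal e : is_ideal (lead_ideal e).
Proof. exact: colon_ideal. Qed.

Lemma lead_ideal_mon e f : evar s e -> evar s f -> mdvd e f ->
  lead_ideal e `<=` lead_ideal f.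
Proof.
move=> ve vf /mdvdP ef c; rewrite /lead_ideal /colon /= => h.
have vd : evar s (divcm f e) by apply: evar_div.
rewrite ef mmorphM mulrA; apply: mon_ideal_shift h => // q /= eq.
exact: (precM mp _ _ _).1.
Qed.

Definition weight_ideal w n : set C := mon_ideal [set q | (n <= wt w s q)%N].

Lemma weight_ideal_ideal w n : is_ideal (weight_ideal w n).
Proof. exact: mon_ideal_ideal. Qed.
Hint Resolve weight_ideal_ideal : core.

(** By Noetherianity and Dickson's lemma the relations that define the leading ideals
    follow from finitely many, and the finitely many comparisons of monomials in
    those are realized by integral weights. *)
Lemma compatible_weights : exists w : nat -> nat,
  (forall i, (i < s)%N -> (0 < w i)%N) /\
  forall e c, evar s e -> lead_ideal e c ->
    weight_ideal w (wt w s e).+1 (c * al e).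
Proof.
have [T [vT Tgen]] := @finite_generators C s lead_ideal aC
  (fun e _ => lead_ideal_ideal e) lead_ideal_mon.
(* By the ascending chain condition, finitely many monomials larger than [t] suffice for
   all elements of the leading ideal of [t]. *)
have exQ t : exists l : seq monomial, (forall q, q \in l -> evar s q /\ prec t q) /\
    lead_ideal t `<=` colon (mon_ideal [set e | e \in l]) (al t).
  pose K (l : seq monomial) := colon (mon_ideal [set e | e \in l]) (al t).
  pose ok (l : seq monomial) := forall q, q \in l -> evar s q /\ prec t q.
  have [||_ [l okl <-] lmax] := @acc_max C [set K l | l in ok] aC.
  - by exists (K [::]), [::].
  - by move=> _ [l _ <-]; apply: colon_ideal.
  exists l; split=> // c /mon_ideal_finite[l' [okl' hl']].
  have okll' : ok (l ++ l') by move=> q; rewrite mem_cat => /orP[/okl|/okl'].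
  apply: (lmax (K (l ++ l'))); first by exists (l ++ l').
    by move=> d; apply: mon_idealS => e /= el; rewrite mem_cat el.
  by move: hl'; apply: mon_idealS => e /= el; rewrite mem_cat el orbT.
have [Q QP] := choice exQ.
have [|w [wpos wl]] := @weights prec mp s
    (flatten [seq [seq (true, (t, q)) | q <- Q t] | t <- T]).
  move=> p /flatten_mapP[t tT /mapP[q qQ ->]] /=.
  by have [vq tq] := (QP t).1 q qQ; split=> //; apply: vT.
exists w; split=> // e c ve /=; have [t [tT te Let]] := Tgen e ve.
move=> /Let/(QP t).2 h; rewrite (mdvdP te) mmorphM mulrA wtM.
have vd : evar s (divcm e t) by apply: evar_div.
apply: mon_ideal_shift h => // q /= qQ; rewrite wtM -addSn leq_add2r.
have := wl (true, (t, q)); apply.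
by apply/flatten_mapP; exists t => //; apply: map_f.
Qed.

Section Weighted.
Context (w : nat -> nat) (wpos : forall i, (i < s)%N -> (0 < w i)%N).
Context (wlead : forall e c, evar s e -> lead_ideal e c ->
    weight_ideal w (wt w s e).+1 (c * al e)).
Local Notation G := (weight_ideal w).
Local Notation ev := (mmap (@idfun C) al).

Lemma GS m n : (m <= n)%N -> G n `<=` G m.
Proof. by move=> mn; apply: mon_idealS => q /=; apply: leq_trans. Qed.

(** If [y] is killed by the [x i] and is congruent to elements of arbitrarily high
    weight, it is 0, everything modulo [J]: in the quotient by an ideal [K] that is maximal
    for not containing [y], each [x i] is nilpotent, so that monomials of high weight vanish. *)
Lemma krull_intersection J y : is_ideal J -> P `<=` J ->
  (forall i, (i < s)%N -> J (x i * y)) ->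
  (forall n, exists2 z, G n z & J (y - z)) -> J y.
Proof.
move=> iJ PJ xyJ yG; apply: contrapT => nJy.
have [||K [iK JK nKy] Kmax] := @acc_max C
    [set K | [/\ is_ideal K, J `<=` K & ~ K y]] aC.
- by exists J; split.
- by move=> K [].
(* If [x i ^+ N] is outside [K], the maximality of [K] gives [y = c * x i ^+ N] modulo [K], and
   [x i * y] is in [K]; so [c] kills [x i ^+ N.+1], hence also [x i ^+ N] for large [N]. *)
have powK i : exists k, (i < s)%N -> K (x i ^+ k).
  have [|N hN] := aC (fun k => colon_ideal (x i ^+ k) iK).
    move=> k a; rewrite /colon /= exprS => h.
    by rewrite mulrCA; apply: idealM.
  exists N => lis; apply: contrapT => nK; apply: nKy.
  have [c Kc] : adj K (x i ^+ N) y.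
    apply: contrapT => nadj.
    have [KK nKK] := adj_proper iK nK; apply: nKK; apply: Kmax => //.
    by split=> //; [apply: adj_ideal|apply: (subset_trans JK)].
  have Kc1 : K (c * x i ^+ N.+1).
    have -> : c * x i ^+ N.+1 = x i * y - x i * (y - c * x i ^+ N) by rewrite exprS; ring.
    by apply: idealB => //; [apply: JK; apply: xyJ|apply: idealM].
  have := hN N.+1 (leqnSn N) c Kc1; rewrite /colon /= => Kc0.
  by rewrite -(subrK (c * x i ^+ N) y); apply: idealD.
have [k kP] := choice powK.
have [z Gz Jyz] := yG (\sum_(i < s) w i * k i).+1.
apply: nKy; rewrite -(subrK z y); apply: idealD => //; first exact: JK.
move: z Gz {Jyz}; apply: mon_ideal_min => //; first exact: subset_trans JK.
move=> q vq /= qw.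
(* A monomial of weight above the sum of the [w i * k i] is divisible by some [x i ^+ k i]. *)
have [i ki] : exists i : 'I_s, (k i <= q i)%N.
  apply: contrapT => h; move: qw; rewrite ltnNge => /negP; apply.
  apply: leq_sum => i _; rewrite leq_mul2l; apply/orP; right; apply: ltnW.
  by rewrite ltnNge; apply/negP => ki; apply: h; exists i.
rewrite /mono (bigD1 i) //=; apply: idealMr => //.
by rewrite -(subnK ki) exprD; apply: idealM => //; apply: kP.
Qed.

Definition homogeneous n (f : {malg C[monomial]}) : Prop :=
  forall e, e \in msupp f -> evar s e /\ wt w s e = n.

(** No single term can be replaced by higher terms. *)
Definition reduced (f : {malg C[monomial]}) : Prop :=
  forall e, e \in msupp f -> ~ lead_ideal e f@_e.

(** Terms with a coefficient in their leading ideal may be dropped, since the weights are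
    compatible with the leading ideals. *)
Lemma reduction n f : homogeneous n f -> exists g, [/\ homogeneous n g, reduced g,
  G n.+1 (ev f - ev g) &
  forall e, ~ lead_ideal e f@_e -> g@_e = f@_e].
Proof.
move=> hf.
pose g : {malg C[monomial]} :=
  [malg e in msupp f => if `[< lead_ideal e f@_e >] then 0 else f@_e].
have gE e : g@_e = if `[< lead_ideal e f@_e >] then 0 else f@_e.
  rewrite /g mcoeffE; case: ifPn => // ef.
  by rewrite (mcoeff_outdom ef); case: ifP.
have sg : (msupp g `<=` msupp f)%fset.
  apply/fsubsetP => e; rewrite -!mcoeff_neq0 gE.
  by case: ifP => // _; rewrite eqxx.
exists g; split.
- by move=> e /(fsubsetP sg); apply: hf.
- move=> e; rewrite -mcoeff_neq0 gE; case: asboolP => // _; by rewrite eqxx.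
- rewrite (mmapEw sg) mmapE -sumrB big_seq; refine (@ideal_sum C _ _ _ _ _ (weight_ideal_ideal w n.+1) _) => e ef.
  rewrite /= gE; case: asboolP => h; last by rewrite subrr; exact: (ideal0 (mon_ideal_ideal _)).
  have [ve <-] := hf e ef.
  by rewrite mul0r subr0; apply: wlead.
- by move=> e h; rewrite gE; case: asboolP.
Qed.

(** An element of weight [n] is, up to higher weight, the value of a reduced form of
    weight [n]; the sign is chosen for [homogeneous_relation]. *)
Lemma stage n z : G n z -> exists g, [/\ homogeneous n g, reduced g & G n.+1 (z + ev g)].
Proof.
move=> Gz; suff [f hf Gf] : exists2 f, homogeneous n f & G n.+1 (z + ev f).
  have [g [hg rg Gfg _]] := reduction hf; exists g; split=> //.
  have -> : z + ev g = (z + ev f) - (ev f - ev g) by ring.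
  exact: (idealB (weight_ideal_ideal w n.+1)).
move: z Gz; apply: mon_ideal_min.
- split.
  + by exists 0; [move=> e; rewrite msupp0|rewrite raddf0 addr0; exact: (ideal0 (mon_ideal_ideal _))].
  + move=> u v [f hf Gf] [g hg Gg]; exists (f + g).
      move=> e /(fsubsetP (msuppD_le f g)); rewrite in_fsetU => /orP[]; [exact: hf|exact: hg].
    have -> : u + v + ev (f + g) = (u + ev f) + (v + ev g) by rewrite raddfD /=; ring.
    exact: (idealD (weight_ideal_ideal w n.+1)).
  + move=> a u [f hf Gf]; exists (a *: f).
      by move=> e /(fsubsetP (msuppZ_le a f)); apply: hf.
    have -> : a * u + ev (a *: f) = a * (u + ev f) by rewrite mmapZ /= mulrDr.
    exact: (idealM _ (weight_ideal_ideal w n.+1)).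
- move=> z Pz; exists 0; first by move=> e; rewrite msupp0.
  by rewrite raddf0 addr0; apply: P_mon_ideal.
- move=> e ve /=; rewrite leq_eqVlt => /predU1P[en|ne]; last first.
    exists 0; first by move=> f; rewrite msupp0.
    by rewrite raddf0 addr0; apply: mem_mon_ideal.
  exists << - 1 *g e >>.
    by move=> f /(fsubsetP msuppU_le); rewrite in_fset1 => /eqP ->.
  by rewrite mmapU /= mulN1r subrr; exact: (ideal0 (mon_ideal_ideal _)).
Qed.

(** Assume that a coefficient of [f] is not in its leading ideal.  Reduce [f], move the
    error, which has higher weight, into a reduced form of weight [n + 1], and so on: this yields a
    formal series of reduced forms [F k] which tends to 0 for the filtration by weight.  Among
    all its exponents there is a least one [e1].  Modulo [above e1] only the term with exponent [e1]
    survives; it has arbitrarily high weight and is killed by the [x i], so it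
    vanishes by Krull's intersection theorem, although its form is reduced. *)
Lemma homogeneous_relation n f : homogeneous n f -> P (ev f) ->
  forall e, e \in msupp f -> lead_ideal e f@_e.
Proof.
move=> hf Pf e0 e0f; apply: contrapT => nL0.
have [f0 [hf0 rf0 Gf0 f0E]] := reduction hf.
have e0f0 : e0 \in msupp f0 by rewrite -mcoeff_neq0 f0E // mcoeff_neq0.
have Gr0 : G n.+1 (ev f0).
  have -> : ev f0 = ev f - (ev f - ev f0) by ring.
  by apply: (idealB (weight_ideal_ideal w n.+1)) => //; apply: P_mon_ideal.
(* A state is a form and the partial sum of the values of all forms so far. *)
pose step k (a b : {malg C[monomial]} * C) := G (n + k).+1 a.2 ->
  [/\ homogeneous (n + k).+1 b.1, reduced b.1, b.2 = a.2 + ev b.1 & G (n + k).+2 b.2].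
have [|F [F0 FS]] := @dependent_choice _ step (f0, ev f0).
  move=> k [g r]; have [Gr|nGr] := pselect (G (n + k).+1 r); last by exists (g, r).
  have [g' [hg' rg' Gg']] := stage Gr.
  by exists (g', r + ev g').
have GF k : G (n + k).+1 (F k).2.
  elim: k => [|k IH]; first by rewrite F0 addn0.
  by have [_ _ _] := FS k IH; rewrite addnS.
have FP k : [/\ homogeneous (n + k) (F k).1, reduced (F k).1 &
    (F k).2 = \sum_(j < k.+1) ev (F j).1].
  elim: k => [|k [_ _ IH]]; first by rewrite F0 addn0 big_ord1 F0.
  have [h1 h2 h3 _] := FS k (GF k).
  by split; [rewrite addnS| |rewrite big_ord_recr /= -IH].
have [||e1 [k1 e1F] e1min] := @monomial_minimum prec mp s
    [set e | exists k, e \in msupp (F k).1].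
- by move=> e [k ek]; have [h _ _] := FP k; case: (h e ek).
- by exists e0, 0%N; rewrite F0.
have [hk1 rk1 _] := FP k1; have [ve1 we1] := hk1 e1 e1F.
apply: (rk1 e1 e1F); set y := (F k1).1@_e1 * al e1.
have termF k e : e \in msupp (F k).1 -> e != e1 -> above e1 (al e).
  move=> ek ne; have [hk _ _] := FP k; have [ve _] := hk e ek.
  apply: mem_mon_ideal => //=.
  have [|//|/e1min[]] := @prec_total e1 e; first by move=> h; rewrite h eqxx in ne.
  by exists k.
have evF k : k != k1 -> above e1 (ev (F k).1).
  move=> nk; rewrite mmapE big_seq; refine (@ideal_sum C _ _ _ _ _ (above_ideal _) _) => e ek.
  apply: (idealM _ (above_ideal _)) => //; apply: (termF k) => //; apply: contra_neq nk => ee1.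
  have [hk _ _] := FP k; have [_] := hk e ek; rewrite ee1 we1.
  by move/addnI.
have evF1 : above e1 (ev (F k1).1 - y).
  rewrite /y mmapE (big_fsetD1 e1) //= addrAC subrr add0r big_seq; refine (@ideal_sum C _ _ _ _ _ (above_ideal _) _) => e.
  rewrite in_fsetD1 => /andP[ne ek].
  by apply: (idealM _ (above_ideal _)) => //; apply: (termF k1).
apply: (@krull_intersection (above e1) y) => //.
- exact: P_mon_ideal.
- move=> i lis; have -> : x i * y = (F k1).1@_e1 * al (mmul e1 (ucm i)).
    by rewrite mmorphM /= mono_ucm // /y; ring.
  apply: (idealM _ (above_ideal _)) => //; apply: mem_mon_ideal.
    apply: evarM => // j sj; rewrite cmU; case: eqP => // e; by move: sj; rewrite -e leqNgt lis.
  rewrite /= -{1}[e1]mulm1; apply: (precMl mp _ _ _).1; apply: (prec_one mp).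
  by move/eqP/cmP/(_ i); rewrite cmUU cm1.
move=> m; exists (F (k1 + m)).2; first by apply: GS (GF _); lia.
have [_ _ ->] := FP (k1 + m)%N.
have lk : (k1 < (k1 + m).+1)%N by rewrite ltnS leq_addr.
rewrite (bigD1 (Ordinal lk)) //= opprD addrA; apply: (idealB (above_ideal _)) => //.
  by rewrite -opprB; apply: (idealN (above_ideal _)).
refine (@ideal_sum C _ _ _ _ _ (above_ideal _) _) => j nj; apply: evF.
by apply: contra_neq nj => h; apply: val_inj.
Qed.

End Weighted.

Lemma evar_ucm i : (i < s)%N -> evar s (ucm i).
Proof.
by move=> lis j sj; rewrite cmU; case: eqP => // e; move: sj; rewrite -e leqNgt lis.
Qed.

Context (indep : forall e, evar s e -> ~ above e (al e)).

Lemma var_notin i : (i < s)%N -> ~ P (x i).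
Proof.
move=> lis Px; apply: (indep (evar_ucm lis)); rewrite mono_ucm //.
exact: P_mon_ideal.
Qed.

(** The leading ideals form a directed family, because they increase with the
    exponent, and independence says that they are proper. *)
Lemma leading_prime : exists M, [/\ prime_ideal M, P `<=` M,
  (forall i, (i < s)%N -> M (x i)) & forall e, evar s e -> lead_ideal e `<=` M].
Proof.
pose L : set C := [set c | exists2 e, evar s e & lead_ideal e c].
have dvdl e f : mdvd e (mmul e f) by move=> i; rewrite cmM leq_addr.
have dvdr e f : mdvd e (mmul f e) by move=> i; rewrite cmM leq_addl.
have iL : is_ideal L.
  split.
  - by exists mone; [apply: evar1|apply: (ideal0 (lead_ideal_ideal _))].
  - move=> c d [e ve Lc] [f vf Ld]; exists (mmul e f); first exact: evarM.
    apply: (idealD (lead_ideal_ideal _)).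
      by apply: lead_ideal_mon Lc => //; apply: evarM.
    by apply: lead_ideal_mon Ld => //; apply: evarM.
  - by move=> a c [e ve Lc]; exists e => //; apply: (idealM _ (lead_ideal_ideal _)).
have [[e ve]|M [pM LM]] := prime_above iL.
  by rewrite /lead_ideal /colon /= mul1r; apply: indep.
exists M; split=> //.
- move=> c Pc; apply: LM; exists mone; first exact: evar1.
  by apply: (idealMr _ (above_ideal _)); apply: P_mon_ideal.
- move=> i lis; apply: LM; exists mone; first exact: evar1.
  rewrite /lead_ideal /colon /= mmorph1 mulr1 -(mono_ucm x lis).
  apply: mem_mon_ideal; first exact: evar_ucm.
  by apply: (prec_one mp) => /eqP/cmP/(_ i); rewrite cmUU cm1.
- by move=> e ve c Lc; apply: LM; exists e.
Qed.

End Independence.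

(** * Blowing up *)

Definition mkmon (n : nat) (h : nat -> nat) : monomial :=
  [cmonom h i | i in [fset i in iota 0 n]%fset]%M.

Lemma mkmonE n h i : mkmon n h i = if (i < n)%N then h i else 0%N.
Proof.
by rewrite /mkmon cmE fsfun_fun in_fset /= mem_iota add0n.
Qed.

Section BlowUp.
Context (C : comNzRingType) (aC : acc C) (n : nat) (x : nat -> C).
Context (P M : set C) (pP : prime_ideal P) (pM : prime_ideal M) (PM : P `<=` M).
Context (xP : forall i, (i < n.+1)%N -> ~ P (x i)).
Context (xM : forall i, (i < n.+1)%N -> M (x i)).
Context (w : nat -> nat) (wpos : forall i, (i < n.+1)%N -> (0 < w i)%N).
Context (rel : forall d (f : {malg C[monomial]}), homogeneous n.+1 w d f ->
  P (mmap (@idfun C) (mono n.+1 x) f) -> forall e, e \in msupp f -> M f@_e).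

(** Let [b i] be powers of the [x i] which all have the same weight, and [u = b 0].  The
    kernel of the evaluation of [n] variables at the fractions [b (i + 1) / u], over the
    field of fractions of [C / P], is the top of a chain of length [n].  A polynomial in this
    kernel becomes, after homogenization, a weighted homogeneous relation among the [x i], so
    its coefficients are in [M]: in geometric terms, the fibre over [M] of the blow-up of the
    ideal of the [b i] is an affine space.  The inclusion in the extension of [M] is
    strict because [u] is in [M]. *)
Lemma blowup_chain : chain (pext n P) (pext n M) n.+1.
Proof.
have iM := prime_is_ideal pM; have iP := prime_is_ideal pP.
(* [W] is a common multiple of the weights, and [b i = x i ^+ v i] has weight [W]. *)
have [W [v [vpos vw]]] : exists W (v : nat -> nat),
    (forall i, (i < n.+1)%N -> (0 < v i)%N) /\
    (forall i, (i < n.+1)%N -> (w i * v i = W)%N).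
  pose W := (\prod_(i < n.+1) w i)%N.
  have W0 : (0 < W)%N by rewrite prodn_gt0 // => i; apply: wpos.
  have vw i : (i < n.+1)%N -> (w i * (W %/ w i) = W)%N.
    by move=> lin; rewrite mulnC divnK // /W (bigD1 (Ordinal lin)) //=; apply: dvdn_mulr.
  exists W, (fun i => W %/ w i)%N; split=> // i lin.
  by move: W0; rewrite -[X in (0 < X)%N](vw i lin) muln_gt0 => /andP[].
pose b i := x i ^+ v i; pose u := b 0%N.
have [K [pi kpi]] : exists (K : fieldType) (pi : {rmorphism C -> K}),
    forall c, pi c = 0 <-> P c.
  have [D [K [p [t [_ kp ti _]]]]] := residue_field pP.
  exists K, (t \o p : {rmorphism C -> K}) => c /=; rewrite -kp.
  by split=> [h|->]; [apply: ti; rewrite h rmorph0|apply: rmorph0].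
have nPu : ~ P u by apply: primeXn => //; apply: xP.
have piu : pi u != 0 by apply/eqP => /kpi.
have [psi [psic psiv]] := pring_eval n pi (fun i => pi (b i.+1) / pi u).
pose pk : set (pring C n) := [set g | psi g = 0].
have ppk : prime_ideal pk.
  rewrite /pk; split=> [|/=|g h /=].
  - split=> [|g h|a g] /=; first exact: rmorph0.
      by rewrite rmorphD => -> ->; rewrite addr0.
    by rewrite rmorphM => ->; rewrite mulr0.
  - by rewrite rmorph1 => /eqP; rewrite oner_eq0.
  - by rewrite rmorphM => /eqP; rewrite mulf_eq0 => /orP[]/eqP; [left|right].
have cpk : pconst C n @^-1` pk = P.
  by apply/seteqP; split=> c; rewrite /pk /= psic => /kpi.
have npku : ~ pk (pconst C n u) by rewrite /pk /= psic => /kpi.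
have c1 : chain (pext n P) pk n.
  rewrite -cpk; apply: (@chain_eval _ _ _ u (fun i => b i.+1)) => // i lin.
  by rewrite /pk /= rmorphB rmorphM !psic psiv // mulrCA divff // mulr1 subrr.
apply: (chain_rcons (pext_prime n pM) c1); split; last first.
  move=> /(_ (pconst C n u)) h; apply: npku; apply: h; apply/(pext_const _ _ iM).
  by rewrite /u /b -(prednK (vpos 0%N isT)) exprS; apply: idealMr => //; apply: xM.
move=> g gk; have [f [vf ef]] := pring_span g.
pose deg (e : monomial) := (\sum_(i < n) e i)%N.
have [d degd] : exists d, forall e, e \in msupp f -> (deg e <= d)%N.
  exists (\sum_(e <- msupp f) deg e)%N => e ef'.
  by rewrite (big_fsetD1 e) //= leq_addr.
(* Homogenization to degree [d] with respect to [u]: [hat e] is the exponent, in the [x i], of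
   the product of [u ^+ (d - deg e)] and the monomial [e] in the [b (i + 1)]. *)
have [hat [hatv hat0 hatS]] : exists hat : monomial -> monomial,
    [/\ forall e, evar n.+1 (hat e), forall e, hat e 0%N = (v 0%N * (d - deg e))%N &
      forall e i, (i < n)%N -> hat e i.+1 = (v i.+1 * e i)%N].
  exists (fun e : monomial => mkmon n.+1
    (fun i => if i is j.+1 then (v j.+1 * e j)%N else (v 0%N * (d - deg e))%N)).
  split=> [e i ni|e|e i lin]; rewrite mkmonE //; first by rewrite ltnNge ni.
  by rewrite ltnS lin.
have hat_inj : {in msupp f &, injective hat}.
  move=> e e' /vf ve /vf ve' ee; apply/eqP/cmP => i.
  have [lin|nli] := ltnP i n; last by rewrite ve // ve'.
  have := congr1 (fun m : monomial => m i.+1) ee; rewrite !hatS // => /eqP.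
  by rewrite eqn_pmul2l ?vpos ?ltnS // => /eqP.
pose F : {malg C[monomial]} := \sum_(e <- msupp f) << f@_e *g hat e >>.
have Fcoef m : F@_m = \sum_(e <- msupp f) f@_e *+ (hat e == m).
  by rewrite /F (raddf_sum (mcoeff m)); apply: eq_bigr => e _; apply: mcoeffU.
have Fhat e : e \in msupp f -> F@_(hat e) = f@_e.
  move=> ef'; rewrite Fcoef (big_fsetD1 e) //= eqxx mulr1n big1_seq ?addr0 // => e' /=.
  rewrite in_fsetD1 => /andP[ne e'f].
  by case: eqP => // /(hat_inj _ _ e'f ef') h; rewrite h eqxx in ne.
have homF : homogeneous n.+1 w (W * d) F.
  move=> m mF; have [e [ef' ->]] : exists e, e \in msupp f /\ m = hat e.
    apply: contrapT => h; move: mF; rewrite -mcoeff_neq0 Fcoef big1_seq ?eqxx //.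
    move=> e /andP[_ ef'] /=; case: eqP => // e'; case: h.
    by exists e.
  split; first exact: hatv.
  rewrite /wt big_ord_recl /= hat0 mulnA vw //.
  rewrite (eq_bigr (fun i : 'I_n => (W * e i)%N)); last first.
    by move=> i _; rewrite /bump leq0n add1n hatS // mulnA vw // ltnS.
  by rewrite -big_distrr /= -mulnDr subnK // degd.
have monohat e : e \in msupp f ->
    pi (mono n.+1 x (hat e)) = pi u ^+ d * mono n (fun i => pi (b i.+1) / pi u) e.
  move=> ef'.
  have -> : mono n.+1 x (hat e) = u ^+ (d - deg e) * \prod_(i < n) b i.+1 ^+ e i.
    have h0 : x 0%N ^+ hat e 0%N = u ^+ (d - deg e).
      by rewrite hat0 /u /b; apply: exprM.
    rewrite /mono big_ord_recl; congr (_ * _); first exact: h0.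
    by apply: eq_bigr => i _; rewrite lift0 /b hatS // exprM.
  rewrite (rmorphM pi) rmorphXn -[in RHS](subnK (degd e ef')) exprD -mulrA; congr (_ * _).
  rewrite rmorph_prod /deg /mono -prodrXr -big_split /=; apply: eq_bigr => i _.
  by rewrite rmorphXn -exprMn [_ * (_ / _)]mulrC divfK.
have PF : P (mmap (@idfun C) (mono n.+1 x) F).
  have -> : mmap (@idfun C) (mono n.+1 x) F =
      \sum_(e <- msupp f) f@_e * mono n.+1 x (hat e).
    by rewrite /F mmap_sum; apply: eq_bigr => e _; apply: mmapU.
  apply/kpi; rewrite (rmorph_sum pi).
  have e0 : mmap pi (mono n (fun i => pi (b i.+1) / pi u)) f = 0.
    rewrite -(gk : psi g = 0) -ef mmap_rmorph; apply: eq_mmap => [c|i lin] /=.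
      by rewrite psic.
    by rewrite psiv.
  have h : pi u ^+ d * mmap pi (mono n (fun i => pi (b i.+1) / pi u)) f = 0.
    by rewrite e0 mulr0.
  rewrite -[RHS]h mmapE mulr_sumr big_seq [RHS]big_seq.
  apply: eq_bigr => e ef'; rewrite rmorphM monohat //; ring.
rewrite -ef mmapE big_seq.
refine (@ideal_sum _ _ _ _ _ _ (pext_ideal n iM) _) => e ef'.
apply: (idealMr _ (pext_ideal n iM)); apply/(pext_const _ _ iM).
rewrite -Fhat //; apply: (rel homF PF).
by rewrite -mcoeff_neq0 Fhat // mcoeff_neq0.
Qed.

(** Otherwise [M] is minimal over a prime above [P] and [n] elements, and so is
    its extension to [n] variables over the extension of [P], against the height theorem
    and [blowup_chain]. *)
Lemma long_chain : exists Q k, [/\ prime_ideal Q, P `<=` Q, chain Q M k & (n < k)%N].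
Proof.
apply: contrapT => none.
have iP := prime_is_ideal pP; have iM := prime_is_ideal pM.
have [|xs [sxs Mxs Mmin]] := @parameters C n P M aC iP pM PM.
  move=> Q k pQ PQ cQ; rewrite leqNgt; apply/negP => nk.
  by apply: none; exists Q, k.
suff : (n.+1 <= size (map (pconst C n) xs))%N by rewrite size_map sxs ltnn.
refine (@height_theorem (pring C n) (map (pconst C n) xs) n.+1 _ _ (acc_pring aC)
  (pext_prime n pP) (pext_prime n pM) blowup_chain _ _).
  by move=> z /mapP[y /Mxs My ->]; apply/(pext_const _ _ iM).
move=> Q pQ PQ Qxs QM; apply/seteqP; split=> //.
apply: pext_sub; first exact: prime_is_ideal.
have <- : pconst C n @^-1` Q = M.
  apply: Mmin.
  - exact: contr_pconst.
  - by move=> a Pa; apply: PQ; apply/(pext_const _ _ iP).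
  - by move=> y yxs; apply: Qxs; apply: map_f.
  - by move=> a /QM /(pext_const _ _ iM).
by [].
Qed.

End BlowUp.

(** A form of Abhyankar's inequality: modulo [P] the [x i] behave like elements with
    independent values for a valuation, so that there is a chain of primes as long as
    their number. *)
Lemma independent_chain (C : comNzRingType) (s : nat) (x : nat -> C) (P : set C)
    (prec : monomial -> monomial -> Prop) :
  acc C -> prime_ideal P -> monomial_preorder prec ->
  (forall u v, u <> v -> prec u v \/ prec v u) ->
  (forall e, evar s e -> ~ above s x P prec e (mono s x e)) ->
  exists Q M, [/\ prime_ideal Q, prime_ideal M, P `<=` Q & chain Q M s].
Proof.
move=> aC pP mp tot indep.
(* The blow-up has one variable less than there are elements [x i]. *)
case: s => [|n] in indep *; first by exists P, P; split.
have [w [wpos wlead]] := compatible_weights aC n.+1 x P mp.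
have [M [pM PM xM LM]] := leading_prime mp indep.
have rel d (f : {malg C[monomial]}) : homogeneous n.+1 w d f ->
    P (mmap (@idfun C) (mono n.+1 x) f) -> forall e, e \in msupp f -> M f@_e.
  move=> hf Pf e ef; apply: (LM e); first by have [] := hf e ef.
  exact: (homogeneous_relation aC mp tot wlead hf Pf ef).
have [Q [k [pQ PQ cQ nk]]] :=
  long_chain aC pP pM PM (var_notin indep) xM wpos rel.
move: cQ; rewrite -(subnKC nk) => /chain_take[M' [pM' cM' _]].
by exists Q, M'; split=> //; case: pM' => [->|].
Qed.

(** * From chains to independent sequences *)

Section SequencesToChains.

Lemma chain_of_sequence (A : comPzRingType) (f : nat -> set A) n :
  (forall i, (i <= n)%N -> prime_ideal (f i)) ->
  (forall i, (i < n)%N -> f i `<` f i.+1) -> chain (f 0%N) (f n) n.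
Proof.
elim: n => // n IH pf sf; apply: (@chain_rcons _ n _ (f n)).
- exact: pf.
- by apply: IH => i h; [apply: pf; apply: leqW|apply: sf; apply: leqW].
- exact: sf.
Qed.

Lemma sequence_of_chain (A : comPzRingType) n (P M : set A) : prime_ideal P ->
  chain P M n -> exists f : nat -> set A,
  [/\ f 0%N = P, f n = M, forall i, (i <= n)%N -> prime_ideal (f i) &
    forall i, (i < n)%N -> f i `<` f i.+1].
Proof.
elim: n P => [|n IH] P pP /=; first by move=> <-; exists (fun=> P).
move=> [Q [pQ PQ /(IH Q pQ)[f [f0 fn pf sf]]]].
exists (fun i => if i is j.+1 then f j else P); split=> //.
- by case=> // i; apply: pf.
- by case=> [|i] h; [rewrite f0|apply: sf].
Qed.

Lemma ideal_finitely_generated (A : comPzRingType) (I : set A) : acc A -> is_ideal I ->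
  exists xs : seq A, {in xs, forall x, I x} /\ I `<=` ideal_gen [set x | x \in xs].
Proof.
move=> aA iI; pose K (xs : seq A) := ideal_gen [set x | x \in xs].
have [||_ [xs xsI <-] xmax] := @acc_max A [set K xs | xs in [set xs : seq A | {in xs, forall x, I x}]] aA.
- by exists (K [::]), [::].
- by move=> _ [xs _ <-]; apply: ideal_gen_ideal.
exists xs; split=> // y Iy; apply: (xmax (K (y :: xs))).
- by exists (y :: xs) => // z; rewrite inE => /predU1P[->|/xsI].
- by apply: ideal_genS => z /= h; rewrite inE h orbT.
- by apply: sub_ideal_gen; rewrite /= mem_head.
Qed.

Lemma chain_bounded (A : comPzRingType) (P M : set A) : acc A -> prime_ideal P ->
  prime_ideal M -> exists N, forall k, chain P M k -> (k <= N)%N.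
Proof.
move=> aA pP pM; have [xs [xsM Mxs]] := ideal_finitely_generated aA (prime_is_ideal pM).
exists (size xs) => k cPM; apply: (height_theorem aA pP pM cPM xsM).
move=> Q pQ PQ Qxs QM; apply/seteqP; split=> //; apply: (subset_trans Mxs).
by apply: ideal_gen_min => //; apply: prime_is_ideal.
Qed.

End SequencesToChains.

Lemma initial_form_coef (R : comPzRingType) prec (f : {malg R[monomial]}) m :
  (initial_form prec f)@_m =
  if (m \in msupp f) && `[< forall m', m' \in msupp f -> ~ prec m' m >] then f@_m else 0.
Proof.
rewrite /initial_form (raddf_sum (mcoeff m)) /=.
under eq_bigr do rewrite mcoeffU.
case: ifPn => [/andP[mf h]|h].
  rewrite big_mkcond (big_fsetD1 m) //= h eqxx mulr1n big1_seq ?addr0 // => e /=.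
  by rewrite in_fsetD1 => /andP[/negbTE ->]; rewrite mulr0n if_same.
rewrite big_seq_cond big1 // => e /andP[ef eh].
by case: eqP => // e'; move: h; rewrite -e' ef eh.
Qed.

Lemma mono_widen (C : comNzRingType) s h (x : nat -> C) e : (s <= h)%N -> evar s e ->
  mono h x e = mono s x e.
Proof.
move=> sh ve; rewrite /mono -(subnKC sh) big_split_ord /= [X in _ * X]big1 ?mulr1 //.
by move=> i _; rewrite ve ?expr0 // leq_addr.
Qed.

(** The elements are the images of the first [s] of [h] parameters, where [h] is the maximal
    length of a chain between the ends of the chain pulled back to [pring R s]; by
    [parameters_independent], no relation between them has an invertible initial
    coefficient. *)
Lemma chain_independent (R A : comNzRingType) (phi : {rmorphism R -> A}) prec s :
  acc R -> monomial_preorder prec -> prime_chain A s ->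
  exists a : s.-tuple A, independent phi prec a.
Proof.
move=> aR mp [P pP sP].
pose P' i := P (inord i).
have pP' i : prime_ideal (P' i) by apply: pP.
have sP' i : (i < s)%N -> P' i `<` P' i.+1.
  by move=> lis; apply: sP; rewrite !inordK // ltnS ltnW.
have exy i : exists y, (i < s)%N -> P' i.+1 y /\ ~ P' i y.
  have [lis|nis] := ltnP i s; last by exists 0.
  have [_ /nsub_witness[y yP]] := sP' i lis.
  by exists y.
have [y yP] := choice exy.
have [ev [evc evv]] := pring_eval s phi y.
have aC := acc_pring (n := s) aR.
pose Q i := ev @^-1` (P' i).
have pQ i : prime_ideal (Q i) by apply: preimage_prime.
have sQ i : (i < s)%N -> Q i `<` Q i.+1.
  move=> lis; split; first by move=> u; apply: (sP' i lis).1.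
  move=> /(_ (pvar R s i)); rewrite /Q /= evv //; have [h1 h2] := yP i lis.
  by move=> /(_ h1).
have cQ := chain_of_sequence (fun i _ => pQ i) sQ.
have [N hN] := chain_bounded aC (pQ 0%N) (pQ s).
have exh : exists k, `[< chain (Q 0%N) (Q s) k >] by exists s; apply/asboolP.
have bh k : `[< chain (Q 0%N) (Q s) k >] -> (k <= N)%N by move=> /asboolP/hN.
have [h /asboolP ch hmax] := ex_maxnP exh bh.
have sh : (s <= h)%N by apply: hmax; apply/asboolP.
have Q0s := chain_sub cQ.
have [|xs [sxs Mxs Mmin]] := @parameters _ h (Q 0%N) (Q s) aC (prime_is_ideal (pQ 0%N)) (pQ s) Q0s.
  move=> J n pJ QJ cJ; have [JQ|nJQ] := pselect (J `<=` Q 0%N).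
    have eJ : J = Q 0%N by apply/seteqP.
    by apply: hmax; apply/asboolP; rewrite -eJ.
  by apply: ltnW; apply: hmax; apply/asboolP; exists J.
have memxs i : (i < h)%N -> xs`_i \in xs by move=> lih; rewrite mem_nth // sxs.
exists [tuple ev xs`_(val i) | i < s] => -[f [vf f0 [m [z zm]]]].
have coefm : (initial_form prec f)@_m != 0.
  by apply/eqP => e; move/eqP: zm; rewrite e mulr0 eq_sym oner_eq0.
move: zm coefm; rewrite initial_form_coef; case: ifPn => [|_ _]; last by rewrite eqxx.
move=> /andP[mf /asboolP mmin] zm _.
apply: (prime1 (pQ s)).
have -> : 1 = pconst R s z * pconst R s f@_m by rewrite -rmorphM zm rmorph1.
apply: idealM; first exact: prime_is_ideal.
apply: (@parameters_independent _ aC h (fun i => xs`_i) (Q 0%N) (Q s) (pQ 0%N) (pQ s) ch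
  _ _ prec mp (msupp f) (fun e => pconst R s f@_e) m) => //.
- by move=> i lih; apply: Mxs; apply: memxs.
- move=> J pJ QJ xJ JM; apply: Mmin => // u uxs.
  by rewrite -(nth_index 0 uxs); apply: xJ; rewrite -sxs index_mem.
- exact: fset_uniq.
- by move=> e ef i hi; apply: (vf e ef); apply: leq_trans hi.
rewrite /Q /=; suff -> : ev (\sum_(e <- msupp f) pconst R s f@_e * mono h (fun i => xs`_i) e) = 0.
  exact: (ideal0 (prime_is_ideal (pP' 0%N))).
rewrite -f0 /poly_eval rmorph_sum big_seq [RHS]big_seq; apply: eq_bigr => e ef.
rewrite rmorphM evc (mono_widen _ sh); last exact: vf.
congr (_ * _); rewrite /mono rmorph_prod; apply: eq_bigr => i _.
by rewrite rmorphXn tnth_mktuple.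
Qed.

(** * From independent sequences to chains *)

Section MonomialIdeals.
Context (R A : comNzRingType) (phi : {rmorphism R -> A}) (s : nat) (a : s.-tuple A).
Context (prec : monomial -> monomial -> Prop) (mp : monomial_preorder prec).
Local Notation C := (pring R s).
Local Notation al := (mono s (pvar R s)).
Let mr := refinement_preorder mp.

(** Every element of the ideal of larger monomials is a combination, with
    coefficients in [R], of larger monomials.  So it can serve as the tail of a
    polynomial over [R]. *)
Lemma above_span e z : evar s e -> above s (pvar R s) set0 (refinement prec) e z ->
  exists f : {malg R[monomial]},
    (forall m, m \in msupp f -> evar s m /\ refinement prec e m) /\
    mmap (pconst R s) al f = z.
Proof.
move=> ve; move: z; apply: mon_ideal_min => //.
- split.
  + by exists 0; split; [move=> m; rewrite msupp0|rewrite raddf0].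
  + move=> _ _ [f [hf <-]] [g [hg <-]]; exists (f + g); split; last by rewrite raddfD.
    move=> m /(fsubsetP (msuppD_le f g)); rewrite in_fsetU => /orP[]; [exact: hf|exact: hg].
  + move=> b _ [f [hf <-]]; have [g [vg <-]] := pring_span b.
    exists (g * f); split; last by rewrite rmorphM.
    move=> m /msuppM_le[m1 [m2 [m1g m2f ->]]]; have [v2 e2] := hf m2 m2f.
    split; first by apply: evarM => //; apply: vg.
    have [->|/eqP n1] := eqVneq m1 mone; first by rewrite mul1m.
    apply: (prec_trans mr e2); rewrite -{1}[m2]mul1m.
    by apply: (precM mr _ _ _).1; apply: (prec_one mr).
- move=> m vm em; exists << 1 *g m >>; split.
    by move=> m' /(fsubsetP msuppU_le); rewrite in_fset1 => /eqP ->.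
  by rewrite mmapU /= rmorph1 mul1r.
Qed.

(** The polynomials whose lowest term, for the total refinement of the preorder, is a bare
    monomial. *)
Definition monic_initial : set C :=
  [set g | exists2 e, evar s e & above s (pvar R s) set0 (refinement prec) e (g - al e)].

Lemma monic_initial_mul : multiplicative monic_initial.
Proof.
split.
  exists mone; first exact: evar1.
  by rewrite mmorph1 subrr; apply: (ideal0 (above_ideal _ _ _ _ _)).
move=> g g' [e ve he] [e' ve' he']; exists (mmul e e'); first exact: evarM.
set z := g - al e in he; set z' := g' - al e' in he'.
have iab := above_ideal s (pvar R s) set0 (refinement prec) (mmul e e').
have -> : g * g' - al (mmul e e') = z' * al e + z * al e' + z' * z.
  by rewrite mmorphM /= /z /z'; ring.
apply: (idealD iab); first apply: (idealD iab).
- apply: mon_ideal_shift he' => // q /= eq.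
  by rewrite [mmul e e']mulmC; exact: (precM mr _ _ _).1.
- apply: mon_ideal_shift he => // q /= eq; exact: (precM mr _ _ _).1.
move: z' he' {ve'}; apply: mon_ideal_min.
- exact: colon_ideal.
- by [].
- move=> q vq eq; rewrite /colon /= mulrC.
  apply: mon_ideal_shift he => // q' /= eq'.
  exact: (prec_trans mr ((precM mr _ _ _).1 eq') ((precMl mr _ _ _).1 eq)).
Qed.

(** A polynomial in the kernel of [ev] and in [monic_initial] is a relation whose initial
    form has the coefficient 1.  For a prime [P] that misses [monic_initial], no
    monomial is a combination of larger ones modulo [P]. *)
Lemma initial_prime (ev : {rmorphism C -> A}) :
  (forall r, ev (pconst R s r) = phi r) ->
  (forall i, (i < s)%N -> ev (pvar R s i) = a`_i) ->
  independent phi prec a ->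
  exists P, [/\ prime_ideal P, forall g, ev g = 0 -> P g &
    forall e, evar s e -> ~ above s (pvar R s) P (refinement prec) e (al e)].
Proof.
move=> evc evv ind; pose I : set C := [set g | ev g = 0].
have iI : is_ideal I.
  rewrite /I; split=> [|u v|u v] /=; first exact: rmorph0.
  - by rewrite rmorphD => -> ->; rewrite addr0.
  - by rewrite rmorphM => ->; rewrite mulr0.
have [|P [pP IP PT _]] := prime_avoiding iI monic_initial_mul.
  move=> g Ig [e ve /(above_span ve)[f [hf ef]]]; apply: ind.
  exists (<< 1 *g e >> + f).
  have nef : e \notin msupp f by apply/negP => /hf[_ /(refinement_irr mp)].
  have vF m : m \in msupp (<< 1 *g e >> + f) -> m = e \/ m \in msupp f.
    move=> /(fsubsetP (msuppD_le _ _)); rewrite in_fsetU => /orP[|]; last by right.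
    by move=> /(fsubsetP msuppU_le); rewrite in_fset1 => /eqP; left.
  split.
  - by move=> m /vF[->|/hf[]].
  - rewrite poly_eval_mmap -(eq_mmap _ evc evv) -[X in mmap X]/(ev \o pconst R s).
    rewrite -mmap_rmorph raddfD /= mmapU /= rmorph1 mul1r ef addrC subrK.
    exact: Ig.
  - exists e, 1; rewrite mul1r initial_form_coef.
    have Fe : (<< 1 *g e >> + f)@_e = 1.
      by rewrite mcoeffD mcoeffUU (mcoeff_outdom nef) addr0.
    rewrite -mcoeff_neq0 Fe oner_neq0 /=; case: asboolP => // h; case: h.
    move=> m' /vF[->|/hf[_ em']] h; first exact: (prec_irr mp h).
    by apply: (prec_asym mr em'); left.
exists P; split=> // e ve hP; have iP := prime_is_ideal pP.
have iab := above_ideal s (pvar R s) set0 (refinement prec) e.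
have [p Pp h] : exists2 p, P p &
    above s (pvar R s) set0 (refinement prec) e (al e - p).
  move: (al e) hP; apply: mon_ideal_min.
  - split=> [|u v [p Pp hp] [q Pq hq]|b u [p Pp hp]].
    + by exists 0; [apply: ideal0|rewrite subr0; apply: (ideal0 iab)].
    + exists (p + q); first exact: idealD.
      have -> : u + v - (p + q) = (u - p) + (v - q) by ring.
      exact: (idealD iab).
    + exists (b * p); first exact: idealM.
      by rewrite -mulrBr; apply: (idealM _ iab).
  - by move=> z Pz; exists z => //; rewrite subrr; apply: (ideal0 iab).
  - move=> q vq eq; exists 0; first exact: ideal0.
    by rewrite subr0; apply: mem_mon_ideal.
apply: (PT p Pp); exists e => //.
by rewrite -opprB; apply: (idealN iab).
Qed.

End MonomialIdeals.

Section Lift.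
Context (R A B : comNzRingType) (phi : {rmorphism R -> A}) (psi : {rmorphism R -> B})
  (iota : {rmorphism A -> B}).
Context (emb : alg_embedding phi psi iota) (fgB : fg_algebra psi).
Context (aR : acc R) (jR : maximal_separation R).

(** Chains are lifted from [pring R s] to the polynomial ring [pring (pring R s) r],
    which [F] maps onto [B].  The lifted primes contain the kernel of [F], so they
    are primes of [B], and their contractions to [A] are distinct because those to
    [pring R s] are. *)
Lemma lift_chain s (ev : {rmorphism pring R s -> A}) n (P M : set (pring R s)) :
  (forall r, ev (pconst R s r) = phi r) ->
  prime_ideal P -> prime_ideal M -> (forall g, ev g = 0 -> P g) -> chain P M n ->
  prime_chain A n.
Proof.
move=> evc pP pM kP cPM; have [emb1 emb2] := emb.
have [r [b bgen]] := fgB.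
pose f : {rmorphism pring R s -> B} := (iota \o ev).
have [F [Fc Fv]] := pring_eval r f (fun i => b`_i).
have Fs y : exists x, F x = y.
  (* The coefficients in [R] of a polynomial expression for [y] become constants of [pring R s]. *)
  have [g vg <-] := bgen y.
  exists (mmap (pconst (pring R s) r \o pconst R s) (mono r (pvar (pring R s) r)) g).
  rewrite poly_eval_mmap mmap_rmorph; apply: eq_mmap => [c|i lir] /=.
    by rewrite Fc /f /= evc emb1.
  exact: Fv.
have iotainj x : iota x = 0 -> x = 0.
  by move=> h; apply: emb2; rewrite h rmorph0.
(* [A] embeds in [B] and the kernel of [ev] is in [P], so [0] is not in [S]; a prime of [B] that
   misses [S] contracts into [P]. *)
pose S : set B := f @` (~` P).
have mS : multiplicative S.
  split; first by exists 1; [apply: prime1|rewrite rmorph1].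
  by move=> _ _ [x nx <-] [y ny <-]; exists (x * y); [apply: primeMn|rewrite rmorphM].
have i0 : is_ideal [set (0 : B)].
  by split=> [|x y -> ->|c x ->] //=; rewrite ?addr0 ?mulr0.
have [|N [pN _ NS _]] := prime_avoiding i0 mS.
  by move=> x /= -> [c nc /iotainj/kP].
have pq : prime_ideal (F @^-1` N) := preimage_prime F pN.
set q := F @^-1` N in pq.
pose q0 := pconst (pring R s) r @^-1` q.
have pq0 : prime_ideal q0 := contr_pconst pq.
have q0P : q0 `<=` P.
  move=> c; rewrite /q0 /q /= Fc => Nc; apply: contrapT => nc.
  by apply: (NS _ Nc); exists c.
have aC := acc_pring (n := s) aR; have jC := maximal_separation_pring (n := s) jR.
(* Chains from [P] become chains from the smaller prime [q0] by changing the first member. *)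
have [M1 [pM1 cM1]] : exists M1, prime_ideal M1 /\ chain q0 M1 n.
  case: n cPM => [|n] cPM; first by exists q0.
  case: cPM => Q [pQ [PQ nQP] cQ]; exists M; split=> //; exists Q; split=> //.
  by split; [apply: subset_trans PQ|move=> h; apply: nQP; apply: (subset_trans h)].
have [h [nh L]] := lifting_pconst pq (prime1 pq).
(* Only the top of the chain may still contain [h]; it is replaced by a maximal ideal, which
   cannot equal the member before it, as that one is not maximal. *)
have [M2 [pM2 nM2h cM2]] : exists M2, [/\ prime_ideal M2, ~ M2 h & chain q0 M2 n].
  case: n cM1 {cPM} => [|n] cM1; first by exists q0.
  have [Q [pQ nQh cQ QM1]] := chain_avoiding aC pq0 pM1 cM1 nh.
  have [M2 [mM2 QM2 nM2h]] := jC _ _ pQ nQh.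
  exists M2; split=> //; first exact: maximal_prime.
  apply: (chain_rcons (maximal_prime mM2) cQ); split=> // M2Q.
  have eQ : Q = M2 by apply/seteqP.
  have [_ _ mmax] := mM2; case: QM1 => QM1 nM1Q.
  have [|e|e] := mmax M1 (prime_is_ideal pM1); first by rewrite -eQ.
  - by apply: nM1Q; rewrite e eQ.
  - by apply: (prime1 pM1); rewrite e.
have [p [p0 pn pp sp]] := sequence_of_chain pq0 cM2.
have [|||Q [[pQ sQ] Q0 cQ _]] := L n p.
- by split=> // i /sp[].
- exact: p0.
- by rewrite pn.
have qQ i : (i <= n)%N -> q `<=` Q i.
  elim: i => [|i IH] lin; first by rewrite Q0.
  by apply: (subset_trans (IH (ltnW lin))); apply: sQ.
have kQ i : (i <= n)%N -> forall x, F x = 0 -> Q i x.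
  move=> lin x Fx; apply: (qQ i lin); rewrite /q /= Fx.
  exact: (ideal0 (prime_is_ideal pN)).
pose P' i : set A := iota @^-1` (F @` (Q i)).
have pP' i : (i <= n)%N -> prime_ideal (P' i).
  by move=> lin; apply: preimage_prime; apply: image_prime (pQ i lin) => //; apply: kQ.
have sP' i : (i < n)%N -> P' i `<` P' i.+1.
  move=> lin; split.
    by move=> x [g Qg e]; exists g => //; apply: (sQ i lin).
  have [_ /nsub_witness[c [pc npc]]] := sp i lin.
  move=> /(_ (ev c)) hc; apply: npc.
  have [|g Qg eg] := hc.
    exists (pconst (pring R s) r c); last by rewrite Fc.
    by move: pc; rewrite -cQ.
  rewrite -cQ /=; last exact: ltnW.
  rewrite -(subrK g (pconst _ _ c)); apply: idealD => //.
    by apply: prime_is_ideal; apply: pQ; apply: ltnW.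
  by apply: kQ; [apply: ltnW|rewrite rmorphB Fc eg subrr].
exists (fun i : 'I_n.+1 => P' i); first by move=> i; apply: pP'; rewrite -ltnS.
move=> i j; case: j => j /= lj; elim: j lj => // j IH lj.
rewrite ltnS leq_eqVlt => /predU1P[->|ij]; first exact: sP'.
have [h1 h2] := IH (ltnW lj) ij; have [h3 h4] := sP' j lj.
split; first exact: subset_trans h3.
by move=> h5; apply: h4; apply: subset_trans h1.
Qed.

(** The chain of [independent_chain] lives above a prime which contains the kernel of
    [ev], hence [lift_chain] applies. *)
Lemma independent_prime_chain prec s (a : s.-tuple A) : monomial_preorder prec ->
  independent phi prec a -> prime_chain A s.
Proof.
move=> mp ind.
have [ev [evc evv]] := pring_eval s phi (fun i => a`_i).
have [P [pP kP indP]] := initial_prime mp evc evv ind.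
have [Q [M [pQ pM PQ cQ]]] := independent_chain (acc_pring (n := s) aR) pP
  (refinement_preorder mp) (@refinement_total prec) indP.
by apply: (lift_chain evc pQ pM _ cQ) => g /kP/PQ.
Qed.

End Lift.

(** * Suprema of sets of natural numbers *)

Section Suprema.
Implicit Types (S : set nat).

(** It is the maximum for a bounded set, and infinity otherwise. *)
Lemma nat_sup_supremums S : S !=set0 ->
  supremums [set (n%:Z)%:E%E | n in S] !=set0.
Proof.
move=> [n0 Sn0]; have [[N hN]|unb] := pselect (exists N, forall n, S n -> (n <= N)%N).
  have ex : exists n, `[< S n >] by exists n0; apply/asboolP.
  have bd n : `[< S n >] -> (n <= N)%N by move=> /asboolP/hN.
  have [m /asboolP Sm mmax] := ex_maxnP ex bd.
  exists (m%:Z)%:E%E; split; last by move=> u; apply; exists m.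
  by move=> _ [n Sn <-]; rewrite lee_fin lez_nat; apply: mmax; apply/asboolP.
exists +oo%E; split; first by move=> x _; apply: leey.
move=> [r| |] hu; [|by []|by have := hu _ (imageP _ Sn0)].
case: unb; exists `|r|%N => n Sn.
have := hu _ (imageP _ Sn); rewrite lee_fin => nr; lia.
Qed.

Lemma le_nat_sup S n : S n -> ((n%:Z)%:E <= nat_sup S)%E.
Proof.
move=> Sn; apply: ge_supremum_Nmem; last exact: imageP.
by apply: nat_sup_supremums; exists n.
Qed.

Lemma nat_sup_le S (u : \bar int) : (forall n, S n -> ((n%:Z)%:E <= u)%E) ->
  (nat_sup S <= u)%E.
Proof.
move=> h; rewrite /nat_sup /supremum; case: ifPn => [_|/set0P[_ [n Sn _]]].
  exact: leNye.
have ne : S !=set0 by exists n.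
case: xgetP => [y _ [_ ylb]|none]; last first.
  by have [z /none] := nat_sup_supremums ne.
by apply: ylb => _ [m Sm <-]; apply: h.
Qed.

Lemma nat_supS S S' : S `<=` S' -> (nat_sup S <= nat_sup S')%E.
Proof. by move=> h; apply: nat_sup_le => n /h; apply: le_nat_sup. Qed.

End Suprema.

(** * The three implications *)

Lemma degree_preorder :
  monomial_preorder (fun m m' : monomial => (mdeg m < mdeg m')%N).
Proof.
split.
- move=> f g h fg; split; last by move=> gf; have := ltn_trans fg gf; rewrite ltnn.
  by have [fh|hf] := ltnP (mdeg f) (mdeg h); [left|right; apply: leq_ltn_trans fg].
- move=> f nf; rewrite mdeg1 lt0n; apply/eqP => /mdeg_eq0I; exact: nf.
- by move=> f g h; rewrite !mdegM ltn_add2r.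
Qed.

Lemma zero_ring_no_prime (A : comPzRingType) (P : set A) : (1 : A) = 0 -> ~ prime_ideal P.
Proof.
by move=> e pP; apply: (prime1 pP); rewrite e; apply: (ideal0 (prime_is_ideal pP)).
Qed.

Lemma zero_ring_dependent (R A : comPzRingType) (phi : {rmorphism R -> A}) prec s
  (a : s.-tuple A) : monomial_preorder prec -> (1 : A) = 0 -> dependent phi prec a.
Proof.
move=> mp e; have A0 (u : A) : u = 0 by rewrite -[u]mulr1 e mulr0.
have [R0|R1] := eqVneq (1 : R) 0.
  exists 0; split; [by move=> m; rewrite msupp0|exact: A0|].
  by exists mone, 0; rewrite mul0r R0.
exists << 1 *g mone >>; split; [|exact: A0|].
  by move=> m /(fsubsetP msuppU_le); rewrite in_fset1 => /eqP -> i _; rewrite cm1.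
exists mone, 1; rewrite mul1r initial_form_coef -mcoeff_neq0 mcoeffUU R1 /=.
case: asboolP => // h; case: h => m' /(fsubsetP msuppU_le).
by rewrite in_fset1 => /eqP ->; apply: (prec_irr mp).
Qed.

(** Both sides are suprema of the same set, by [chain_independent] and
    [independent_prime_chain]; for the zero ring this set is empty. *)
Lemma jacobson_dimension (R : comPzRingType) : noetherian R -> jacobson R ->
  forall (A : comPzRingType) (phi : {rmorphism R -> A}), subfinite phi ->
  forall prec, monomial_preorder prec ->
  krull_dim A = nat_sup [set s | exists a : s.-tuple A, independent phi prec a].
Proof.
move=> nR jR A phi [B [psi [iota [emb fgB]]]] prec mp.
rewrite /krull_dim; congr nat_sup; apply/seteqP.
have [A0|A1] := eqVneq (1 : A) 0.
  split=> s /= => [[P pP _]|[a ind]].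
    by case: (zero_ring_no_prime A0 (pP ord0)).
  by case: ind; apply: zero_ring_dependent.
have R1 : (1 : R) != 0.
  by apply: contra_neq A1 => h; rewrite -(rmorph1 phi) h rmorph0.
have B1 : (1 : B) != 0.
  apply: contra_neq A1 => h; have [_ inj] := emb; apply: inj.
  by rewrite rmorph1 rmorph0.
have aR := noetherian_acc nR; have {}jR := jacobson_separation jR.
move: phi psi iota emb fgB aR jR; clear nR.
(* From here on the three rings carry the nonzero ring structure. *)
have [R' eR] := nonzero_pz_nz R1; have [A' eA] := nonzero_pz_nz A1.
have [B' eB] := nonzero_pz_nz B1.
clear A1 R1 B1; case: R / eR; case: A / eA; case: B / eB.
move=> phi psi iota emb fgB aR jR; split=> s /=.
  exact: chain_independent.
by move=> [a]; apply: independent_prime_chain emb fgB aR jR _ _ a mp.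
Qed.

Lemma independent_mono (R A B : comPzRingType) (phi : {rmorphism R -> A})
    (psi : {rmorphism R -> B}) (iota : {rmorphism A -> B}) prec s (a : s.-tuple A) :
  alg_embedding phi psi iota -> independent phi prec a ->
  independent psi prec [tuple iota (tnth a i) | i < s].
Proof.
move=> [emb inj] ind [f [vf f0 hf]]; apply: ind; exists f; split=> //.
apply: inj; rewrite rmorph0 -f0 /poly_eval rmorph_sum; apply: eq_bigr => m _.
rewrite rmorphM emb rmorph_prod; congr (_ * _); apply: eq_bigr => i _.
by rewrite rmorphXn tnth_mktuple.
Qed.

(** If [x] is outside [P] but in all the maximal ideals above it, then a prime [Q]
    which is maximal among the ideals above [P] avoiding the powers of [x] is not a maximal
    ideal, and inverting [x] turns [R / Q] into its field of fractions. *)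
Lemma monotone_dimension_jacobson (R : comPzRingType) :
  (forall (A B : comPzRingType) (phi : {rmorphism R -> A})
     (psi : {rmorphism R -> B}) (iota : {rmorphism A -> B}),
     subfinite phi -> subfinite psi -> alg_embedding phi psi iota ->
     (krull_dim A <= krull_dim B)%E) -> jacobson R.
Proof.
have [R0|R1] := eqVneq (1 : R) 0; first by move=> _ P /(zero_ring_no_prime R0).
have [R' eR] := nonzero_pz_nz R1; clear R1; case: R / eR; move: R' => {}R mono_dim.
move=> P pP; exists [set M | maximal_ideal M /\ P `<=` M]; first by move=> M [].
apply/seteqP; split; first by move=> y Py M [_ PM]; apply: PM.
move=> x xM; apply: contrapT => nPx.
have mS : multiplicative [set y : R | exists n, y = x ^+ n].
  split; first by exists 0%N.
  by move=> _ _ [m ->] [n ->]; exists (m + n)%N; rewrite exprD.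
have [|Q [pQ PQ QS Qmax]] := prime_avoiding (prime_is_ideal pP) mS.
  by move=> y Py [n ey]; apply: nPx; apply: (primeX (n := n) pP); rewrite -ey.
have iQ := prime_is_ideal pQ.
have nQx : ~ Q x by move=> Qx; apply: (QS x Qx); exists 1%N.
have [D [K [p [t [ps kp tinj frac]]]]] := residue_field pQ.
have [psi psiE] : exists psi : {rmorphism R -> K}, forall r, psi r = t (p r).
  by exists (t \o p : {rmorphism R -> K}).
have psi0 c : psi c = 0 -> Q c.
  by rewrite psiE => h; apply/kp; apply: tinj; rewrite rmorph0.
(* The fraction [c / d] equals [c * e / x ^+ n] when [x ^+ n = e * d] modulo [Q]. *)
have fgK : fg_algebra psi.
  exists 1%N, [tuple of [:: (psi x)^-1]] => z.
  have [u [v [v0 ->]]] := frac z.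
  have [c ec] := ps u; have [d ed] := ps v.
  have nQd : ~ Q d by move/kp => h; move: v0; rewrite -ed h rmorph0 eqxx.
  have [y [e Qe] [n ey]] := Qmax _ (adj_ideal d iQ) (adj_proper iQ nQd).
  exists << (c * e) *g mkmon 1 (fun=> n) >>.
    move=> m /(fsubsetP msuppU_le); rewrite in_fset1 => /eqP -> i i1.
    by rewrite mkmonE ltnNge i1.
  rewrite poly_eval_mmap mmapU /mono big_ord1 mkmonE /=.
  rewrite (rmorphM psi) -ec -ed -!psiE.
  have nx : psi x != 0 by apply/eqP => /psi0.
  have nd : psi d != 0 by apply/eqP => /psi0.
  have exn : psi x ^+ n = psi e * psi d.
    rewrite -rmorphXn -rmorphM; apply/eqP; rewrite -subr_eq0 -rmorphB -ey.
    by apply/eqP; rewrite psiE; move/kp: Qe => ->; rewrite rmorph0.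
  have ne : psi e != 0.
    apply/eqP => e0; move: exn; rewrite e0 mul0r => /eqP.
    by rewrite expf_eq0 (negbTE nx) andbF.
  have -> : psi c * psi e * (psi x)^-1 ^+ n = psi c / psi d.
    by rewrite exprVn exn invfM mulrA mulfK.
  by [].
have embD : alg_embedding p psi t by split=> // r; rewrite psiE.
have embK : alg_embedding psi psi idfun by split.
have sD : subfinite p by exists K, psi, t.
have sK : subfinite psi by exists K, psi, idfun.
have dimK : (krull_dim K <= 0%:E)%E.
  apply: nat_sup_le => n [P' pP' sP']; case: n => [|n] in P' pP' sP' *; first by [].
  have lt01 : (@ord0 n.+1 < (inord 1 : 'I_n.+2))%N by rewrite inordK.
  have [_ /nsub_witness[z [P1z nP0z]]] := sP' ord0 (inord 1) lt01.
  have z0 : z != 0.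
    by apply/eqP => e; apply: nP0z; rewrite e; apply: (ideal0 (prime_is_ideal (pP' _))).
  case: (prime1 (pP' (inord 1))); rewrite -(mulVf z0).
  by apply: idealM => //; apply: prime_is_ideal.
have [J [iJ QJ nJ1]] : exists J, [/\ is_ideal J, Q `<` J & ~ J 1].
  apply: contrapT => none; apply: nQx; apply: (xM Q); split; last exact: PQ.
  split=> //; first by move=> e; apply: (prime1 pQ); rewrite e.
  move=> J iJ QJ; have [JQ|nJQ] := pselect (J `<=` Q); first by left; apply/seteqP.
  right; apply/seteqP; split=> // y _; rewrite -(mulr1 y); apply: idealM => //.
  by apply: contrapT => nJ1; apply: none; exists J.
have [M [pM JM]] := prime_above iJ nJ1.
have QM : Q `<=` M by apply: subset_trans JM; case: QJ.
have [u [Mu nQu]] : exists u, M u /\ ~ Q u.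
  by case: QJ => _ /nsub_witness[u [Ju nQu]]; exists u; split=> //; apply: JM.
have dimD : prime_chain D 1.
  have kQ y : p y = 0 -> Q y by move/kp.
  have kM y : p y = 0 -> M y by move/kQ/QM.
  exists (fun i : 'I_2 => if i == ord0 then p @` Q else p @` M).
    by move=> i; case: ifP => _; apply: image_prime.
  move=> i j ij; have -> : i = ord0 by apply: val_inj; case: i j ij => [[|i] li] [[|[]] lj].
  have -> : (j == ord0) = false by case: j ij => [[|]].
  rewrite eqxx; split; first by move=> _ [y Qy <-]; exists y => //; apply: QM.
  move=> /(_ (p u)) [|v Qv epv]; first by exists u.
  apply: nQu; rewrite -(subrK v u); apply: idealD => //.
  by apply: kQ; rewrite rmorphB epv subrr.
have h := mono_dim D K p psi t sD sK embD.
have := Order.POrderTheory.le_trans (Order.POrderTheory.le_trans (le_nat_sup dimD) h) dimK.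
by [].
Qed.

Theorem corollary4p9 (R : comPzRingType) (R_noetherian : noetherian R) :
  [<-> jacobson R;
    (forall (A : comPzRingType) (phi : {rmorphism R -> A}),
       subfinite phi ->
       forall prec : monomial -> monomial -> Prop, monomial_preorder prec ->
       krull_dim A =
         nat_sup [set s | exists a : s.-tuple A, independent phi prec a]);
    (forall (A B : comPzRingType) (phi : {rmorphism R -> A})
        (psi : {rmorphism R -> B}) (iota : {rmorphism A -> B}),
       subfinite phi -> subfinite psi -> alg_embedding phi psi iota ->
       (krull_dim A <= krull_dim B)%E)].
Proof.
tfae.
- exact: jacobson_dimension.
- move=> dimE A B phi psi iota sA sB emb.
  rewrite (dimE A phi sA _ degree_preorder) (dimE B psi sB _ degree_preorder).
  by apply: nat_supS => s [a ind]; exists [tuple iota (tnth a i) | i < s];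
    apply: independent_mono emb ind.
- exact: monotone_dimension_jacobson.
Qed.
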